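(* Let $H,U,Y$ be separable Hilbert spaces, let $A$ be the generator of a strongly continuous semigroup $\mathbb{T}=(\mathbb{T}(t))_{t\ge 0}$ on $H$, and let $B\in\mathcal{L}(U,H_{-1})$ and $C\in\mathcal{L}(H_1,Y)$. (i) $C$ is an $\mathcal{S}$-admissible observation operator for $A$ if and only if $C$ is an admissible observation operator for $A$ and $$\int_0^T\|C_\Lambda\mathbb{T}(t)\|_2^2\,dt<\infty$$ for some $T>0$. (ii) $B$ is an $\mathcal{S}$-admissible control operator for $A$ if and only if $B^*$ is an $\mathcal{S}$-admissible observation operator for $A^*$. (iii) $B$ is an $\mathcal{S}$-admissible control operator for $A$ if and only if $B^*$ is an admissible observation operator for $A^*$ and $$\int_0^T\|B^*_\Lambda\mathbb{T}^*(t)\|_2^2\,dt<\infty$$ for some $T>0$.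
   Context: Spaces. $H_1$ is $D(A)$ with norm $\|(\beta-A)x\|$ ($\beta\in\rho(A)$ fixed), and $H_{-1}$ is the completion of $H$ for the norm $\|R(\beta,A)x\|$, where $R(\beta,A)=(\beta-A)^{-1}$. The semigroup $\mathbb{T}$ extends to a strongly continuous semigroup $\mathbb{T}_{-1}$ on $H_{-1}$, whose generator $A_{-1}$ extends $A$ and has domain $H$. $H_1^d$ is $D(A^* )$ with norm $\|(\bar\beta-A^* )x\|$, and $H_{-1}$ is identified with the dual of $H_1^d$ with respect to the pivot space $H$; hence for $B\in\mathcal{L}(U,H_{-1})$ the adjoint is $B^*\in\mathcal{L}(H_1^d,U)$. $\mathbb{T}^*=(\mathbb{T}(t)^* )_{t\ge0}$ is the semigroup generated by $A^*$. $\|\cdot\|_2$ denotes the Hilbert–Schmidt norm. Admissibility. $C\in\mathcal{L}(H_1,Y)$ is an admissible observation operator for $A$ if for some (hence all) $\alpha>0$ there is $\gamma>0$ with $\int_0^\alpha\|C\mathbb{T}(t)x\|^2dt\le\gamma^2\|x\|^2$ for all $x\in D(A)$. $\mathcal{S}$-admissibility. Let $T>0$. For $C\in\mathcal{L}(H_1,Y)$ the output map is $(\Psi_Tx)(t)=C\mathbb{T}(t)x$, $x\in D(A)$, $t\in[0,T]$. $C$ is an $\mathcal{S}$-admissible observation operator for $A$ if $\Psi_T$ has an extension to a Hilbert–Schmidt operator from $H$ into $L^2(0,T;Y)$. For $B\in\mathcal{L}(U,H_{-1})$ the input map is $\Phi_Tu=\int_0^T\mathbb{T}_{-1}(T-s)Bu(s)\,ds$,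 $u\in L^2(0,T;U)$ (integral in $H_{-1}$). $B$ is an $\mathcal{S}$-admissible control operator for $A$ if $\Phi_T$ defines a Hilbert–Schmidt operator from $L^2(0,T;U)$ into $H$. The same definitions apply with $A$, $C$, $Y$ replaced by $A^*$, $B^*$, $U$. (These $\mathcal{S}$-admissibility properties do not depend on the choice of $T>0$.) Yosida extension. $C_\Lambda x=\lim_{\lambda\to+\infty}C\lambda R(\lambda,A)x$ for $x\in D(C_\Lambda)=\{x\in H:\ \text{this limit exists in }Y\}$. If $C$ is admissible for $A$, then for every $x\in H$ one has $\mathbb{T}(t)x\in D(C_\Lambda)$ for a.e. $t>0$, and the bounded extension of $\Psi_T$ satisfies $(\Psi_Tx)(t)=C_\Lambda\mathbb{T}(t)x$ for a.e. $t\in(0,T]$. The quantity $\|C_\Lambda\mathbb{T}(t)\|_2^2$ is understood as $\sum_k\|C_\Lambda\mathbb{T}(t)e_k\|^2\in[0,\infty]$ (defined for a.e. $t$) for an orthonormal basis $(e_k)$ of $H$. $B^*_\Lambda$ is the Yosida extension of $B^*$ with respect to $A^*$, i.e. $B^*_\Lambda x=\lim_{\lambda\to+\infty}B^*\lambda R(\lambda,A^* )x$. *)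

(* Defs.v *)
From HB Require Import structures.
From mathcomp Require Import all_boot all_order all_algebra.
From mathcomp Require Import complex.
From mathcomp Require Import all_classical all_reals all_analysis.

Set Implicit Arguments.
Unset Strict Implicit.
Unset Printing Implicit Defensive.

Import Order.TTheory GRing.Theory Num.Theory numFieldNormedType.Exports.

Local Open Scope classical_set_scope.
Local Open Scope complex_scope.
Local Open Scope ring_scope.

(* The library norm of a normed module over R[i] takes its values in R[i]. *)
Definition rnorm {R : realType} {V : normedModType R[i]} (x : V) : R :=
  complex.Re `|x|.

Definition separable (V : topologicalType) : Prop :=
  exists2 D : set V, countable D & dense D.

(* Complex Hilbert spaces; the inner product is linear in its first argument. *)
HB.mixin Record CompleteNormedModule_isHilbert (R : realType) V
    of CompleteNormedModule R[i] V := {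
  inner : {dot V for (@Num.conj R[i])};
  inner_normE : forall x : V, inner x x = `|x| ^+ 2
}.

#[short(type="hilbertType")]
HB.structure Definition Hilbert (R : realType) :=
  {V of CompleteNormedModule_isHilbert R V & CompleteNormedModule R[i] V}.

(* A semi-inner-product space given by representatives: the vectors of the    *)
(* space are the elements of sip_dom, two of them being identified when the   *)
(* seminorm of their difference is 0.                                         *)
Record sipSpace (R : realType) := SipSpace {
  sip_car :> lmodType R[i];
  sip_dom : set sip_car;
  sip_dot : sip_car -> sip_car -> R[i] }.
Arguments sip_dom {R} s.
Arguments sip_dot {R} s.

Section SemiInnerProduct.
Context {R : realType}.

Definition sip_norm (V : sipSpace R) (v : V) : R :=
  Num.sqrt (complex.Re (sip_dot V v v)).

Definition orthonormal_basis (V : sipSpace R) (E : set V) : Prop :=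
  [/\ E `<=` sip_dom V,
      forall e f, E e -> E f -> sip_dot V e f = (e == f)%:R
    & forall v, sip_dom V v -> forall eps : R, 0 < eps ->
        exists (n : nat) (c : 'I_n -> R[i]) (e : 'I_n -> V),
          (forall i, E (e i)) /\ sip_norm (v - \sum_i c i *: e i) < eps].

Definition bounded_operator (V W : sipSpace R) (F : V -> W) : Prop :=
  [/\ forall v, sip_dom V v -> sip_dom W (F v),
      forall (a : R[i]) u v, sip_dom V u -> sip_dom V v ->
        sip_norm (F (a *: u + v) - (a *: F u + F v)) = 0
    & exists M : R, forall v, sip_dom V v -> sip_norm (F v) <= M * sip_norm v].

Definition hilbert_schmidt (V W : sipSpace R) (F : V -> W) : Prop :=
  bounded_operator F /\
  exists2 E : set V, orthonormal_basis E
    & (\esum_(e in E) (sip_norm (F e) ^+ 2)%:E < +oo)%E.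

Definition sip_of (H : hilbertType R) : sipSpace R :=
  @SipSpace R H setT (@inner R H).

End SemiInnerProduct.

(* Functions of t in [0, T], represented as functions on R. *)
Section VectorIntegration.
Context {R : realType}.
Local Notation mu := (@lebesgue_measure R).

Definition simple {V : normedModType R[i]} (s : R -> V) : Prop :=
  finite_set (range s) /\
  forall v, measurable (s @^-1` [set v] : set (measurableTypeR R)).

Definition simple_integral {V : normedModType R[i]} (T : R) (s : R -> V) : V :=
  \sum_(v \in range s) (fine (mu (`[0, T]%classic `&` s @^-1` [set v])))%:C *: v.

Definition strongly_measurable {V : normedModType R[i]} (T : R) (f : R -> V) :
    Prop :=
  exists2 s : nat -> R -> V, (forall n, simple (s n))
    & forall t, t \in `[0, T] -> s n t @[n --> \oo] --> f t.

Definition is_bochner_integral {V : normedModType R[i]} (T : R) (f : R -> V)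
    (z : V) : Prop :=
  strongly_measurable T f /\
  exists s : nat -> R -> V,
    [/\ forall n, simple (s n),
        (\int[mu]_(t in `[0%R, T]) (rnorm (f t - s n t))%:E)%E
          @[n --> \oo] --> 0%E
      & simple_integral T (s n) @[n --> \oo] --> z].

Definition bochner_integral {V : normedModType R[i]} (T : R) (f : R -> V) : V :=
  xget 0 [set z | is_bochner_integral T f z].

Definition sqnorm_integral {V : normedModType R[i]} (T : R) (f : R -> V) :
    \bar R :=
  (\int[mu]_(t in `[0%R, T]) (rnorm (f t) ^+ 2)%:E)%E.

Definition L2 (T : R) (Y : hilbertType R) : sipSpace R :=
  @SipSpace R (R -> Y)
    [set f | strongly_measurable T f /\ (sqnorm_integral T f < +oo)%E]
    (fun f g =>
       (Rintegral mu `[0, T]%classic (fun t => complex.Re (inner (f t) (g t)))) +i*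
       (Rintegral mu `[0, T]%classic (fun t => complex.Im (inner (f t) (g t))))).

End VectorIntegration.

(* The values of an operator outside its domain are irrelevant. *)
Record partialOp (V W : Type) := PartialOp {
  dom : set V;
  pop :> V -> W }.

Section Operators.
Context {R : realType}.

Definition C0_semigroup (H : normedModType R[i]) (S : R -> H -> H) : Prop :=
  [/\ forall t, 0 <= t -> linear (S t) /\ continuous (S t),
      forall x, S 0 x = x,
      forall s t x, 0 <= s -> 0 <= t -> S (s + t) x = S s (S t x)
    & forall x, S t x @[t --> 0^'+] --> x].

Definition is_generator (H : normedModType R[i]) (S : R -> H -> H)
    (A : partialOp H H) : Prop :=
  (forall x, dom A x <->
     exists y : H, (h^-1)%:C *: (S h x - x) @[h --> 0^'+] --> y) /\
  (forall x, dom A x -> (h^-1)%:C *: (S h x - x) @[h --> 0^'+] --> A x).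

Definition resolvent_set (H : normedModType R[i]) (A : partialOp H H) :
    set R[i] :=
  [set z | (forall y, exists! x, dom A x /\ z *: x - A x = y) /\
           exists M : R, forall x, dom A x ->
             rnorm x <= M * rnorm (z *: x - A x)].

Definition resolvent (H : normedModType R[i]) (A : partialOp H H) (z : R[i])
    (y : H) : H :=
  xget 0 [set x | dom A x /\ z *: x - A x = y].

Definition adjoint (V W : hilbertType R) (A : partialOp V W) : partialOp W V :=
  @PartialOp W V
    [set y | exists z, forall x, dom A x -> inner (A x) y = inner x z]
    (fun y => xget 0 [set z | forall x, dom A x -> inner (A x) y = inner x z]).

Definition adjoint_semigroup (H : hilbertType R) (S : R -> H -> H) :
    R -> H -> H :=
  fun t => adjoint (PartialOp setT (S t)).

(* C in L(H_1, Y), where H_1 is D(A) with the norm |(beta - A) x|. *)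
Definition bounded_on_H1 (H Y : normedModType R[i]) (A : partialOp H H)
    (beta : R[i]) (C : H -> Y) : Prop :=
  (forall (a : R[i]) x y, dom A x -> dom A y ->
     C (a *: x + y) = a *: C x + C y) /\
  exists M : R, forall x, dom A x -> rnorm (C x) <= M * rnorm (beta *: x - A x).

(* j : H -> Hm1 exhibits Hm1 as the completion H_{-1} of H. *)
Definition is_extrapolation_space (H : normedModType R[i])
    (Hm1 : completeNormedModType R[i]) (A : partialOp H H) (beta : R[i])
    (j : H -> Hm1) : Prop :=
  (forall x, rnorm (j x) = rnorm (resolvent A beta x)) /\ dense (range j).

(* Continuous extension of f along the dense map j. *)
Definition dense_extension (X : Type) (Z W : normedModType R[i]) (j : X -> Z)
    (f : X -> W) (z : Z) : W :=
  xget 0 [set w | forall x : nat -> X,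
    j (x n) @[n --> \oo] --> z -> f (x n) @[n --> \oo] --> w].

Definition extrapolated_semigroup (H Hm1 : normedModType R[i]) (j : H -> Hm1)
    (S : R -> H -> H) : R -> Hm1 -> Hm1 :=
  fun t => dense_extension j (fun x => j (S t x)).

(* Duality pairing of H_{-1} with H_1^d = D(A^* ) with respect to the pivot   *)
(* space H: the continuous extension of <x, y>_H in x, for y in D(A^* ).      *)
Definition pivot_pairing (H : hilbertType R) (Hm1 : normedModType R[i])
    (j : H -> Hm1) (z : Hm1) (y : H) : R[i] :=
  dense_extension (W := R[i]^o) j (fun x => inner x y) z.

(* B^* in L(H_1^d, U) for B in L(U, H_{-1}); meaningful on D(A^* ) only. *)
Definition control_adjoint (H U : hilbertType R) (Hm1 : normedModType R[i])
    (j : H -> Hm1) (B : U -> Hm1) (y : H) : U :=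
  xget 0 [set v | forall u, pivot_pairing j (B u) y = inner u v].

Definition yosida (H Y : normedModType R[i]) (A : partialOp H H) (C : H -> Y) :
    partialOp H Y :=
  let u (x : H) (l : R) := C (l%:C *: resolvent A l%:C x) in
  @PartialOp H Y [set x | cvg (u x l @[l --> +oo])]
                 (fun x => lim (u x l @[l --> +oo])).

End Operators.

Section Admissibility.
Context {R : realType}.
Local Notation mu := (@lebesgue_measure R).

Definition admissible_obs (H Y : normedModType R[i]) (S : R -> H -> H)
    (A : partialOp H H) (C : H -> Y) : Prop :=
  exists2 alpha : R, 0 < alpha & exists2 gamma : R, 0 < gamma &
    forall x, dom A x ->
      (sqnorm_integral alpha (fun t => C (S t x))
         <= (gamma ^+ 2 * rnorm x ^+ 2)%:E)%E.

Definition S_admissible_obs (H Y : hilbertType R) (S : R -> H -> H)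
    (A : partialOp H H) (C : H -> Y) (T : R) : Prop :=
  exists2 Psi : H -> R -> Y, hilbert_schmidt (V := sip_of H) (W := L2 T Y) Psi
    & forall x, dom A x ->
        {ae mu, forall t, t \in `[0, T] -> Psi x t = C (S t x)}.

Definition input_map (H U : hilbertType R) (Hm1 : normedModType R[i])
    (j : H -> Hm1) (S : R -> H -> H) (B : U -> Hm1) (T : R) (u : R -> U) : Hm1 :=
  bochner_integral T (fun s => extrapolated_semigroup j S (T - s) (B (u s))).

Definition S_admissible_ctrl (H U : hilbertType R) (Hm1 : normedModType R[i])
    (j : H -> Hm1) (S : R -> H -> H) (B : U -> Hm1) (T : R) : Prop :=
  exists2 Phi : (R -> U) -> H,
      hilbert_schmidt (V := L2 T U) (W := sip_of H) Phi
    & forall u, sip_dom (L2 T U) u -> j (Phi u) = input_map j S B T u.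

(* int_0^T |C_Lambda S(t)|_2^2 dt, computed with the orthonormal basis E. *)
Definition yosida_HS_integral (H Y : normedModType R[i]) (S : R -> H -> H)
    (A : partialOp H H) (C : H -> Y) (E : set H) (T : R) : \bar R :=
  (\int[mu]_(t in `[0%R, T])
     \esum_(e in E) (rnorm (yosida A C (S t e)) ^+ 2)%:E)%E.

End Admissibility.

(* Main.v *)
Require Import Defs.
From HB Require Import structures.
From mathcomp Require Import all_boot all_order all_algebra.
From mathcomp Require Import complex.
From mathcomp Require Import all_classical all_reals all_analysis.
From mathcomp Require Import measurable_realfun.
From mathcomp Require Import ring lra.

Set Implicit Arguments.
Unset Strict Implicit.
Unset Printing Implicit Defensive.

Import Order.TTheory GRing.Theory Num.Theory numFieldNormedType.Exports.

Local Open Scope classical_set_scope.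
Local Open Scope complex_scope.
Local Open Scope ring_scope.

(* For (i), the output map Psi of an admissible C is t |-> C_Lambda T(t) x for almost every t *)
(* (Weiss: C lambda R(lambda, A) T(t) x is an Abel mean of Psi x near t), so Tonelli turns   *)
(* the integral of |C_Lambda T(t)|_2^2 into the sum of |Psi e|^2 over an orthonormal basis;   *)
(* the independence of T follows by gluing Psi x on [0, T] to Psi (T(T) x) on [T, 2 T].      *)
(* For (ii), the isometry J from H_{-1} onto H extending R(beta, A) conjugates T_{-1} to T    *)
(* and turns B into a bounded operator b; then B^* y = b^* (beta^* y - A^* y), and the input  *)
(* map is the adjoint of the output map of (A^*, B^* ) up to reversal of time.  An operator   *)
(* and its adjoint have the same Hilbert-Schmidt norm.                                       *)

(** (i) An output map [Psi] agrees with [C (S t x)] only for x in D(A) and only for almost every t,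
    so the link with C_Lambda has to be made through integrals. For every x, [output_rdotE] equates
    the Laplace integral of [Psi x] from time t on with C applied to the Laplace integral of the
    orbit of [S t x] over [0, T - t]: both depend continuously on x, and they agree on the dense
    domain of A. By [resolvent_laplace] the latter integral is the resolvent at [S t x] up to a tail
    with the factor e^(-l(T - t)), which beats the linear growth in l of C R(l, A)
    ([obs_resolvent_le]). Hence C l R(l, A) S(t) x is, up to a vanishing term, an Abel mean of
    [Psi x] to the right of t, and it tends to [Psi x t] at each Lebesgue point
    ([lebesgue_point_L2], [abel_laplace_cvg0], [yosida_orbit_cvg]). An orthonormal basis of the
    separable space H is countable, so almost every t works for all basis vectors at once, and
    Tonelli gives [yosida_HS_integralE]: the integral of |C_Lambda S(t)|_2^2 is the squared
    Hilbert-Schmidt norm of [Psi]. Conversely admissibility provides a bounded [Psi] by density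
    ([bounded_operator_extend]), on a window that [S_admissible_obs_indep] then replaces by [0, T].

    (ii) The isometry of [extrapolation_isometry] moves the input map from H_{-1} into H, where the
    Bochner integral becomes a weak integral ([bochner_integralE]). [input_map_factorP] then says
    that Phi represents the input map exactly when its pairing with each y in the domain of the
    adjoint of A is the L2 pairing of the input with the time-reversed output of y. So Phi and the
    dual output map are obtained from each other by taking an adjoint and reversing time
    ([S_admissible_ctrlP]), and [esum_sqr_adjoint] preserves the Hilbert-Schmidt sum.

    (iii) The adjoint semigroup is strongly continuous and is generated by the adjoint of A
    ([adjoint_sg_C0], [adjoint_is_generator]), so (i) applies to the dual data and combines with
    (ii).

    The elements of [L2] are functions, not classes: operators into it are linear, and equal, only
    up to vectors of norm 0. The Hilbert space arguments are therefore carried out for the structure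
    [hilbert_sip], which covers both H and [L2]. *)

Section RNorm.
Context {R : realType} {V : normedModType R[i]}.
Implicit Types (x y : V) (a : R[i]) (r : R).

Lemma rnormE x : `|x| = (rnorm x)%:C.
Proof. by rewrite /rnorm RRe_real// normr_real. Qed.

Lemma rnorm_ge0 x : 0 <= rnorm x.
Proof. by rewrite -ler0c -rnormE. Qed.

Lemma rnorm0 : rnorm (0 : V) = 0.
Proof. by rewrite /rnorm normr0. Qed.

Lemma rnorm_eq0 x : rnorm x = 0 -> x = 0.
Proof. by move=> x0; apply/normr0_eq0; rewrite rnormE x0. Qed.

Lemma rnormN x : rnorm (- x) = rnorm x.
Proof. by rewrite /rnorm normrN. Qed.

Lemma rnormC x y : rnorm (x - y) = rnorm (y - x).
Proof. by rewrite -rnormN opprB. Qed.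

Lemma rnormD x y : rnorm (x + y) <= rnorm x + rnorm y.
Proof. by rewrite -lecR rmorphD/= -!rnormE ler_normD. Qed.

Lemma rnormB x y : rnorm (x - y) <= rnorm x + rnorm y.
Proof. by rewrite (le_trans (rnormD _ _))// rnormN. Qed.

Lemma rnorm_triangle x y z : rnorm (x - z) <= rnorm (x - y) + rnorm (y - z).
Proof. by rewrite -[x - z](subrKA y) (le_trans (rnormD _ _)). Qed.

Lemma rnorm_dist x y : `|rnorm x - rnorm y| <= rnorm (x - y).
Proof.
have := rnormD (x - y) y; have := rnormD (y - x) x.
rewrite !subrK (rnormC y) => h1 h2; rewrite ler_norml; apply/andP; split; lra.
Qed.

Lemma rnormZ a x : rnorm (a *: x) = rnorm (a : R[i]^o) * rnorm x.
Proof. by apply: complexI; rewrite rmorphM/= -!rnormE normrZ. Qed.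

Lemma rnorm_real r : rnorm (r%:C : R[i]^o) = `|r|.
Proof. by rewrite /rnorm normc_def /= expr0n /= addr0 sqrtr_sqr. Qed.

Lemma rnormZr r x : rnorm (r%:C *: x) = `|r| * rnorm x.
Proof. by rewrite rnormZ rnorm_real. Qed.

Lemma cvg_rnormP {T : Type} {F : set_system T} {FF : Filter F} (f : T -> V) l :
  f @ F --> l <-> forall e : R, 0 < e -> \forall x \near F, rnorm (f x - l) < e.
Proof.
split => [/cvgrPdist_lt h e e0|h].
  have /h : 0 < e%:C by rewrite ltcR.
  by apply: filterS => t; rewrite rnormE ltcR rnormC.
apply/cvgrPdist_lt => e e0.
have eE : e = (complex.Re e)%:C by rewrite RRe_real// gtr0_real.
have e0' : 0 < complex.Re e by rewrite -ltcR -eE.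
by apply: filterS (h _ e0') => t; rewrite eE rnormE ltcR rnormC.
Qed.

Lemma cvg_rnorm0P {T : Type} {F : set_system T} {FF : Filter F} (f : T -> V) l :
  f @ F --> l <-> rnorm (f x - l) @[x --> F] --> (0 : R).
Proof.
rewrite cvg_rnormP; split => [h|/cvgrPdist_lt h e /h].
  apply/cvgrPdist_lt => e /h; apply: filterS => t.
  by rewrite sub0r normrN ger0_norm// rnorm_ge0.
by apply: filterS => t; rewrite sub0r normrN ger0_norm// rnorm_ge0.
Qed.

Lemma cvg_rnorm {T : Type} {F : set_system T} {FF : Filter F} (f : T -> V) l :
  f @ F --> l -> rnorm (f x) @[x --> F] --> rnorm l.
Proof.
move=> /cvg_rnormP h; apply/cvgrPdist_lt => e /h; apply: filterS => t.
by apply: le_lt_trans; rewrite rnormC rnorm_dist.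
Qed.

Lemma rnorm_squeeze {T : Type} {F : set_system T} {FF : Filter F} (f : T -> V) l
    (g : T -> R) :
  (\forall x \near F, rnorm (f x - l) <= g x) -> g @ F --> (0 : R) -> f @ F --> l.
Proof.
move=> fg g0; apply/cvg_rnorm0P.
apply: (@squeeze_cvgr _ _ _ _ (cst 0) g) => //; last exact: cvg_cst.
by apply: filterS fg => t ->; rewrite rnorm_ge0.
Qed.

End RNorm.

(* With ratio 1/2 the tails of the geometric series are explicit. *)
Lemma geometric_cauchy_cvg {R : realType} {V : completeNormedModType R[i]}
    (x : nat -> V) (c : R) :
  (forall n, rnorm (x n.+1 - x n) <= c * 2^-1 ^+ n) ->
  exists2 l, x @ \oo --> l & forall n, rnorm (x n - l) <= 2 * c * 2^-1 ^+ n.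
Proof.
move=> xc.
have xnk n k : rnorm (x (n + k)%N - x n) <= 2 * c * (2^-1 ^+ n - 2^-1 ^+ (n + k)).
  elim: k => [|k IH]; first by rewrite addn0 !subrr mulr0 rnorm0.
  have := rnorm_triangle (x (n + k).+1) (x (n + k)%N) (x n).
  have := xc (n + k)%N; rewrite addnS exprS; move: IH.
  set p := _ ^+ (n + k); move=> *; lra.
have c0 : 0 <= c by have := xc 0%N; rewrite expr0 mulr1; apply: le_trans; exact: rnorm_ge0.
have p0 n : 0 <= (2^-1 : R) ^+ n by rewrite exprn_ge0.
have xnk' n k : rnorm (x (n + k)%N - x n) <= 2 * c * 2^-1 ^+ n.
  by rewrite (le_trans (xnk n k))// ler_wpM2l ?mulr_ge0// gerBl.
have g0 : (2 * c * 2^-1 ^+ n) @[n --> \oo] --> (0 : R).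
  rewrite -(mulr0 (2 * c)); apply: cvgM; first exact: cvg_cst.
  by apply: cvg_expr; rewrite ger0_norm// invf_lt1// ltr1n.
have : cvg (x @ \oo).
  apply/cauchy_cvgP/cauchy_exP => e e0.
  have eE : e = (complex.Re e)%:C by rewrite RRe_real// gtr0_real.
  have e0' : 0 < complex.Re e by rewrite -ltcR -eE.
  have [N _ hN] := (cvgrPdist_lt _ _).1 g0 _ e0'.
  exists (x N); exists N => // n /= Nn.
  rewrite -ball_normE /= eE rnormE ltcR rnormC -(subnKC Nn).
  rewrite (le_lt_trans (xnk' _ _))//.
  by have := hN N (leqnn N); rewrite sub0r normrN; apply: le_lt_trans; rewrite ler_norm.
move=> /cvg_ex[l xl]; exists l => // n.
have h : rnorm (x (n + k)%N - x n) @[k --> \oo] --> rnorm (l - x n).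
  apply: cvg_rnorm; apply: cvgB; last exact: cvg_cst.
  by rewrite (_ : (fun k => _) = [sequence x (k + n)%N]_k) ?cvg_shiftn//; apply/funext => k; rewrite /= addnC.
rewrite rnormC.
apply: (cvgr_to_le h).
by apply: nearW => k; exact: xnk'.
Qed.

(** * Hilbert spaces of representatives: Cauchy-Schwarz, Riesz, orthogonality and density *)

Section HilbertSip.
Context {R : realType}.

(** The Hilbert space axioms on the domain of a [sipSpace], where a nonzero vector may have norm 0.
    Completeness is asked for sequences with increments of order 8^-n: minimising sequences can be
    chosen that fast, and in [L2] the rate leaves room for the weights 4^n of [L2_complete]. *)
Record hilbert_sip (V : sipSpace R) : Prop := HilbertSip {
  hs_dom0 : sip_dom V 0;
  hs_domP : forall a u v, sip_dom V u -> sip_dom V v -> sip_dom V (a *: u + v);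
  hs_dotP : forall a u v w, sip_dom V u -> sip_dom V v -> sip_dom V w ->
    sip_dot V (a *: u + v) w = a * sip_dot V u w + sip_dot V v w;
  hs_dotC : forall u v, sip_dom V u -> sip_dom V v ->
    sip_dot V v u = (sip_dot V u v)^*%C;
  hs_dot_ge0 : forall u, sip_dom V u -> 0 <= complex.Re (sip_dot V u u);
  hs_complete : forall (f : nat -> V) (c : R), (forall n, sip_dom V (f n)) ->
    (forall n, sip_norm (f n.+1 - f n) <= c * 8^-1 ^+ n) ->
    exists2 l, sip_dom V l & sip_norm (f n - l) @[n --> \oo] --> (0 : R) }.

(** Order arguments are made with this real inner product; the complex one is recovered by also
    testing with the vector multiplied by i, as in [sip_dot_eq]. *)
Definition sip_rdot (V : sipSpace R) (u v : V) : R := complex.Re (sip_dot V u v).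

Section Theory.
Variables (V : sipSpace R) (hV : hilbert_sip V).
Local Notation dom := (sip_dom V).
Local Notation rd := (@sip_rdot V).
Local Notation N := (@sip_norm R V).
Implicit Types (u v w : V) (r : R).

Lemma hs_domD u v : dom u -> dom v -> dom (u + v).
Proof. by move=> du dv; rewrite -[u]scale1r; exact: hs_domP. Qed.

Lemma hs_domZ a u : dom u -> dom (a *: u).
Proof. by move=> du; rewrite -[_ *: _]addr0; apply: hs_domP => //; exact: hs_dom0. Qed.

Lemma hs_domN u : dom u -> dom (- u).
Proof. by move=> du; rewrite -scaleN1r; exact: hs_domZ. Qed.

Lemma hs_domB u v : dom u -> dom v -> dom (u - v).
Proof. by move=> du dv; apply: hs_domD => //; exact: hs_domN. Qed.

Lemma sip_dotDl u v w : dom u -> dom v -> dom w ->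
  sip_dot V (u + v) w = sip_dot V u w + sip_dot V v w.
Proof. by move=> du dv dw; rewrite -[u in LHS]scale1r hs_dotP// mul1r. Qed.

Lemma sip_dot0l w : dom w -> sip_dot V 0 w = 0.
Proof.
move=> dw; have := sip_dotDl (hs_dom0 hV) (hs_dom0 hV) dw.
by rewrite addr0 -{1}[sip_dot V 0 w]addr0 => /addrI <-.
Qed.

Lemma sip_dotZl a u w : dom u -> dom w -> sip_dot V (a *: u) w = a * sip_dot V u w.
Proof.
move=> du dw; rewrite -[a *: u]addr0 hs_dotP//; last exact: hs_dom0.
by rewrite sip_dot0l// addr0.
Qed.

Lemma sip_rdotC u v : dom u -> dom v -> rd u v = rd v u.
Proof. by move=> du dv; rewrite /sip_rdot (hs_dotC hV dv du); case: (sip_dot V v u). Qed.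

Lemma sip_rdotDl u v w : dom u -> dom v -> dom w -> rd (u + v) w = rd u w + rd v w.
Proof. by move=> du dv dw; rewrite /sip_rdot sip_dotDl// raddfD. Qed.

Lemma sip_rdotZl r u w : dom u -> dom w -> rd (r%:C *: u) w = r * rd u w.
Proof.
move=> du dw; rewrite /sip_rdot sip_dotZl//.
by case: (sip_dot V u w) => a b /=; rewrite mul0r subr0.
Qed.

Lemma sip_rdotNl u w : dom u -> dom w -> rd (- u) w = - rd u w.
Proof.
move=> du dw; rewrite -scaleN1r (_ : -1 = (-1)%:C); last by rewrite rmorphN1.
by rewrite sip_rdotZl// mulN1r.
Qed.

Lemma sip_rdotBl u v w : dom u -> dom v -> dom w -> rd (u - v) w = rd u w - rd v w.
Proof.
by move=> du dv dw; rewrite sip_rdotDl// ?sip_rdotNl//; exact: hs_domN.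
Qed.

Lemma sip_rdotDr u v w : dom u -> dom v -> dom w -> rd w (u + v) = rd w u + rd w v.
Proof.
move=> du dv dw; rewrite sip_rdotC//; last exact: hs_domD.
by rewrite sip_rdotDl// !(sip_rdotC dw).
Qed.

Lemma sip_rdotZr r u w : dom u -> dom w -> rd w (r%:C *: u) = r * rd w u.
Proof.
move=> du dw; rewrite sip_rdotC//; last exact: hs_domZ.
by rewrite sip_rdotZl// (sip_rdotC dw).
Qed.

Lemma sip_rdotBr u v w : dom u -> dom v -> dom w -> rd w (u - v) = rd w u - rd w v.
Proof.
move=> du dv dw; rewrite sip_rdotC//; last exact: hs_domB.
by rewrite sip_rdotBl// !(sip_rdotC dw).
Qed.

Lemma sip_norm_ge0 u : 0 <= N u. Proof. exact: sqrtr_ge0. Qed.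

Lemma sip_normE u : dom u -> N u ^+ 2 = rd u u.
Proof. by move=> du; rewrite sqr_sqrtr//; exact: hs_dot_ge0. Qed.

Lemma sip_rdotii r u v : dom u -> dom v ->
  rd (r%:C *: u + v) (r%:C *: u + v) = r ^+ 2 * rd u u + 2 * r * rd u v + rd v v.
Proof.
move=> du dv; have dru : dom (r%:C *: u) by exact: hs_domZ.
rewrite sip_rdotDl// ?sip_rdotDr//; last exact: hs_domD.
rewrite (sip_rdotC dv dru) !sip_rdotZl// sip_rdotZr//; ring.
Qed.

Lemma sip_normDsq u v : dom u -> dom v ->
  N (u + v) ^+ 2 = N u ^+ 2 + 2 * rd u v + N v ^+ 2.
Proof.
move=> du dv; rewrite !sip_normE//; last exact: hs_domD.
by have := sip_rdotii 1 du dv; rewrite scale1r => ->; rewrite expr1n mul1r mulr1.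
Qed.

(** The quadratic r -> |r u + v|^2 is nonnegative. The case of norm 0 does not force u to be 0 and
    is treated apart. *)
Lemma sip_CS u v : dom u -> dom v -> `|rd u v| <= N u * N v.
Proof.
move=> du dv.
have h (r : R) : 0 <= r ^+ 2 * N u ^+ 2 + 2 * r * rd u v + N v ^+ 2.
  rewrite !sip_normE// -sip_rdotii//; apply: (hs_dot_ge0 hV).
  by apply: (hs_domP hV).
rewrite -[X in _ <= X]ger0_norm ?mulr_ge0 ?sip_norm_ge0//.
rewrite -ler_sqr ?nnegrE// !real_normK ?num_real// exprMn.
have [Nu0|Nu0] := eqVneq (N u) 0.
  have [->|r0] := eqVneq (rd u v) 0; first by rewrite expr0n mulr_ge0// sqr_ge0.
  (* Here the quadratic is affine in r, and this r gives it the value -1. *)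
  have := h (- (N v ^+ 2 + 1) / (2 * rd u v)).
  rewrite Nu0 expr0n/= mulr0 add0r.
  rewrite (_ : 2 * _ * rd u v = - (N v ^+ 2 + 1)); last by field.
  by rewrite addrC; have := ltr01 (R := R); lra.
have Nup : 0 < N u ^+ 2 by rewrite exprn_gt0// lt_neqAle eq_sym Nu0 sip_norm_ge0.
(* The minimiser of the quadratic. *)
have := h (- rd u v / N u ^+ 2).
rewrite (_ : _ + _ = N v ^+ 2 - rd u v ^+ 2 / N u ^+ 2); last by field.
by rewrite subr_ge0 ler_pdivrMr// mulrC.
Qed.

Lemma sip_rdot_le u v : dom u -> dom v -> rd u v <= N u * N v.
Proof. by move=> du dv; rewrite (le_trans (ler_norm _))// sip_CS. Qed.

Lemma sip_normD u v : dom u -> dom v -> N (u + v) <= N u + N v.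
Proof.
move=> du dv; rewrite -ler_sqr ?nnegrE ?addr_ge0 ?sip_norm_ge0//.
by rewrite sip_normDsq//; have := sip_rdot_le du dv; lra.
Qed.

Lemma sip_norm0 : N 0 = 0.
Proof. by rewrite /sip_norm sip_dot0l ?sqrtr0//; exact: hs_dom0. Qed.

Lemma sip_normZ a u : dom u -> N (a *: u) = rnorm (a : R[i]^o) * N u.
Proof.
move=> du; rewrite /sip_norm.
have dau : dom (a *: u) by exact: hs_domZ.
rewrite sip_dotZl// (hs_dotC hV dau du) sip_dotZl// rmorphM/= -(hs_dotC hV du du).
rewrite mulrA -sqr_normc [`|a|](@rnormE _ R[i]^o a) -rmorphXn/=.
rewrite -[complex.Re _]/(complex.Re (_ * _)).
case: (sip_dot V u u) => x y /=; rewrite mul0r subr0 sqrtrM ?sqr_ge0//.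
by rewrite sqrtr_sqr ger0_norm// rnorm_ge0.
Qed.

Lemma sip_normZr r u : dom u -> N (r%:C *: u) = `|r| * N u.
Proof.
by move=> du; rewrite sip_normZ// rnorm_real.
Qed.

Lemma sip_normN u : dom u -> N (- u) = N u.
Proof.
by move=> du; rewrite -scaleN1r sip_normZ// {1}/rnorm normrN1/= mul1r.
Qed.

Lemma sip_normC u v : dom u -> dom v -> N (u - v) = N (v - u).
Proof. by move=> du dv; rewrite -opprB sip_normN//; exact: hs_domB. Qed.

Lemma sip_triangle v u w : dom u -> dom v -> dom w -> N (u - w) <= N (u - v) + N (v - w).
Proof.
move=> du dv dw; rewrite -[u - w](subrKA v).
by apply: sip_normD; exact: hs_domB.
Qed.

Lemma sip_parallelogram u v : dom u -> dom v ->
  N (u - v) ^+ 2 = 2 * N u ^+ 2 + 2 * N v ^+ 2 - N (u + v) ^+ 2.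
Proof.
move=> du dv; rewrite !sip_normDsq//; last exact: hs_domN.
rewrite sip_normN// sip_rdotC//; last exact: hs_domN.
by rewrite sip_rdotNl// (sip_rdotC dv du); ring.
Qed.

(** Test with v = u and divide by the norm of u. *)
Lemma sip_norm_ge_rdot u (M : R) : dom u -> 0 <= M ->
  (forall v, dom v -> rd u v <= M * N v) -> N u <= M.
Proof.
move=> du M0 h; have [->//|Nu0] := eqVneq (N u) 0.
have := h u du; rewrite -sip_normE// expr2 ler_pM2r//.
by rewrite lt_neqAle eq_sym Nu0 sip_norm_ge0.
Qed.

Lemma sip_dot_eq u v w w' : dom u -> dom v -> dom w -> dom w' ->
  rd u w = rd v w' -> rd ('i *: u) w = rd ('i *: v) w' -> sip_dot V u w = sip_dot V v w'.
Proof.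
move=> du dv dw dw'; rewrite /sip_rdot !sip_dotZl//.
case: (sip_dot V u w) => a b; case: (sip_dot V v w') => c d /= ->.
by rewrite !mul0r !mul1r !sub0r => /oppr_inj ->.
Qed.

End Theory.

(* Minimise the functional [N z ^+ 2 - 2 * phi z] over [D]; the parallelogram  *)
(* law makes minimising sequences Cauchy.                                     *)
Lemma riesz_on (V : sipSpace R) (hV : hilbert_sip V) (D : set V) (phi : V -> R) (M : R) :
  D `<=` sip_dom V -> D 0 ->
  (forall (r : R) u v, D u -> D v -> D (r%:C *: u + v)) ->
  (forall (r : R) u v, D u -> D v -> phi (r%:C *: u + v) = r * phi u + phi v) ->
  (forall u, D u -> `|phi u| <= M * sip_norm u) ->
  exists z, [/\ sip_dom V z,
    exists2 x : nat -> V, (forall n, D (x n)) & sip_norm (x n - z) @[n --> \oo] --> (0 : R)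
    & forall u, D u -> phi u = sip_rdot u z].
Proof.
move=> Ddom D0 DP phiP phiM.
pose J u := sip_norm u ^+ 2 - 2 * phi u.
pose A := [set J u | u in D].
(* Completing the square: |u|^2 - 2 M |u| >= - M^2. *)
have JM u : D u -> - M ^+ 2 <= J u.
  move=> Du; have := phiM u Du; rewrite ler_norml => /andP[_].
  have : 0 <= (sip_norm u - M) ^+ 2 by exact: sqr_ge0.
  rewrite /J; nra.
have infA : has_inf A.
  by split; [exists (J 0), 0|exists (- M ^+ 2) => _ [u Du <-]; exact: JM].
pose m := inf A.
have mJ u : D u -> m <= J u by move=> Du; apply: (ge_inf infA.2); exists u.
(* A gap of 64^-n in J becomes a distance of order 8^-n, the rate in [hs_complete]. *)
have /choice[x xP] : forall n, exists u, D u /\ J u < m + 64^-1 ^+ n.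
  move=> n; have e0 : 0 < (64^-1 : R) ^+ n by rewrite exprn_gt0.
  by have [_ [u Du <-] h] := inf_adherent e0 infA; exists u.
have Dx n : D (x n) := (xP n).1.
have dx n : sip_dom V (x n) := Ddom _ (Dx n).
have phi0 : phi 0 = 0.
  have := phiP 1 0 0 D0 D0; rewrite scaler0 addr0 mul1r -{1}[phi 0]addr0.
  by move=> /addrI <-.
have phiZ r u : D u -> phi (r%:C *: u) = r * phi u.
  by move=> Du; rewrite -[_ *: u]addr0 phiP// phi0 addr0.
have DZ r u : D u -> D (r%:C *: u) by move=> Du; rewrite -[_ *: u]addr0; exact: DP.
have DD u v : D u -> D v -> D (u + v).
  by move=> Du Dv; rewrite -[u]scale1r; exact: (DP 1).
have phiD u v : D u -> D v -> phi (u + v) = phi u + phi v.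
  by move=> Du Dv; have := phiP 1 _ _ Du Dv; rewrite scale1r mul1r.
have sq a b : D a -> D b ->
    sip_norm (a - b) ^+ 2 <= 2 * (J a - m) + 2 * (J b - m).
  move=> Da Db; have [da db] := (Ddom _ Da, Ddom _ Db).
  rewrite (sip_parallelogram hV)//.
  have := mJ _ (DZ 2^-1 _ (DD _ _ Da Db)).
  rewrite /J (sip_normZr hV) ?phiZ ?phiD//; [|exact: DD|exact: hs_domD].
  rewrite exprMn real_normK ?num_real//.
  set p := sip_norm (a + b) ^+ 2; lra.
have xC n : sip_norm (x n.+1 - x n) <= 2 * 8^-1 ^+ n.
  rewrite -ler_sqr ?nnegrE ?sip_norm_ge0 ?mulr_ge0 ?exprn_ge0//.
  apply: le_trans (sq _ _ (Dx _) (Dx _)) _.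
  rewrite exprMn -exprM mulnC exprM (_ : 8^-1 ^+ 2 = 64^-1); last by field.
  have := (xP n.+1).2; have := (xP n).2; rewrite exprS.
  have : 0 < (64^-1 : R) ^+ n by rewrite exprn_gt0.
  set p := _ ^+ n; lra.
have [z dz xz] := hs_complete hV dx xC.
exists z; split => //; first by exists x.
move=> u Du; have du := Ddom _ Du.
(* The first variation: J (t u + x_n) >= m while J x_n < m + 64^-n; let n tend to infinity. *)
have key (t : R) : 0 <= 2 * t * (sip_rdot u z - phi u) + t ^+ 2 * sip_norm u ^+ 2.
  have h n : 0 <= 64^-1 ^+ n + 2 * t * (sip_rdot u (x n) - phi u) + t ^+ 2 * sip_norm u ^+ 2.
    have := mJ _ (DP t _ _ Du (Dx n)); have := (xP n).2.
    rewrite /J phiP// !(sip_normE hV)//; last exact: (hs_domP hV).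
    rewrite (sip_rdotii hV)//; lra.
  have l1 : (64^-1 : R) ^+ n @[n --> \oo] --> (0 : R).
    by apply: cvg_expr; rewrite ger0_norm// invf_lt1// ltr1n.
  have l2 : sip_rdot u (x n) @[n --> \oo] --> sip_rdot u z.
    apply/cvgrPdist_lt => e e0.
    have Nu1 : 0 < sip_norm u + 1 by rewrite ltr_wpDl// sip_norm_ge0.
    have : 0 < e / (sip_norm u + 1) by rewrite divr_gt0.
    move: xz => /cvgrPdist_lt /[apply]; apply: filterS => n.
    rewrite sub0r normrN ger0_norm ?sip_norm_ge0// ltr_pdivlMr// => xe.
    rewrite distrC -(sip_rdotBr hV)//.
    have dxz : sip_dom V (x n - z) by exact: hs_domB.
    rewrite (le_lt_trans (sip_CS hV du dxz))//.
    rewrite (le_lt_trans _ xe)// mulrC ler_wpM2l ?sip_norm_ge0//.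
    by rewrite lerDl.
  have l3 : 64^-1 ^+ n + 2 * t * (sip_rdot u (x n) - phi u) + t ^+ 2 * sip_norm u ^+ 2
       @[n --> \oo] --> 0 + 2 * t * (sip_rdot u z - phi u) + t ^+ 2 * sip_norm u ^+ 2.
    apply: cvgD; last exact: cvg_cst.
    apply: cvgD => //; apply: cvgM; first exact: cvg_cst.
    by apply: cvgB => //; exact: cvg_cst.
  by rewrite -[X in X + _]add0r; apply: (cvgr_to_ge l3); apply: nearW => n; exact: h.
set al := sip_rdot u z - phi u in key.
suff : al = 0 by rewrite /al => /eqP; rewrite subr_eq0 => /eqP ->.
set q := sip_norm u ^+ 2 in key; have q0 : 0 <= q by exact: sqr_ge0.
apply: contrapT => /eqP al0.
have al2 : 0 < al ^+ 2 by rewrite exprn_even_gt0.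
have q1 : 0 < q + 1 by rewrite ltr_wpDl.
(* Dividing by q + 1 instead of q also covers u of norm 0; the value is a negative multiple of
   al^2. *)
have := key (- al / (q + 1)).
rewrite (_ : _ + _ = al ^+ 2 * (- q - 2) / (q + 1) ^+ 2); last by field; lra.
rewrite pmulr_lge0 ?invr_gt0 ?exprn_gt0// pmulr_rge0//; lra.
Qed.

Lemma riesz (V : sipSpace R) (hV : hilbert_sip V) (phi : V -> R) (M : R) :
  (forall (r : R) u v, sip_dom V u -> sip_dom V v ->
     phi (r%:C *: u + v) = r * phi u + phi v) ->
  (forall u, sip_dom V u -> `|phi u| <= M * sip_norm u) ->
  exists2 z, sip_dom V z & forall u, sip_dom V u -> phi u = sip_rdot u z.
Proof.
move=> phiP phiM.
have [|||z [dz _ h]] := riesz_on hV (D := sip_dom V) _ _ _ phiP phiM => //.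
- exact: hs_dom0.
- by move=> r u v; exact: (hs_domP hV).
by exists z.
Qed.

(** [riesz_on] applied to the pairing with x gives the projection z of x onto the closure of D. Then
    z - x is orthogonal to D, hence of norm 0, and z is a limit of elements of D. *)
Lemma dense_of_orthogonal (V : sipSpace R) (hV : hilbert_sip V) (D : set V) :
  D `<=` sip_dom V -> D 0 ->
  (forall (r : R) u v, D u -> D v -> D (r%:C *: u + v)) ->
  (forall x, sip_dom V x -> (forall u, D u -> sip_rdot u x = 0) -> sip_norm x = 0) ->
  forall x, sip_dom V x -> exists2 y : nat -> V, (forall n, D (y n)) &
    sip_norm (y n - x) @[n --> \oo] --> (0 : R).
Proof.
move=> Ddom D0 DP h x dx.
have [||z [dz [y Dy yz] hz]] := @riesz_on V hV D (fun u => sip_rdot u x) (sip_norm x) Ddom D0 DP.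
- by move=> r u v /Ddom du /Ddom dv; rewrite (sip_rdotDl hV)// ?(sip_rdotZl hV)//; exact: hs_domZ.
- by move=> u /Ddom du; rewrite mulrC (sip_CS hV).
exists y => //.
have dxz : sip_dom V (z - x) by exact: hs_domB.
have zx0 : sip_norm (z - x) = 0.
  apply: h => // u Du; rewrite (sip_rdotBr hV)//; last exact: Ddom.
  by rewrite (hz u Du) subrr.
apply: (@squeeze_cvgr _ _ _ _ (cst 0) (fun n => sip_norm (y n - z))) => //; last exact: cvg_cst.
apply: nearW => n; rewrite sip_norm_ge0/=.
by rewrite (le_trans (sip_triangle hV (Ddom _ (Dy n)) dz dx))// zx0 addr0.
Qed.

End HilbertSip.

(** * Orthonormal bases: Bessel, Parseval, existence, and the Hilbert-Schmidt sum of an adjoint *)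

Section OrthonormalBases.
Context {R : realType}.

Definition orthonormal_set (V : sipSpace R) (E : set V) :=
  E `<=` sip_dom V /\ forall e f, E e -> E f -> sip_dot V e f = (e == f)%:R.

Definition sip_span (V : sipSpace R) (E : set V) : set V :=
  [set w | exists (n : nat) (c : 'I_n -> R[i]) (e : 'I_n -> V),
     (forall i, E (e i)) /\ w = \sum_i c i *: e i].

Lemma sip_spanP (V : sipSpace R) (E : set V) a u v :
  sip_span E u -> sip_span E v -> sip_span E (a *: u + v).
Proof.
move=> [n [c [e [Ee ->]]]] [m [d [f [Ef ->]]]].
exists (n + m)%N, (fun k => match fintype.split k with inl i => a * c i | inr j => d j end).
exists (fun k => match fintype.split k with inl i => e i | inr j => f j end); split.
  by move=> k; case: (fintype.split k).
rewrite big_split_ord scaler_sumr; congr (_ + _); apply: eq_bigr => i _.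
  by rewrite -[lshift m i]/(unsplit (inl i)) unsplitK scalerA.
by rewrite -[rshift n i]/(unsplit (inr i)) unsplitK.
Qed.

Lemma sip_span0 (V : sipSpace R) (E : set V) : sip_span E 0.
Proof.
exists 0%N, (fun=> 0), (fun=> 0); split; first by case.
by rewrite big_ord0.
Qed.

Lemma sub_sip_span (V : sipSpace R) (E : set V) : E `<=` sip_span E.
Proof.
move=> e Ee; exists 1%N, (fun=> 1), (fun=> e); split => //.
by rewrite big_ord_recl big_ord0 addr0 scale1r.
Qed.

Lemma sqr_rnormE (c : R[i]) :
  rnorm (c : R[i]^o) ^+ 2 = complex.Re c ^+ 2 + complex.Im c ^+ 2.
Proof.
by rewrite /rnorm normc_def /= sqr_sqrtr// addr_ge0 ?sqr_ge0.
Qed.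

Lemma Re_mulcJ (c : R[i]) : complex.Re (c * c^*%C) = rnorm (c : R[i]^o) ^+ 2.
Proof. by rewrite sqr_rnormE; case: c => a b /=; rewrite mulrN opprK -!expr2. Qed.

Section Theory.
Variables (V : sipSpace R) (hV : hilbert_sip V).

Lemma sip_span_dom (E : set V) : E `<=` sip_dom V -> sip_span E `<=` sip_dom V.
Proof.
move=> Ed _ [n [c [e [Ee ->]]]].
elim/big_ind: _ => //; first exact: hs_dom0.
- by move=> x y; exact: hs_domD.
- by move=> i _; apply: hs_domZ => //; exact: Ed.
Qed.

Lemma hs_dom_sum (I : eqType) (r : seq I) (c : I -> R[i]) (e : I -> V) :
  (forall i, i \in r -> sip_dom V (e i)) -> sip_dom V (\sum_(i <- r) c i *: e i).
Proof.
move=> de; rewrite big_seq; elim/big_ind: _ => //; first exact: hs_dom0.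
- by move=> x y; exact: hs_domD.
- by move=> i ir; apply: hs_domZ => //; exact: de.
Qed.

Lemma sip_dot_suml (I : eqType) (r : seq I) (c : I -> R[i]) (e : I -> V) w :
  (forall i, i \in r -> sip_dom V (e i)) -> sip_dom V w ->
  sip_dot V (\sum_(i <- r) c i *: e i) w = \sum_(i <- r) c i * sip_dot V (e i) w.
Proof.
move=> de dw; elim: r de => [|i r IH] de; first by rewrite !big_nil (sip_dot0l hV).
have di : sip_dom V (e i) by apply: de; rewrite mem_head.
have dr j : j \in r -> sip_dom V (e j) by move=> jr; apply: de; rewrite inE jr orbT.
by rewrite !big_cons (hs_dotP hV)// ?IH//; exact: hs_dom_sum.
Qed.

Section Bessel.
Variables (E : set V) (oE : orthonormal_set E) (s : seq V).
Hypotheses (us : uniq s) (sE : forall e, e \in s -> E e).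
Variables (v : V) (dv : sip_dom V v).
Let p := \sum_(e <- s) sip_dot V v e *: e.

Let ds e : e \in s -> sip_dom V e. Proof. by move=> /sE /oE.1. Qed.

Lemma dom_proj : sip_dom V p. Proof. exact: hs_dom_sum. Qed.

Lemma dot_proj f : f \in s -> sip_dot V p f = sip_dot V v f.
Proof.
move=> fs; rewrite sip_dot_suml//; last exact: ds.
rewrite (bigD1_seq f)//= (oE.2 _ _ (sE fs) (sE fs)).
rewrite eqxx mulr1 big_seq_cond big1 ?addr0// => e /andP[es ef].
by rewrite (oE.2 _ _ (sE es) (sE fs)) (negbTE ef) mulr0.
Qed.

Lemma dot_residue f : f \in s -> sip_dot V f (v - p) = 0.
Proof.
move=> fs; have df := ds fs.
have dp := dom_proj.
rewrite (hs_dotC hV (hs_domB hV dv dp) df) (sip_dotDl hV)//; last exact: hs_domN.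
by rewrite -scaleN1r (sip_dotZl hV)// mulN1r dot_proj// subrr conjc0.
Qed.

(** Pythagoras: the residue v - p is orthogonal to every element of s, hence to p. *)
Lemma bessel_eq : sip_norm v ^+ 2 =
  sip_norm (v - p) ^+ 2 + \sum_(e <- s) rnorm (sip_dot V v e : R[i]^o) ^+ 2.
Proof.
have dp := dom_proj; have dr : sip_dom V (v - p) by exact: hs_domB.
have rp : sip_rdot p (v - p) = 0.
  rewrite /sip_rdot sip_dot_suml// big_seq big1// => e es.
  by rewrite dot_residue// mulr0.
have -> : sip_norm v = sip_norm (v - p + p) by rewrite subrK.
rewrite (sip_normDsq hV dr dp) [sip_rdot _ p](sip_rdotC hV dr dp) rp mulr0 addr0.
congr (_ + _); rewrite (sip_normE hV)// /sip_rdot sip_dot_suml//.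
rewrite raddf_sum [LHS]big_seq [RHS]big_seq; apply: eq_bigr => e es.
rewrite -Re_mulcJ -(dot_proj es) -(hs_dotC hV)//; exact: ds.
Qed.

(** Write v - w = (v - p) + (p - w); the second summand is in the span of s, so the two are
    orthogonal. *)
Lemma proj_best w : sip_dom V w ->
  (exists (n : nat) (c : 'I_n -> R[i]) (e : 'I_n -> V),
    (forall i, e i \in s) /\ w = \sum_i c i *: e i) ->
  sip_norm (v - p) <= sip_norm (v - w).
Proof.
move=> dw [n [c [f [fs wE]]]].
have dp := dom_proj; have dr : sip_dom V (v - p) by exact: hs_domB.
have dpw : sip_dom V (p - w) by exact: hs_domB.
rewrite -ler_sqr ?nnegrE ?sip_norm_ge0//.
have -> : v - w = (v - p) + (p - w) by rewrite subrKA.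
rewrite (sip_normDsq hV dr dpw).
have -> : sip_rdot (v - p) (p - w) = 0.
  rewrite (sip_rdotBr hV)// ![sip_rdot (v - p) _](sip_rdotC hV)//.
  have -> : sip_rdot p (v - p) = 0.
    rewrite /sip_rdot sip_dot_suml// big_seq big1// => e es.
    by rewrite dot_residue// mulr0.
  rewrite /sip_rdot wE sip_dot_suml//; last by move=> i _; exact: ds.
  by rewrite big1 ?subrr// => i _; rewrite dot_residue// mulr0.
by rewrite mulr0 addr0 lerDl sqr_ge0.
Qed.

End Bessel.

(** Bessel bounds every finite partial sum by |v|^2. Conversely a combination close to v involves
    finitely many basis vectors, and by [proj_best] the residue of v for these is no larger than the
    error of the combination. *)
Lemma parseval (E : set V) v : orthonormal_basis E -> sip_dom V v ->
  (\esum_(e in E) (rnorm (sip_dot V v e : R[i]^o) ^+ 2)%:E = (sip_norm v ^+ 2)%:E)%E.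
Proof.
move=> [Ed Eo Et] dv.
have oE : orthonormal_set E by split.
apply/eqP; rewrite eq_le; apply/andP; split.
  apply: ge_ereal_sup => _ [X [finX XE] <-].
  rewrite fsbig_finite//= sumEFin lee_fin.
  rewrite (bessel_eq oE (finmap.fset_uniq (fset_set X)) _ dv)//; first by rewrite lerDr sqr_ge0.
  by move=> e; rewrite in_fset_set// => /set_mem /XE.
apply/lee_addgt0Pr => e e0.
(* The residue enters squared, so v is approximated to within a square root of e. *)
have [d d0 de] : exists2 d : R, 0 < d & d ^+ 2 <= e.
  exists (Num.sqrt e); first by rewrite sqrtr_gt0.
  by rewrite sqr_sqrtr// ltW.
have [n [c [f [Ef vf]]]] := Et v dv d d0.
pose s := undup [seq f i | i <- enum 'I_n].
have us : uniq s := undup_uniq _.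
have sE x : x \in s -> E x.
  by rewrite mem_undup => /mapP[i _ ->].
have fs i : f i \in s by rewrite mem_undup map_f// mem_enum.
have dw : sip_dom V (\sum_i c i *: f i).
  by apply: (sip_span_dom Ed); exists n, c, f.
have := proj_best oE us sE dv dw; set p := \sum_(e <- s) _.
have -> : (sip_norm v ^+ 2)%:E = (sip_norm (v - p) ^+ 2 +
    \sum_(e <- s) rnorm (sip_dot V v e : R[i]^o) ^+ 2)%:E.
  by rewrite (bessel_eq oE us sE dv).
have wE : exists (n0 : nat) (c0 : _) (e0 : _), (forall i : 'I_n0, e0 i \in s) /\ \sum_i c i *: f i = \sum_i c0 i *: e0 i
  by exists n, c, f.
move=> /(_ wE).
move=> pw; rewrite EFinD addeC; apply: leeD.
  rewrite -sumEFin; apply: esum_ge; exists [set` s].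
    by split; [exact: finite_seq|move=> x /= /sE].
  by rewrite fsbig_seq.
rewrite lee_fin (le_trans _ de)// ler_sqr ?nnegrE ?sip_norm_ge0 ?(ltW d0)//.
by rewrite (le_trans pw)// ltW.
Qed.

(** Zorn gives a maximal orthonormal set. A vector of nonzero norm orthogonal to it could be
    normalised and added, so [dense_of_orthogonal] makes its span dense. *)
Lemma exists_orthonormal_basis : exists E : set V, orthonormal_basis E.
Proof.
have [F Fs tF|E [oE Emax]] := @Zorn_bigcup V (@orthonormal_set V).
  split; first by move=> x [X FX Xx]; apply: (Fs X FX).1.
  move=> e f [X FX Xe] [Y FY Yf].
  have [XY|YX] := tF X Y FX FY.
    by apply: (Fs Y FY).2 => //; exact: XY.
  by apply: (Fs X FX).2 => //; exact: YX.
exists E; split; [exact: oE.1|exact: oE.2|].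
have Dd := sip_span_dom oE.1.
have DP (r : R) u v : sip_span E u -> sip_span E v -> sip_span E (r%:C *: u + v).
  by move=> Du Dv; exact: sip_spanP.
have orth x : sip_dom V x -> (forall u, sip_span E u -> sip_rdot u x = 0) -> sip_norm x = 0.
  move=> dx xE; apply: contrapT => /eqP Nx0.
  have Nxp : 0 < sip_norm x by rewrite lt_neqAle eq_sym Nx0 sip_norm_ge0.
  pose w := (sip_norm x)^-1%:C *: x.
  have dw : sip_dom V w by exact: hs_domZ.
  have Ew e : E e -> sip_dot V e w = 0.
    move=> Ee; have de := oE.1 _ Ee.
    have d0 := hs_dom0 hV.
    rewrite -(sip_dot0l hV dw); apply: (sip_dot_eq hV) => //.
      rewrite (sip_rdotZr hV)// xE ?mulr0; last exact: sub_sip_span.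
      by rewrite /sip_rdot (sip_dot0l hV).
    rewrite scaler0 (sip_rdotZr hV)//; last exact: hs_domZ.
    rewrite xE ?mulr0 ?/sip_rdot ?(sip_dot0l hV)//.
    rewrite -[_ *: _]addr0; apply: sip_spanP; first exact: sub_sip_span.
    exact: sip_span0.
  have ww : sip_dot V w w = 1.
    have := hs_dotC hV dw dw; have := sip_normE hV dw.
    rewrite (sip_normZr hV)// gtr0_norm ?invr_gt0// mulVf// expr1n /sip_rdot.
    case: (sip_dot V w w) => a b /= a1 /(congr1 (@complex.Im R)) /= bb.
    by rewrite -a1 (_ : b = 0)//; lra.
  have nEw : ~ E w.
    by move=> /Ew; rewrite ww => /eqP; rewrite oner_eq0.
  apply: (Emax (w |` E)).
    split; first by move=> x0 Ex0; right.
    by move=> h; apply: nEw; apply: h; left.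
  split; first by move=> x0 [/= ->//|/oE.1].
  move=> e f [->|Ee] [->|Ef].
  - by rewrite eqxx ww.
  - rewrite (hs_dotC hV (oE.1 _ Ef) dw) Ew// conjc0.
    by case: eqVneq => // wf; move: nEw; rewrite wf.
  - by rewrite Ew//; case: eqVneq => // wf; move: nEw; rewrite -wf.
  - exact: oE.2.
move=> v dv eps eps0.
have [y Dy yv] := dense_of_orthogonal hV Dd (sip_span0 E) DP orth dv.
have [n _ /(_ n (leqnn n))] := (cvgrPdist_lt _ _).1 yv _ eps0.
rewrite sub0r normrN ger0_norm ?sip_norm_ge0// (sip_normC hV)//; last exact: Dd.
have [m [c [e [Ee yE]]]] := Dy n.
by move=> h; exists m, c, e; rewrite -yE.
Qed.

End Theory.

Lemma orthonormal_of_basis (V : sipSpace R) (E : set V) :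
  orthonormal_basis E -> orthonormal_set E.
Proof. by case. Qed.

Lemma esum_swap (T1 T2 : choiceType) (I : set T1) (J : set T2) (a : T1 -> T2 -> \bar R) :
  (forall i j, I i -> J j -> (0 <= a i j)%E) ->
  (\esum_(i in I) \esum_(j in J) a i j = \esum_(j in J) \esum_(i in I) a i j)%E.
Proof.
move=> a0; rewrite !esum_esum//; last by move=> j i Jj Ii; exact: a0.
rewrite (@reindex_esum _ _ _ (J `*`` fun=> I) (I `*`` fun=> J) (fun k => (k.2, k.1)))//.
split => //=.
- by move=> [x y] [/= ? ?].
- by move=> [x1 x2] [y1 y2] _ _ [-> ->].
- by move=> [x y] [/= ? ?]; exists (y, x).
Qed.

(* Both sides are the sum of the squared matrix entries. *)
Lemma esum_sqr_adjoint (V W : sipSpace R) (hV : hilbert_sip V) (hW : hilbert_sip W)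
    (E : set V) (L : set W) (F : V -> W) (G : W -> V) :
  orthonormal_basis E -> orthonormal_basis L ->
  (forall v, sip_dom V v -> sip_dom W (F v)) ->
  (forall w, sip_dom W w -> sip_dom V (G w)) ->
  (forall v w, sip_dom V v -> sip_dom W w ->
     sip_dot W (F v) w = sip_dot V v (G w)) ->
  (\esum_(e in E) (sip_norm (F e) ^+ 2)%:E = \esum_(l in L) (sip_norm (G l) ^+ 2)%:E)%E.
Proof.
move=> bE bL dF dG FG; have [Ed _ _] := bE; have [Ld _ _] := bL.
under eq_esum => e Ee do rewrite -(parseval hW bL (dF _ (Ed _ Ee))).
under [RHS]eq_esum => l Ll do rewrite -(parseval hV bE (dG _ (Ld _ Ll))).
rewrite esum_swap; last by move=> i j _ _; rewrite lee_fin sqr_ge0.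
apply: eq_esum => l Ll; apply: eq_esum => e Ee.
have [dl de] := (Ld _ Ll, Ed _ Ee).
rewrite FG// (hs_dotC hV (dG _ dl) de) !sqr_rnormE.
by case: (sip_dot V (G l) e) => a b /=; rewrite sqrrN.
Qed.

End OrthonormalBases.

(** * Strong measurability of vector-valued functions *)

Section StrongMeasurability.
Context {R : realType}.
Variable T : R.
Local Notation I := (`[0, T]%classic : set (measurableTypeR R)).

Lemma measurable_I : measurable I.
Proof. exact: measurable_itv. Qed.
Local Hint Resolve measurable_I : core.

Lemma measurable_fun_simple {V : normedModType R[i]} (s : R -> V) (phi : R -> V -> R) :
  simple s -> (forall v, measurable_fun I (phi^~ v)) ->
  measurable_fun I (fun t => phi t (s t)).
Proof.
move=> [fs ms] mphi _ Y mY.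
rewrite (_ : _ `&` _ =
  \bigcup_(v in range s) ((I `&` (phi^~ v) @^-1` Y) `&` s @^-1` [set v])); last first.
  apply/seteqP; split => t /=.
    by move=> [It Yt]; exists (s t) => //=; exists t.
  by move=> [v _ [[It Yt] ->]].
apply: fin_bigcup_measurable => // v _; apply: measurableI; last exact: ms.
exact: mphi.
Qed.

Definition seq_continuous {V : normedModType R[i]} (f : V -> R) :=
  forall (x : nat -> V) l, x @ \oo --> l -> f (x n) @[n --> \oo] --> f l.

(** Substitute the simple functions approximating u, where [measurable_fun_simple] applies, and pass
    to the pointwise limit by continuity in the second argument. *)
Lemma measurable_fun_caratheodory {V : normedModType R[i]} (u : R -> V)
    (phi : R -> V -> R) :
  strongly_measurable T u -> (forall v, measurable_fun I (phi^~ v)) ->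
  (forall t, t \in `[0, T] -> seq_continuous (phi t)) ->
  measurable_fun I (fun t => phi t (u t)).
Proof.
move=> [s ss su] mphi cphi.
apply: (@measurable_fun_cvg _ _ _ _ (fun n t => phi t (s n t))).
  by move=> n; exact: measurable_fun_simple.
by move=> t It; apply: cphi => //; exact: su.
Qed.

Lemma simple_cst {V : normedModType R[i]} (v : V) : simple (fun _ : R => v).
Proof.
split; last first.
  move=> w; have [->|vw] := pselect (v = w).
    by rewrite (_ : _ @^-1` _ = setT)//; apply/seteqP; split.
  by rewrite (_ : _ @^-1` _ = set0)//; apply/seteqP; split.
by apply: (sub_finite_set _ (finite_set1 v)) => _ [t _ <-].
Qed.

Lemma strongly_measurable_cst {V : normedModType R[i]} (v : V) :
  strongly_measurable T (fun=> v).
Proof. by exists (fun _ _ => v) => *; [exact: simple_cst|exact: cvg_cst]. Qed.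

Lemma simple_if {V : normedModType R[i]} (B : set (measurableTypeR R)) (s r : R -> V) :
  measurable B -> simple s -> simple r ->
  simple (fun t => if `[< B t >] then s t else r t).
Proof.
move=> mB [fs ms] [fr mr]; split.
  have : finite_set (range s `|` range r) by rewrite finite_setU.
  apply: sub_finite_set => _ [t _ <-].
  by case: asboolP => _; [left|right]; exists t.
move=> v; rewrite (_ : _ @^-1` _ = (B `&` s @^-1` [set v]) `|` (~` B `&` r @^-1` [set v])).
  by apply: measurableU; apply: measurableI => //; first [exact: ms|exact: mr|exact: measurableC].
apply/seteqP; split => t /=.
  by case: asboolP => Bt ->; [left|right].
by move=> [[Bt]|[Bt]]; case: asboolP.
Qed.

Lemma separable_seq {V : normedModType R[i]} : separable V ->
  exists e : nat -> V, forall x (r : R), 0 < r -> exists n, rnorm (e n - x) < r.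
Proof.
move=> [D /countable_injP[g ginj] dD].
exists (fun n => xget 0 [set x | D x /\ g x = n]) => x r r0.
have xB : (ball x r%:C)^° !=set0.
  exists x; apply: nbhsx_ballx; by rewrite ltcR.
have [y [yB Dy]] := dD _ xB (open_interior _).
exists (g y); case: xgetP => [z _ [Dz gz]|/(_ y)/=]; last by case.
have -> : z = y by apply: ginj; rewrite ?inE.
have := interior_subset yB.
by rewrite -ball_normE /= rnormE ltcR rnormC.
Qed.

(** A criterion of Pettis type: the n-th simple function takes at t the point nearest to [f t] among
    the first points of a dense sequence, a choice made by comparing measurable distances. *)
Lemma strongly_measurableP {V : normedModType R[i]} (f : R -> V) : separable V ->
  (forall d, measurable_fun I (fun t => rnorm (f t - d))) -> strongly_measurable T f.
Proof.
move=> /separable_seq[e edense] mf.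
(* The value changes only when the new point is strictly closer; outside [0, T], where nothing is
   known of f, it stays at [e 0]. *)
pose fix s n : R -> V := if n isn't n.+1 then (fun=> e 0%N) else
  fun t => if `[< t \in `[0, T] /\ rnorm (f t - e n.+1) < rnorm (f t - s n t) >]
           then e n.+1 else s n t.
have ss n : simple (s n).
  elim: n => [|n IH] /=; first exact: simple_cst.
  apply: (@simple_if _ [set t | t \in `[0, T] /\
     rnorm (f t - e n.+1) < rnorm (f t - s n t)] (fun=> e n.+1)) => //.
    have h := measurable_fun_simple IH mf.
    have := measurable_fun_ltr (mf (e n.+1)) h measurable_I (Logic.I : measurable [set true]).
    rewrite (_ : _ `&` _ = [set t | t \in `[0, T] /\
      rnorm (f t - e n.+1) < rnorm (f t - s n t)])//.
  exact: simple_cst.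
exists s => // t It.
have best n k : (k <= n)%N -> rnorm (f t - s n t) <= rnorm (f t - e k).
  elim: n => [|n IH]; first by rewrite leqn0 => /eqP ->.
  rewrite leq_eqVlt => /predU1P[->|] /=.
    by case: asboolP => // /not_andP[//|/negP]; rewrite -leNgt.
  rewrite ltnS => /IH; case: asboolP => // -[_ /ltW]; exact: le_trans.
apply/cvg_rnormP => r r0; have [k ek] := edense (f t) r r0.
exists k => // n /= kn; rewrite rnormC (le_lt_trans (best n k kn))//.
by rewrite rnormC.
Qed.

Lemma seq_continuous_rnormB {V : normedModType R[i]} (d : V) :
  seq_continuous (fun v => rnorm (v - d)).
Proof. by move=> x l xl; apply: cvg_rnorm; apply: cvgB => //; exact: cvg_cst. Qed.

Lemma measurable_rnormB {V : normedModType R[i]} (f : R -> V) d :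
  strongly_measurable T f -> measurable_fun I (fun t => rnorm (f t - d)).
Proof.
move=> mf; apply: (@measurable_fun_caratheodory _ f (fun _ v => rnorm (v - d))) => //.
by move=> t _; exact: seq_continuous_rnormB.
Qed.

Lemma measurable_rnorm {V : normedModType R[i]} (f : R -> V) :
  strongly_measurable T f -> measurable_fun I (fun t => rnorm (f t)).
Proof.
move=> /(@measurable_rnormB _ _ 0); congr (measurable_fun _ _).
by apply/funext => t; rewrite subr0.
Qed.

Lemma strongly_measurable_caratheodory {V W : normedModType R[i]} (u : R -> V)
    (F : R -> V -> W) : separable W ->
  strongly_measurable T u -> (forall v, strongly_measurable T (F^~ v)) ->
  (forall t, t \in `[0, T] -> forall (x : nat -> V) l, x @ \oo --> l ->
     F t (x n) @[n --> \oo] --> F t l) ->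
  strongly_measurable T (fun t => F t (u t)).
Proof.
move=> sW mu mF cF; apply: strongly_measurableP => // d.
apply: (@measurable_fun_caratheodory _ u (fun t v => rnorm (F t v - d))) => //.
  by move=> v; exact: measurable_rnormB.
by move=> t It x l xl; apply: seq_continuous_rnormB; exact: cF.
Qed.

Lemma strongly_measurable_lim {V : normedModType R[i]} (f : nat -> R -> V) g :
  separable V -> (forall n, strongly_measurable T (f n)) ->
  (forall t, t \in `[0, T] -> f n t @[n --> \oo] --> g t) ->
  strongly_measurable T g.
Proof.
move=> sV mf fg; apply: strongly_measurableP => // d.
apply: (@measurable_fun_cvg _ _ _ _ (fun n t => rnorm (f n t - d))).
  by move=> n; exact: measurable_rnormB.
by move=> t It; apply: (seq_continuous_rnormB (x := f^~ t)); exact: fg.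
Qed.

Lemma strongly_measurableZD {V : normedModType R[i]} (a : R[i]) (f g : R -> V) :
  separable V -> strongly_measurable T f -> strongly_measurable T g ->
  strongly_measurable T (fun t => a *: f t + g t).
Proof.
move=> sV mf mg.
apply: (@strongly_measurable_caratheodory _ _ f (fun t v => a *: v + g t)) => //.
  move=> v.
  apply: (@strongly_measurable_caratheodory _ _ g (fun t w => a *: v + w)) => //.
    by move=> w; exact: strongly_measurable_cst.
  by move=> t _ x l xl; apply: cvgD => //; exact: cvg_cst.
move=> t _ x l xl; apply: cvgD => //; last exact: cvg_cst.
by apply: cvgZ => //; exact: cvg_cst.
Qed.

Lemma strongly_measurable_if {V : normedModType R[i]} (B : set (measurableTypeR R))
    (f g : R -> V) : measurable B ->
  strongly_measurable T f -> strongly_measurable T g ->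
  strongly_measurable T (fun t => if `[< B t >] then f t else g t).
Proof.
move=> mB [s ss sf] [r rr rg].
exists (fun n t => if `[< B t >] then s n t else r n t).
  by move=> n; exact: simple_if.
by move=> t It; case: asboolP => _; [exact: sf|exact: rg].
Qed.

Lemma strongly_measurableP_cont {V : normedModType R[i]} (f : R -> V) : separable V ->
  {within I, continuous f} -> strongly_measurable T f.
Proof.
move=> sV cf; apply: strongly_measurableP => // d.
apply: subspace_continuous_measurable_fun => //.
apply/subspace_continuousP => x Ix.
apply: (@cvg_rnorm _ _ _ _ _ (fun t => f t - d)).
apply: cvgB; last exact: cvg_cst.
by move/subspace_continuousP : cf => /(_ x Ix).
Qed.

End StrongMeasurability.

Arguments seq_continuous {R V} f.

(** * The real inner product of a Hilbert space *)

Section RealDot.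
Context {R : realType} {V : hilbertType R}.
Implicit Types (x y z : V) (r : R) (a : R[i]).

Definition rdot x y : R := complex.Re (inner x y).

Lemma sip_norm_of x : sip_norm (x : sip_of V) = rnorm x.
Proof.
rewrite /sip_norm /= inner_normE rnormE -rmorphXn /= sqrtr_sqr ger0_norm//.
exact: rnorm_ge0.
Qed.

Lemma hs_sip_of : hilbert_sip (sip_of V).
Proof.
split => //=.
- by move=> a u v w _ _ _; rewrite linearDl linearZl_LR.
- by move=> u v _ _; rewrite hermC /= mul1r.
- by move=> u _; rewrite inner_normE rnormE -rmorphXn /= sqr_ge0.
- move=> f c _ fc.
  have c0 : 0 <= c by have := fc 0%N; rewrite expr0 mulr1; apply: le_trans; exact: sip_norm_ge0.
  have [n|l fl _] := @geometric_cauchy_cvg _ V f c.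
    rewrite -sip_norm_of (le_trans (fc n))// ler_wpM2l// lerXn2r ?nnegrE//.
    by rewrite lef_pV2 ?posrE// ler_nat.
  exists l => //; apply: cvg_trans ((cvg_rnorm0P _ _).1 fl).
  by apply: near_eq_cvg; near=> n; rewrite -sip_norm_of.
Unshelve. all: by end_near. Qed.

Lemma rdotE x : rdot x x = rnorm x ^+ 2.
Proof. by rewrite -sip_norm_of (sip_normE hs_sip_of). Qed.

Lemma rdotC x y : rdot x y = rdot y x.
Proof. exact: (@sip_rdotC _ _ hs_sip_of). Qed.

Lemma rdotDl x y z : rdot (x + y) z = rdot x z + rdot y z.
Proof. exact: (@sip_rdotDl _ _ hs_sip_of). Qed.

Lemma rdotDr x y z : rdot z (x + y) = rdot z x + rdot z y.
Proof. exact: (@sip_rdotDr _ _ hs_sip_of). Qed.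

Lemma rdotBl x y z : rdot (x - y) z = rdot x z - rdot y z.
Proof. exact: (@sip_rdotBl _ _ hs_sip_of). Qed.

Lemma rdotBr x y z : rdot z (x - y) = rdot z x - rdot z y.
Proof. exact: (@sip_rdotBr _ _ hs_sip_of). Qed.

Lemma rdotZl r x y : rdot (r%:C *: x) y = r * rdot x y.
Proof. exact: (@sip_rdotZl _ _ hs_sip_of). Qed.

Lemma rdotZr r x y : rdot x (r%:C *: y) = r * rdot x y.
Proof. exact: (@sip_rdotZr _ _ hs_sip_of). Qed.

Lemma rdot0l y : rdot 0 y = 0.
Proof. by rewrite -(subrr y) rdotBl subrr. Qed.

Lemma rdot0r y : rdot y 0 = 0.
Proof. by rewrite rdotC rdot0l. Qed.

Lemma rdot_CS x y : `|rdot x y| <= rnorm x * rnorm y.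
Proof. by rewrite -!sip_norm_of; exact: (@sip_CS _ _ hs_sip_of). Qed.

Lemma rdot_le x y : rdot x y <= rnorm x * rnorm y.
Proof. by rewrite (le_trans (ler_norm _))// rdot_CS. Qed.

Lemma rnorm_le_rdot x (M : R) : 0 <= M ->
  (forall y, rdot x y <= M * rnorm y) -> rnorm x <= M.
Proof.
move=> M0 h; rewrite -sip_norm_of; apply: (@sip_norm_ge_rdot _ _ hs_sip_of) => //.
by move=> v _; rewrite sip_norm_of; exact: h.
Qed.

Lemma rdot_injl x z : (forall y, rdot x y = rdot z y) -> x = z.
Proof.
move=> h; apply/eqP; rewrite -subr_eq0; apply/eqP/rnorm_eq0.
by apply/eqP; rewrite -sqrf_eq0 -rdotE rdotBl h subrr.
Qed.

Lemma rdot_injr x z : (forall y, rdot y x = rdot y z) -> x = z.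
Proof. by move=> h; apply: rdot_injl => y; rewrite !(rdotC _ y). Qed.

Lemma rdotiC x y : rdot ('i *: x) y = - rdot x ('i *: y).
Proof.
rewrite /rdot linearZl_LR linearZr_LR/=.
by case: (inner x y) => a b /=; rewrite !mul0r !mul1r; lra.
Qed.

Lemma Im_inner x y : complex.Im (inner x y) = rdot x ('i *: y).
Proof.
rewrite /rdot linearZr_LR/=.
by case: (inner x y) => a b /=; lra.
Qed.

Lemma rdotii x y : rdot ('i *: x) ('i *: y) = rdot x y.
Proof.
by rewrite rdotiC scalerA -expr2 sqr_i scaleN1r -[- y]add0r rdotBr rdot0r sub0r opprK.
Qed.

Lemma riesz_rdot (phi : V -> R) (M : R) :
  (forall r x y, phi (r%:C *: x + y) = r * phi x + phi y) ->
  (forall x, `|phi x| <= M * rnorm x) -> exists z, forall x, phi x = rdot x z.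
Proof.
move=> phiP phiM; have [r u v _ _|u _|z _ h] := @riesz _ _ hs_sip_of phi M.
- exact: phiP.
- by rewrite sip_norm_of.
by exists z => x; rewrite h.
Qed.

Lemma cvg_rdot {T : Type} {F : set_system T} {FF : Filter F} (f : T -> V) l y :
  f @ F --> l -> rdot (f t) y @[t --> F] --> rdot l y.
Proof.
move=> fl; apply/cvgrPdist_lt => e e0.
have y1 : 0 < rnorm y + 1 by rewrite ltr_wpDl// rnorm_ge0.
move/cvg_rnormP : fl => /(_ _ (divr_gt0 e0 y1)).
apply: filterS => t; rewrite ltr_pdivlMr// => h.
rewrite -rdotBl (le_lt_trans (rdot_CS _ _))// rnormC.
by rewrite (le_lt_trans _ h)// ler_wpM2l ?rnorm_ge0// lerDl.
Qed.

End RealDot.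

(** The imaginary part of an inner product is the real part after multiplying the second argument by
    i ([Im_inner]). *)
Lemma inner_eq_rdot {R : realType} {V W : hilbertType R} (x y : V) (u v : W) :
  rdot x y = rdot u v -> rdot x ('i *: y) = rdot u ('i *: v) -> inner x y = inner u v.
Proof.
rewrite -!Im_inner /rdot; case: (inner x y) => a b; case: (inner u v) => c d /=.
by move=> -> ->.
Qed.

(** * Arithmetic of real integrable functions *)

Section RealIntegrable.
Context d {X : measurableType d} {R : realType} (mu : {measure set X -> \bar R}).
Variables (D : set X) (mD : measurable D).

Lemma integrable_RD (f g : X -> R) : mu.-integrable D (EFin \o f) ->
  mu.-integrable D (EFin \o g) -> mu.-integrable D (EFin \o (fun t => f t + g t)).
Proof. by move=> hf hg; exact: (integrableD mD hf hg). Qed.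

Lemma integrable_RZ (a : R) (f : X -> R) : mu.-integrable D (EFin \o f) ->
  mu.-integrable D (EFin \o (fun t => a * f t)).
Proof. by move=> hf; exact: (integrableZl mD a hf). Qed.

Lemma integrable_RB (f g : X -> R) : mu.-integrable D (EFin \o f) ->
  mu.-integrable D (EFin \o g) -> mu.-integrable D (EFin \o (fun t => f t - g t)).
Proof. by move=> hf hg; exact: (integrableB mD hf hg). Qed.

End RealIntegrable.

(** * The space L2 of vector-valued functions is a Hilbert space *)

Section LebesgueSpace.
Context {R : realType} (T : R) (Y : hilbertType R).
Hypothesis sepY : separable Y.
Local Notation mu := (@lebesgue_measure R).
Local Notation I := (`[0, T]%classic : set (measurableTypeR R)).
Local Notation dom := (sip_dom (L2 T Y)).
Local Notation N f := (@sip_norm R (L2 T Y) f).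

Let mI : measurable I. Proof. exact: measurable_I. Qed.

Lemma mu_I_fin : (mu I < +oo)%E.
Proof. by rewrite lebesgue_measure_itv; case: ifP => _; rewrite ltry. Qed.

Lemma measurable_rdot (f g : R -> Y) :
  strongly_measurable T f -> strongly_measurable T g ->
  measurable_fun I (fun t => rdot (f t) (g t)).
Proof.
move=> mf mg.
apply: (@measurable_fun_caratheodory _ _ _ f (fun t v => rdot v (g t))) => // [v|t _ x l xl].
  apply: (@measurable_fun_caratheodory _ _ _ g (fun t w => rdot v w)) => // t _ x l xl.
  by rewrite rdotC; under eq_cvg do rewrite rdotC; exact: cvg_rdot.
exact: cvg_rdot.
Qed.

Lemma sqnorm_integral_ge0 (f : R -> Y) : (0 <= sqnorm_integral T f)%E.
Proof. by apply: integral_ge0 => t _; rewrite lee_fin sqr_ge0. Qed.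

Lemma measurable_sqnorm (f : R -> Y) : strongly_measurable T f ->
  measurable_fun I (fun t => rnorm (f t) ^+ 2).
Proof. by move=> mf; apply: measurable_funX; exact: measurable_rnorm. Qed.

Lemma integrable_sqnorm (f : R -> Y) : dom f ->
  mu.-integrable I (EFin \o (fun t => rnorm (f t) ^+ 2)).
Proof.
move=> [mf foo]; apply/integrableP; split.
  by apply/measurable_EFinP; exact: measurable_sqnorm.
rewrite (le_lt_trans _ foo)// le_eqVlt; apply/orP; left; apply/eqP.
by apply: eq_integral => t _ /=; rewrite ger0_norm// sqr_ge0.
Qed.

Lemma integrable_rdot (f g : R -> Y) : dom f -> dom g ->
  mu.-integrable I (EFin \o (fun t => rdot (f t) (g t))).
Proof.
move=> df dg.
apply: (@le_integrable _ _ _ mu I mI _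
  (EFin \o (fun t => rnorm (f t) ^+ 2 + rnorm (g t) ^+ 2))).
- by apply/measurable_EFinP; exact: (measurable_rdot df.1 dg.1).
- move=> t _; rewrite lee_fin [leRHS]ger0_norm ?addr_ge0 ?sqr_ge0//.
  rewrite (le_trans (rdot_CS _ _))//.
  have := sqr_ge0 (rnorm (f t) - rnorm (g t)).
  by have := sqr_ge0 (rnorm (f t)); have := sqr_ge0 (rnorm (g t)); nra.
- by apply: integrable_RD => //; exact: integrable_sqnorm.
Qed.

Lemma L2_dom0 : dom 0.
Proof.
split; first exact: strongly_measurable_cst.
rewrite /sqnorm_integral integral0_eq// => t _; by rewrite rnorm0 expr0n.
Qed.

Lemma L2_domP (a : R[i]) (f g : R -> Y) : dom f -> dom g -> dom (a *: f + g).
Proof.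
move=> df dg; split; first exact: (strongly_measurableZD a sepY df.1 dg.1).
have h : mu.-integrable I (EFin \o (fun t => 2 * rnorm (a : R[i]^o) ^+ 2 * rnorm (f t) ^+ 2 +
    2 * rnorm (g t) ^+ 2)).
  by apply: integrable_RD => //; apply: integrable_RZ => //; exact: integrable_sqnorm.
apply: le_lt_trans (integrable_lty mI h).
apply: ge0_le_integral => //.
- by move=> t _; rewrite lee_fin sqr_ge0.
- apply/measurable_EFinP; apply: (@measurable_sqnorm (a *: f + g)).
  exact: (strongly_measurableZD a sepY df.1 dg.1).
- by case/integrableP : h.
move=> t _ /=; rewrite lee_fin.
have := rnormD (a *: f t) (g t); rewrite rnormZ.
move=> /(lerXn2r 2) -/(_ _ _)/le_trans -> //.
- by rewrite nnegrE rnorm_ge0.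
- by rewrite nnegrE addr_ge0 ?mulr_ge0 ?rnorm_ge0.
set u := rnorm (a : R[i]^o); set v := rnorm (f t); set w := rnorm (g t).
by have := sqr_ge0 (u * v - w); nra.
Qed.

Lemma L2_rdotE (f g : R -> Y) :
  sip_rdot (f : L2 T Y) g = Rintegral mu I (fun t => rdot (f t) (g t)).
Proof. by []. Qed.

Lemma L2_domZ (a : R[i]) (f : R -> Y) : dom f -> dom (a *: f).
Proof. by move=> df; rewrite -[_ *: _]addr0; apply: L2_domP => //; exact: L2_dom0. Qed.

Lemma L2_ImE (f g : R -> Y) :
  complex.Im (sip_dot (L2 T Y) f g) = sip_rdot (f : L2 T Y) ('i *: (g : R -> Y)).
Proof. by apply: eq_Rintegral => t _; rewrite Im_inner. Qed.

Lemma L2_rdotPl (r : R) (f g h : R -> Y) : dom f -> dom g -> dom h ->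
  sip_rdot (r%:C *: f + g : L2 T Y) h = r * sip_rdot (f : L2 T Y) h + sip_rdot (g : L2 T Y) h.
Proof.
move=> df dg dh; rewrite !L2_rdotE.
under eq_Rintegral do rewrite rdotDl rdotZl.
rewrite RintegralD//; last 2 first.
- by apply: integrable_RZ => //; exact: integrable_rdot.
- exact: integrable_rdot.
by rewrite RintegralZl//; exact: integrable_rdot.
Qed.

Lemma L2_rdotC (f g : R -> Y) : sip_rdot (f : L2 T Y) g = sip_rdot (g : L2 T Y) f.
Proof. by apply: eq_Rintegral => t _; exact: rdotC. Qed.

Lemma L2_rdotiC (f g : R -> Y) : dom f -> dom g ->
  sip_rdot ('i *: f : L2 T Y) g = - sip_rdot (f : L2 T Y) ('i *: (g : R -> Y)).
Proof.
move=> df dg; rewrite !L2_rdotE -mulN1r -RintegralZl//.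
  by apply: eq_Rintegral => t _; rewrite mulN1r -rdotiC.
by apply: integrable_rdot => //; exact: L2_domZ.
Qed.

Lemma L2_sqnormE (f : R -> Y) : dom f -> ((N f ^+ 2)%:E = sqnorm_integral T f)%E.
Proof.
move=> df; have E0 : complex.Re (sip_dot (L2 T Y) f f) = fine (sqnorm_integral T f).
  by apply: eq_Rintegral => t _; rewrite -[LHS]/(rdot _ _) rdotE.
rewrite /sip_norm E0 sqr_sqrtr ?fine_ge0 ?sqnorm_integral_ge0// fineK//.
rewrite ge0_fin_numE ?sqnorm_integral_ge0//; exact: df.2.
Qed.

(** Riesz-Fischer with weights: the sum S of 4^n |f_(n+1) - f_n|^2 has a finite integral. Where S t
    is finite the increments are at most sqrt(S t) 2^-n, so [geometric_cauchy_cvg] gives a pointwise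
    limit together with a tail bound that can be integrated. *)
Lemma L2_complete (f : nat -> R -> Y) (c : R) : (forall n, dom (f n)) ->
  (forall n, N (f n.+1 - f n) <= c * 8^-1 ^+ n) ->
  exists2 g, dom g & N (f n - g) @[n --> \oo] --> (0 : R).
Proof.
move=> df fc.
have domB u v : dom u -> dom v -> dom (u - v).
  by move=> du dv; rewrite addrC -scaleN1r; exact: L2_domP.
pose h n t : R := 4 ^+ n * rnorm (f n.+1 t - f n t) ^+ 2.
have h0 n t : 0 <= h n t by rewrite mulr_ge0 ?sqr_ge0 ?exprn_ge0.
have mh n : measurable_fun I (EFin \o h n).
  apply/measurable_EFinP; apply: measurable_funM; first exact: measurable_cst.
  by apply: (@measurable_sqnorm (f n.+1 - f n)); exact: (domB _ _ (df _) (df _)).1.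
pose S t := (\sum_(0 <= n <oo) (h n t)%:E)%E.
have S0 t : (0 <= S t)%E by apply: nneseries_ge0 => n _ _; rewrite lee_fin.
have mS : measurable_fun I S.
  apply: (@ge0_emeasurable_sum _ _ _ I (fun n t => (h n t)%:E) predT) => //.
    by move=> n t _ _; rewrite lee_fin.
  by move=> n _; exact: mh.
have intS : (\int[mu]_(t in I) S t <= (2 * c ^+ 2)%:E)%E.
  rewrite integral_nneseries//; last by move=> n t _; rewrite lee_fin.
  apply: lime_le.
    by apply: is_cvg_nneseries => n _ _; apply: integral_ge0 => t _; rewrite lee_fin.
  apply: nearW => n.
  apply: (@le_trans _ _ (\sum_(0 <= k < n) (c ^+ 2 * 2^-1 ^+ k)%:E)%E).
    apply: lee_sum => k _.
    under eq_integral do rewrite /h EFinM.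
    rewrite ge0_integralZl_EFin//; last first.
      by apply/measurable_EFinP; apply: (@measurable_sqnorm (f k.+1 - f k));
         exact: (domB _ _ (df _) (df _)).1.
      by move=> t _; rewrite lee_fin sqr_ge0.
    have := L2_sqnormE (domB _ _ (df k.+1) (df k)); rewrite /sqnorm_integral => <-.
    rewrite -EFinM lee_fin.
    have c0 : 0 <= c * 8^-1 ^+ k by apply: le_trans (fc k); exact: sip_norm_ge0.
    have : N (f k.+1 - f k) ^+ 2 <= (c * 8^-1 ^+ k) ^+ 2.
      by rewrite lerXn2r ?nnegrE ?sip_norm_ge0.
    move=> /(ler_wpM2l (exprn_ge0 k (ler0n R 4)))/le_trans -> //.
    rewrite exprMn mulrCA ler_wpM2l ?sqr_ge0// -exprM mulnC exprM -exprMn.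
    rewrite lerXn2r ?nnegrE//.
    by lra.
  rewrite sumEFin lee_fin.
  have -> : \sum_(0 <= k < n) c ^+ 2 * 2^-1 ^+ k = c ^+ 2 * (2 - 2 * 2^-1 ^+ n).
    elim: n => [|n IH]; first by rewrite big_geq// expr0 mulr1 subrr mulr0.
    by rewrite big_nat_recr//= IH [2^-1 ^+ n.+1]exprS; set p := (_ : R) ^+ n; lra.
  by rewrite mulrC ler_wpM2r ?sqr_ge0// gerBl mulr_ge0// exprn_ge0.
pose B := I `&` [set t | (S t < +oo)%E].
have mB : measurable (B : set (measurableTypeR R)).
  have := measurable_fun_lte mS (measurable_cst +oo%E) mI (Logic.I : measurable [set true]).
  by rewrite (_ : _ `&` _ = B).
have hS n t : ((h n t)%:E <= S t)%E.
  apply: le_trans (nneseries_lim_ge n.+1 _); last by move=> k _ _; rewrite lee_fin.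
  rewrite big_nat_recr//= leeDr//.
  by apply: sume_ge0 => k _; rewrite lee_fin.
have /choice[g gP] : forall t, exists y, B t -> f n t @[n --> \oo] --> y /\
    forall n, rnorm (f n t - y) <= 2 * Num.sqrt (fine (S t)) * 2^-1 ^+ n.
  move=> t; have [Bt|nBt] := pselect (B t); last by exists 0.
  have [n|l fl lP] := @geometric_cauchy_cvg _ Y (fun n => f n t) (Num.sqrt (fine (S t))).
    have Sfin : S t \is a fin_num by rewrite ge0_fin_numE//; exact: Bt.2.
    have s0 : 0 <= fine (S t) by rewrite fine_ge0.
    rewrite -ler_sqr ?nnegrE ?rnorm_ge0 ?mulr_ge0 ?sqrtr_ge0 ?exprn_ge0//.
    rewrite exprMn sqr_sqrtr// -exprM mulnC exprM.
    have := hS n t; rewrite -[S t]fineK// lee_fin /h => hS'.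
    have p4 : 0 < (4 : R) ^+ n by rewrite exprn_gt0.
    rewrite -(ler_pM2l p4) (le_trans hS')// mulrCA -exprMn.
    by rewrite (_ : 4 * _ = 1) ?expr1n ?mulr1//; field.
  by exists l.
(* Cutting off to 0 outside B makes the limit a pointwise limit, at every t, of measurable
   functions. *)
pose g' : R -> Y := fun t => if `[< B t >] then g t else 0.
have mfB n : strongly_measurable T (fun t => if `[< B t >] then f n t else 0).
  by apply: strongly_measurable_if => //; [exact: (df n).1|exact: strongly_measurable_cst].
have mg : strongly_measurable T g'.
  apply: (strongly_measurable_lim sepY mfB) => t _; rewrite /g'.
  by case: asboolP => [/gP[]//|_]; exact: cvg_cst.
have mfg n : strongly_measurable T (f n - g').
  have := strongly_measurableZD (-1) sepY mg (df n).1.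
  by congr strongly_measurable; apply/funext => t; rewrite scaleN1r addrC.
(* The tail bound squared is 4 * 4^-n * S t, and S has integral at most 2 c^2; where S is infinite
   the bound is trivial. *)
have key n : (sqnorm_integral T (f n - g')%R <= (4 * 4^-1 ^+ n * (2 * c ^+ 2))%:E)%E.
  have p4 : 0 < 4 * (4^-1 : R) ^+ n by rewrite mulr_gt0// exprn_gt0.
  apply: (@le_trans _ _ (\int[mu]_(t in I) ((4 * 4^-1 ^+ n)%:E * S t))%E).
    apply: ge0_le_integral => //.
    - by move=> t _; rewrite lee_fin sqr_ge0.
    - by apply/measurable_EFinP; exact: (@measurable_sqnorm (f n - g')).
    - by apply: measurable_funeM.
    move=> t It.
    have [Bt|nBt] := pselect (B t); last first.
      have -> : S t = +oo%E.
        by apply/eqP; rewrite eq_le leey/= leNgt; apply/negP => ?; apply: nBt.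
      by rewrite gt0_muley ?lte_fin// leey.
    have [_ /(_ n)] := gP t Bt.
    have Sfin : S t \is a fin_num by rewrite ge0_fin_numE//; exact: Bt.2.
    have s0 : 0 <= fine (S t) by rewrite fine_ge0.
    rewrite -[S t]fineK// -EFinM lee_fin.
    have -> : (f n - g') t = f n t - g t.
      by rewrite /g' -[LHS]/(f n t - _); case: asboolP.
    move=> /(lerXn2r 2) -/(_ _ _)/le_trans -> //.
    - by rewrite nnegrE rnorm_ge0.
    - by rewrite nnegrE !mulr_ge0 ?sqrtr_ge0 ?exprn_ge0.
    rewrite !exprMn sqr_sqrtr// -exprM mulnC exprM.
    rewrite (_ : 2^-1 ^+ 2 = 4^-1); last by field.
    by rewrite le_eqVlt; apply/orP; left; apply/eqP; ring.
  rewrite (ge0_integralZl_EFin mu mI (fun t _ => S0 t) mS (ltW p4)).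
  by rewrite [leRHS]EFinM lee_pmul2l.
have dfg n : dom (f n - g').
  by split => //; rewrite (le_lt_trans (key n))// ltry.
have dg : dom g'.
  rewrite (_ : g' = f 0%N - (f 0%N - g')); first exact: domB.
  by rewrite subKr.
exists g' => //.
have q0 : 0 <= 8 * c ^+ 2 by rewrite mulr_ge0// sqr_ge0.
have NP n : N (f n - g') <= Num.sqrt (8 * c ^+ 2) * 2^-1 ^+ n.
  rewrite -ler_sqr ?nnegrE ?sip_norm_ge0 ?mulr_ge0 ?sqrtr_ge0 ?exprn_ge0//.
  have := key n; rewrite -L2_sqnormE// lee_fin => /le_trans ->//.
  rewrite exprMn sqr_sqrtr// -exprM mulnC exprM (_ : 2^-1 ^+ 2 = 4^-1); last by field.
  by rewrite le_eqVlt; apply/orP; left; apply/eqP; ring.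
apply: (@squeeze_cvgr _ _ _ _ (cst 0) (fun n => Num.sqrt (8 * c ^+ 2) * 2^-1 ^+ n)).
- by apply: nearW => n; rewrite NP sip_norm_ge0.
- exact: cvg_cst.
- rewrite -(mulr0 (Num.sqrt (8 * c ^+ 2))); apply: cvgM; first exact: cvg_cst.
  by apply: cvg_expr; rewrite ger0_norm// invf_lt1// ltr1n.
Qed.

(** The inner product of [L2] is given by two real integrals. Complex linearity follows from real
    linearity by splitting the scalar as Re a + i Im a and reading imaginary parts through
    [L2_ImE]. *)
Lemma hs_L2 : hilbert_sip (L2 T Y).
Proof.
split.
- exact: L2_dom0.
- exact: L2_domP.
- move=> a f g h df dg dh.
  have dif := L2_domZ 'i df; have dih := L2_domZ 'i dh.
  have key (k : R -> Y) : dom k -> sip_rdot (a *: f + g : L2 T Y) k =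
      complex.Re a * sip_rdot (f : L2 T Y) k +
      (complex.Im a * sip_rdot ('i *: f : L2 T Y) k + sip_rdot (g : L2 T Y) k).
    move=> dk; rewrite -L2_rdotPl// -L2_rdotPl//; last exact: L2_domP.
    by congr sip_rdot; rewrite addrA scalerA -scalerDl mulrC -complexE.
  have kR := key h dh; have kI := key _ dih.
  have iiE : sip_rdot ('i *: f : L2 T Y) ('i *: (h : R -> Y)) = sip_rdot (f : L2 T Y) h.
    by apply: eq_Rintegral => t _; exact: rdotii.
  rewrite iiE -!L2_ImE in kI.
  rewrite L2_rdotiC// -L2_ImE in kR.
  move: kR kI; rewrite /sip_rdot.
  case: (sip_dot _ (a *: f + g) h) => p q; case: (sip_dot _ f h) => p1 q1.
  case: (sip_dot _ g h) => p2 q2 /= -> ->.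
  by case: a {key} => a1 a2 /=; apply/eqP; rewrite eq_complex /=; apply/andP; split; apply/eqP; ring.
- move=> f g df dg; have := L2_rdotC f g.
  have := L2_ImE g f; rewrite L2_rdotC L2_rdotiC// -L2_ImE /sip_rdot.
  by case: (sip_dot _ f g) => a b; case: (sip_dot _ g f) => c d /= -> ->.
- move=> f df; apply: Rintegral_ge0 => t _.
  by rewrite -[leRHS]/(rdot _ _) rdotE sqr_ge0.
- exact: L2_complete.
Qed.

End LebesgueSpace.

(** * Invariance of Lebesgue integrals under translation and reflection *)

Section AffineChange.
Context {R : realType}.
Local Notation mu := (@lebesgue_measure R).
Local Notation MR := (measurableTypeR R).

Lemma measurable_affine (s c : R) : measurable_fun [set: MR] (fun t : MR => s * t + c : MR).
Proof.
apply: measurable_funD; last exact: measurable_cst.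
by apply: measurable_funM; [exact: measurable_cst|exact: measurable_id].
Qed.

(** Lebesgue measure is determined by its values on the intervals ]a, b]. Here s is 1 or -1, and for
    s = -1 the preimage is half-open on the other side, with the same length. *)
Lemma lebesgue_measure_affine (s c : R) (A : set MR) : `|s| = 1 -> measurable A ->
  mu ((fun t => s * t + c) @^-1` A) = mu A.
Proof.
move=> s1 mA; rewrite -[LHS]/(pushforward mu (fun t : MR => s * t + c : MR) A).
apply/esym; move: A mA.
apply: (@lebesgue_measure_unique _ (pushforward mu (fun t : MR => s * t + c : MR))).
  exact: measurable_affine.
move=> ? _ [[a b] _ <-]; rewrite /= /pushforward.
have mitv i j x y : (i <= j)%O -> mu [set` Interval (BSide x i) (BSide y j)] = (j - i)%:E.
  move=> ij; rewrite lebesgue_measure_itv /= lte_fin.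
  have [_|ji] := ltP i j; first by rewrite -EFinD.
  by rewrite (_ : i = j) ?subrr//; apply/eqP; rewrite eq_le ij.
have [ba|ab] := ltP b a.
  have e0 : `]a, b]%classic = set0 by apply: set_itv_ge; rewrite bnd_simp -leNgt ltW.
  by rewrite /= e0 preimage_set0 !measure0.
have /orP[/eqP s1'|/eqP s1'] : (s == 1) || (s == -1) by have := eqr_norml s 1; rewrite s1 eqxx ler01 andbT => <-.
  rewrite (_ : _ @^-1` _ = `]a - c, b - c]%classic).
    by rewrite !mitv ?lerD2r//; congr (_%:E); ring.
  apply/seteqP; split => t /=; rewrite !in_itv /= s1' mul1r => /andP[? ?].
    by apply/andP; split; lra.
  by apply/andP; split; lra.
rewrite (_ : _ @^-1` _ = `[c - b, c - a[%classic).
  by rewrite !mitv ?lerD2l ?lerN2//; congr (_%:E); ring.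
apply/seteqP; split => t /=; rewrite !in_itv /= s1' mulN1r => /andP[? ?].
  by apply/andP; split; lra.
by apply/andP; split; lra.
Qed.

Lemma ge0_integral_affine (s c : R) (D : set MR) (f : MR -> \bar R) : `|s| = 1 ->
  measurable D -> measurable_fun D f -> (forall t, D t -> (0 <= f t)%E) ->
  (\int[mu]_(t in (fun t => (s * t + c)%R) @^-1` D) f (s * t + c)%R = \int[mu]_(t in D) f t)%E.
Proof.
move=> s1 mD mf f0.
transitivity (\int[pushforward mu (fun t : MR => (s * t + c)%R : MR)]_(t in D) f t)%E.
  rewrite ge0_integral_pushforward//; first exact: measurable_affine.
  by move=> t; rewrite inE; exact: f0.
apply: eq_measure_integral; first exact: measurable_affine.
move=> ? A mA _; exact: lebesgue_measure_affine.
Qed.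

Lemma Rintegral_affine (s c : R) (D : set MR) (f : R -> R) : `|s| = 1 ->
  measurable D -> measurable_fun D f ->
  Rintegral mu ((fun t => s * t + c) @^-1` D) (fun t => f (s * t + c)) = Rintegral mu D f.
Proof.
move=> s1 mD mf; rewrite /Rintegral; congr fine.
have mf' : measurable_fun D (EFin \o f) by apply/measurable_EFinP.
rewrite integralE [RHS]integralE; congr (_ - _)%E.
  rewrite -(ge0_integral_affine c s1 mD (measurable_funepos mf') (fun t _ => funepos_ge0 _ t)).
  by apply: eq_integral => t _; rewrite !funeposE.
rewrite -(ge0_integral_affine c s1 mD (measurable_funeneg mf') (fun t _ => funeneg_ge0 _ t)).
by apply: eq_integral => t _; rewrite !funenegE.
Qed.

Lemma measurable_fun_affine (s c : R) (D : set MR) (f : R -> R) : measurable D ->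
  measurable_fun D f ->
  measurable_fun ((fun t => s * t + c) @^-1` D : set MR) (fun t => f (s * t + c)).
Proof.
move=> mD mf; apply: (@measurable_comp _ _ _ _ _ _ D) => //.
  by move=> _ [t Dt <-].
exact: measurable_funS (measurable_affine s c).
Qed.

End AffineChange.

(** * Weak integrals of Hilbert-space-valued functions *)

Section WeakIntegral.
Context {R : realType} {V : hilbertType R}.
Local Notation mu := (@lebesgue_measure R).
Local Notation MR := (measurableTypeR R).
Variables (D : set MR) (mD : measurable D).

(** The Pettis integral, tested with real parts only, which determine a vector by [rdot_injl].
    Existence is the Riesz theorem, and bounded operators pass through it by their adjoints. *)
Definition weak_integral (g : R -> V) (z : V) :=
  forall y, rdot z y = Rintegral mu D (fun t => rdot (g t) y).

Lemma integrable_rdot_dominated (g : R -> V) (k : R -> R) y :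
  (forall y, measurable_fun D (fun t => rdot (g t) y)) ->
  mu.-integrable D (EFin \o k) -> (forall t, D t -> rnorm (g t) <= k t) ->
  mu.-integrable D (EFin \o (fun t => rdot (g t) y)).
Proof.
move=> mg ik gk.
apply: (@le_integrable _ _ _ mu D mD _ (EFin \o (fun t => rnorm y * k t))).
- by apply/measurable_EFinP.
- move=> t Dt; rewrite lee_fin (le_trans (rdot_CS _ _))//.
  have k0 : 0 <= k t by rewrite (le_trans _ (gk t Dt))// rnorm_ge0.
  by rewrite ger0_norm ?mulr_ge0 ?rnorm_ge0// mulrC ler_wpM2l ?rnorm_ge0 ?gk.
- exact: integrable_RZ.
Qed.

Lemma weak_integral_norm (g : R -> V) (k : R -> R) z :
  (forall y, measurable_fun D (fun t => rdot (g t) y)) ->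
  mu.-integrable D (EFin \o k) -> (forall t, D t -> rnorm (g t) <= k t) ->
  weak_integral g z -> rnorm z <= Rintegral mu D k.
Proof.
move=> mg ik gk gz; apply: rnorm_le_rdot.
  by apply: Rintegral_ge0 => t Dt; rewrite (le_trans _ (gk t Dt))// rnorm_ge0.
move=> y; rewrite gz -RintegralZr//; apply: le_Rintegral => //.
- exact: integrable_rdot_dominated ik gk.
- by have := integrable_RZ mD (rnorm y) ik; congr (_.-integrable _ _);
    apply/funext => t /=; rewrite mulrC.
- move=> t Dt; rewrite (le_trans (rdot_le _ _))//.
  by rewrite ler_wpM2r ?rnorm_ge0// gk.
Qed.

Lemma weak_integral_exists (g : R -> V) (k : R -> R) :
  (forall y, measurable_fun D (fun t => rdot (g t) y)) ->
  mu.-integrable D (EFin \o k) -> (forall t, D t -> rnorm (g t) <= k t) ->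
  exists z, weak_integral g z.
Proof.
move=> mg ik gk.
have ig y := integrable_rdot_dominated y mg ik gk.
have [r x y|x|z zP] := @riesz_rdot _ _ (fun y => Rintegral mu D (fun t => rdot (g t) y))
  (Rintegral mu D k).
- under eq_Rintegral do rewrite rdotDr rdotZr.
  by rewrite RintegralD//; [rewrite RintegralZl|exact: integrable_RZ].
- rewrite (le_trans (le_normr_Rintegral _ _))// -RintegralZr//.
  apply: le_Rintegral => //.
  + by have /integrable_abse := ig x; congr (_.-integrable _ _).
  + by have := integrable_RZ mD (rnorm x) ik; congr (_.-integrable _ _);
      apply/funext => t /=; rewrite mulrC.
  + move=> t Dt; rewrite (le_trans (rdot_CS _ _))//.
    by rewrite ler_wpM2r ?rnorm_ge0// gk.
by exists z => y; rewrite rdotC -zP.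
Qed.

Lemma weak_integral_unique (g : R -> V) z z' :
  weak_integral g z -> weak_integral g z' -> z = z'.
Proof. by move=> gz gz'; apply: rdot_injl => y; rewrite gz gz'. Qed.

End WeakIntegral.

(** * The uniform boundedness principle *)

Section UniformBoundedness.
Context {R : realType} {V : completeNormedModType R[i]} {W : normedModType R[i]}.

(* Gliding hump. *)
Lemma uniform_boundedness (F : nat -> V -> W) :
  (forall n, linear (F n)) ->
  (forall n, exists M : R, forall x, rnorm (F n x) <= M * rnorm x) ->
  (forall x, exists M : R, forall n, rnorm (F n x) <= M) ->
  exists M : R, forall n x, rnorm (F n x) <= M * rnorm x.
Proof.
move=> linF bndF ptF; apply: contrapT => nubF.
have FD n x y : F n (x + y) = F n x + F n y.
  by have := linF n 1 x y; rewrite !scale1r.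
have F0 n : F n 0 = 0.
  by have := FD n 0 0; rewrite addr0 -{1}[F n 0]addr0 => /addrI.
have FZ n a x : F n (a *: x) = a *: F n x.
  by have := linF n a x 0; rewrite F0 !addr0.
have FB n x y : F n (x - y) = F n x - F n y by rewrite FD -scaleN1r FZ scaleN1r.
have big (M : R) : exists n u, rnorm u = 1 /\ M < rnorm (F n u).
  apply: contrapT => nb; apply: nubF; exists M => n x.
  have [->|x0] := eqVneq x 0; first by rewrite F0 !rnorm0 mulr0.
  have Nx : 0 < rnorm x.
    rewrite lt_neqAle rnorm_ge0 andbT eq_sym; apply/eqP => /rnorm_eq0 /eqP.
    by rewrite (negbTE x0).
  rewrite leNgt; apply/negP => h; apply: nb; exists n, ((rnorm x)^-1%:C *: x).
  rewrite FZ !rnormZr gtr0_norm ?invr_gt0// mulVf ?gt_eqF//; split => //.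
  by rewrite mulrC ltr_pdivlMr.
(* A pair is a centre with a radius. The new radius is at most half the old one, the centre moves by
   at most the old radius, and some [F n] has norm at least k at every point within twice the new
   radius. *)
have step (k : nat) (p : V * R) : exists q : V * R, 0 < p.2 ->
    [/\ 0 < q.2, q.2 <= p.2 / 2, rnorm (q.1 - p.1) <= p.2 &
        exists n, forall l, rnorm (q.1 - l) <= 2 * q.2 -> k%:R <= rnorm (F n l)].
  case: p => x r; have [/= r0|] := ltP 0 r; last by exists (x, r) => /=; lra.
  have [n [u [u1 Fu]]] := big ((k%:R + 1) / r).
  have [M0 M0P] := bndF n.
  pose M := Num.max M0 1.
  have M1 : 1 <= M by rewrite le_max lexx orbT.
  have MP y : rnorm (F n y) <= M * rnorm y.
    by rewrite (le_trans (M0P y))// ler_wpM2r ?rnorm_ge0// le_max lexx.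
  (* The values of [F n] at x + r u and x - r u differ by 2 r F n u, so one of them has norm at
     least k + 1. *)
  have [x' [x'x Fx']] : exists x', rnorm (x' - x) <= r /\ k%:R + 1 <= rnorm (F n x').
    have hsum : 2 * (k%:R + 1) <= rnorm (F n (x + r%:C *: u)) + rnorm (F n (x - r%:C *: u)).
      have := rnormB (F n (x + r%:C *: u)) (F n (x - r%:C *: u)); rewrite -FB.
      rewrite opprB addrC addrA subrK -mulr2n -scaler_nat FZ FZ !rnormZ rnorm_real.
      rewrite [rnorm (2%:R : R[i]^o)]/rnorm normr_nat.
      rewrite gtr0_norm// (_ : complex.Re 2%:R = 2); last by rewrite raddfMn.
      move: Fu; rewrite ltr_pdivrMr// mulrC => /ltW h; apply: le_trans.
      by rewrite ler_wpM2l.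
    have [h|h] := leP (k%:R + 1) (rnorm (F n (x + r%:C *: u))).
      exists (x + r%:C *: u); split => //.
      by rewrite addrC addKr rnormZr u1 mulr1 gtr0_norm.
    exists (x - r%:C *: u); split.
      by rewrite addrC addKr rnormN rnormZr u1 mulr1 gtr0_norm.
    by move: h hsum; set a := rnorm _; set b := rnorm _; lra.
  have M0' : 0 < M by rewrite (lt_le_trans ltr01).
  (* Within twice the radius 1 / (2 M) the value of [F n] moves by at most 1, the margin left in k +
     1. *)
  exists (x', Num.min (r / 2) (2^-1 / M)) => _ /=; split => //.
  - by rewrite lt_min !divr_gt0.
  - by rewrite ge_min lexx.
  - exists n => l hl.
    have : M * rnorm (x' - l) <= 1.
      rewrite mulrC -ler_pdivlMr// (le_trans hl)//.
      rewrite (le_trans (ler_wpM2l _ (_ : _ <= 2^-1 / M)))//; first by rewrite ge_min lexx orbT.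
      by rewrite mulrA divff// mul1r div1r.
    have := rnorm_dist (F n x') (F n l); rewrite -FB ler_norml => /andP[_].
    by have := MP (x' - l); lra.
have /choice[f fP] : forall kp : nat * (V * R), exists q : V * R, 0 < kp.2.2 ->
    [/\ 0 < q.2, q.2 <= kp.2.2 / 2, rnorm (q.1 - kp.2.1) <= kp.2.2 &
        exists n, forall l, rnorm (q.1 - l) <= 2 * q.2 -> kp.1%:R <= rnorm (F n l)].
  by move=> [k p]; exact: step.
pose fix p n : V * R := if n isn't n.+1 then (0, 1) else f (n, p n).
have p0 n : 0 < (p n).2.
  by elim: n => [|n IH] /=; [exact: ltr01|have [] := fP (n, p n) IH].
have pS n := fP (n, p n) (p0 n).
have phalf m n : (p (m + n)%N).2 <= (p m).2 * 2^-1 ^+ n.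
  elim: n => [|n IH]; first by rewrite addn0 expr0 mulr1.
  have [_ h _ _] := pS (m + n)%N; rewrite addnS (le_trans h)//= exprS mulrCA.
  by rewrite mulrC ler_wpM2l.
have cauchy m : exists2 l, (p (m + n)%N).1 @[n --> \oo] --> l &
    forall n, rnorm ((p (m + n)%N).1 - l) <= 2 * (p m).2 * 2^-1 ^+ n.
  apply: geometric_cauchy_cvg => n; rewrite addnS.
  by have [_ _ h _] := pS (m + n)%N; rewrite (le_trans h)// phalf.
have [l pl _] := cauchy 0%N.
(* The geometric tail bound, started at index m, keeps the limit l within reach of every ball. *)
have lP m : rnorm ((p m).1 - l) <= 2 * (p m).2.
  have [l' pl' /(_ 0%N)] := cauchy m; rewrite addn0 expr0 mulr1.
  suff -> : l' = l by [].
  have : (p (m + n)%N).1 @[n --> \oo] --> l.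
    rewrite (_ : (fun n => _) = [sequence (p (n + m)%N).1]_n).
      by rewrite (cvg_shiftn m (fun n => (p n).1)).
    by apply/funext => n /=; rewrite addnC.
  exact: (cvg_unique _ pl').
have [M MP] := ptF l.
have [k kM] : exists k : nat, M < k%:R.
  by exists (Num.truncn M).+1; rewrite truncnS_gt.
have [_ _ _ [n /(_ l (lP k.+1)) /= h]] := pS k.
by have := MP n; rewrite leNgt (lt_le_trans kM).
Qed.

End UniformBoundedness.

(** * Bounded linear operators, adjoints and the Neumann series *)

Section BoundedLinear.
Context {R : realType}.

Definition bounded_linear (V W : normedModType R[i]) (F : V -> W) :=
  linear F /\ exists M : R, forall x, rnorm (F x) <= M * rnorm x.

Section Theory.
Context {V W : normedModType R[i]} (F : V -> W).
Hypothesis linF : linear F.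

Lemma lin0 : F 0 = 0.
Proof. by have := linF (-1) 0 0; rewrite scaleN1r oppr0 addr0 scaleN1r addNr. Qed.

Lemma linD x y : F (x + y) = F x + F y.
Proof. by have := linF 1 x y; rewrite !scale1r. Qed.

Lemma linZ a x : F (a *: x) = a *: F x.
Proof. by have := linF a x 0; rewrite lin0 !addr0. Qed.

Lemma linN x : F (- x) = - F x.
Proof. by rewrite -scaleN1r linZ scaleN1r. Qed.

Lemma linB x y : F (x - y) = F x - F y.
Proof. by rewrite linD linN. Qed.

Lemma continuous_bounded_linear : continuous F -> bounded_linear F.
Proof.
move=> cF; split => //.
have [e e0 eP] : exists2 e : R, 0 < e & forall x, rnorm x < e -> rnorm (F x) <= 1.
  have /cvg_rnormP/(_ 1 ltr01)/nbhs_ballP[e /= e0 eP] := cF 0.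
  have eE : e = (complex.Re e)%:C by rewrite RRe_real// gtr0_real.
  exists (complex.Re e); first by rewrite -ltcR -eE.
  move=> x xe; have : ball 0 e x.
    by rewrite -ball_normE /= sub0r normrN rnormE eE ltcR.
  by move=> /eP /=; rewrite lin0 subr0 => /ltW.
exists (2 / e) => x.
have [->|x0] := eqVneq x 0; first by rewrite lin0 !rnorm0 mulr0.
have Nx : 0 < rnorm x.
  rewrite lt_neqAle rnorm_ge0 andbT eq_sym; apply/eqP => /rnorm_eq0 /eqP.
  by rewrite (negbTE x0).
have c0 : 0 < e / 2 / rnorm x by rewrite !divr_gt0.
have e2 : e / 2 < e by lra.
have := eP ((e / 2 / rnorm x)%:C *: x).
rewrite linZ !rnormZr gtr0_norm// divfK ?gt_eqF// => /(_ e2) h.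
have -> : 2 / e * rnorm x = (e / 2 / rnorm x)^-1 by field; rewrite !gt_eqF.
by rewrite -[leRHS]mulr1 ler_pdivlMl.
Qed.

End Theory.

Lemma bounded_linear_cvg {V W : normedModType R[i]} (F : V -> W) {T : Type}
    {G : set_system T} {FG : Filter G} (f : T -> V) l :
  bounded_linear F -> f @ G --> l -> F (f t) @[t --> G] --> F l.
Proof.
move=> [linF [M MP]] fl; apply: (rnorm_squeeze (g := fun t => M * rnorm (f t - l))).
  by apply: nearW => t; rewrite -linB.
rewrite -(mulr0 M); apply: cvgM; first exact: cvg_cst.
exact/cvg_rnorm0P.
Qed.

Lemma bounded_linear_adjoint {V W : hilbertType R} (F : V -> W) : bounded_linear F ->
  exists G : W -> V, forall x y, inner (F x) y = inner x (G y).
Proof.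
move=> [linF [M MP]].
have /choice[G GP] : forall y, exists z, forall x, rdot (F x) y = rdot x z.
  move=> y; apply: (riesz_rdot (M := M * rnorm y)) => [r u v|x].
    by rewrite linF rdotDl rdotZl.
  by rewrite (le_trans (rdot_CS _ _))// mulrAC ler_wpM2r ?rnorm_ge0.
exists G => x y; apply: inner_eq_rdot; first exact: GP.
by apply: oppr_inj; rewrite -!rdotiC -linZ// GP.
Qed.

(** Iterate w -> z + K w from z; the increments halve at each step. *)
Lemma neumann {V : completeNormedModType R[i]} (K : V -> V) (z : V) : linear K ->
  (forall x, rnorm (K x) <= 2^-1 * rnorm x) ->
  exists2 w, w - K w = z & rnorm w <= 2 * rnorm z.
Proof.
move=> linK KP.
pose fix w n := if n isn't n.+1 then z else z + K (w n).
have wS n : rnorm (w n.+1 - w n) <= (2^-1 * rnorm z) * 2^-1 ^+ n.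
  elim: n => [|n IH]; first by rewrite /= addrC addKr expr0 mulr1 KP.
  rewrite [w n.+2]/= [w n.+1 in X in _ - X]/= opprD addrACA subrr add0r -linB//.
  rewrite (le_trans (KP _))// exprS mulrCA ler_wpM2l//.
have [l wl /(_ 0%N)] := geometric_cauchy_cvg wS.
rewrite expr0 mulr1 /= => lz.
exists l; last by have := rnorm_triangle 0 z l; rewrite !sub0r !rnormN; lra.
have Kb : bounded_linear K by split => //; exists 2^-1.
have : w n.+1 @[n --> \oo] --> z + K l.
  by apply: cvgD; [exact: cvg_cst|exact: bounded_linear_cvg wl].
have wl' : w n.+1 @[n --> \oo] --> l by rewrite (cvg_shiftS w).
move=> /(cvg_unique (@norm_hausdorff _ _) wl') lE; apply/eqP; rewrite subr_eq; exact/eqP.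
Qed.

End BoundedLinear.

(** * Boundedness of a strongly continuous semigroup on bounded intervals *)

Section Semigroup.
Context {R : realType} {H : hilbertType R} (S : R -> H -> H).
Hypothesis hS : C0_semigroup S.
Local Notation mu := (@lebesgue_measure R).
Local Notation I b := (`[0, b]%classic : set (measurableTypeR R)).

Lemma sg_lin t : 0 <= t -> linear (S t).
Proof. by move=> t0; case: hS => h _ _ _; case: (h t t0). Qed.

Lemma sg_bounded_linear t : 0 <= t -> bounded_linear (S t).
Proof.
move=> t0; case: hS => h _ _ _; case: (h t t0) => lS cS.
exact: continuous_bounded_linear.
Qed.

Lemma sg0 x : S 0 x = x. Proof. by case: hS. Qed.

Lemma sgD s t x : 0 <= s -> 0 <= t -> S (s + t) x = S s (S t x).
Proof. by case: hS => _ _ h _; exact: h. Qed.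

Lemma sg_cvg0 x (e : R) : 0 < e ->
  exists2 d, 0 < d & forall t, 0 <= t < d -> rnorm (S t x - x) < e.
Proof.
move=> e0; case: hS => _ _ _ /(_ x)/cvg_rnormP/(_ e e0) [d /= d0 dP].
exists d => // t; have [->|t0] := eqVneq t 0.
  by move=> _; rewrite sg0 subrr rnorm0.
move=> /andP[t0' td]; apply: dP; last by rewrite /= lt_neqAle eq_sym t0.
by rewrite /= sub0r normrN ger0_norm.
Qed.

(** Otherwise there are times t_n -> 0 at which the operator norm exceeds n. Each sequence S(t_n) x
    converges to x, hence is bounded, against the uniform boundedness principle. *)
Lemma sg_bound0 : exists2 d, 0 < d & exists M : R, forall t, 0 <= t <= d ->
  forall x, rnorm (S t x) <= M * rnorm x.
Proof.
apply: contrapT => nb.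
have /choice[t tP] : forall n : nat, exists t : R, 0 <= t <= n.+1%:R^-1 /\
    exists x, n%:R * rnorm x < rnorm (S t x).
  move=> n; apply: contrapT => nt; apply: nb; exists n.+1%:R^-1; first by rewrite invr_gt0.
  exists n%:R => t t0 x; rewrite leNgt; apply/negP => h; apply: nt; exists t.
  by split => //; exists x.
have t0 n : 0 <= t n by have [/andP[]] := tP n.
have [||x|M MP] := @uniform_boundedness R H H (fun n => S (t n)).
- by move=> n; exact: sg_lin.
- by move=> n; case: (sg_bounded_linear (t0 n)).
- have [d d0 dP] := sg_cvg0 x ltr01.
  have [N Nd] : exists N : nat, forall n, (N <= n)%N -> t n < d.
    exists (Num.truncn d^-1) => n Nn; have [/andP[_ tn] _] := tP n.
    rewrite (le_lt_trans tn)// invf_plt ?posrE//.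
    by rewrite (lt_le_trans (truncnS_gt _))// ler_nat.
  (* The first two terms cover the indices with t n < d, the sum covers the finitely many before
     N. *)
  exists (rnorm x + 1 + \sum_(k < N) rnorm (S (t k) x)) => n.
  have [Nn|nN] := leqP N n.
    have := dP (t n); rewrite t0 Nd// => /(_ isT).
    have := rnormD (S (t n) x - x) x; rewrite subrK.
    have : 0 <= \sum_(k < N) rnorm (S (t k) x) by apply: sumr_ge0 => k _; exact: rnorm_ge0.
    lra.
  rewrite (bigD1 (Ordinal nN))//=.
  have : 0 <= \sum_(k < N | k != Ordinal nN) rnorm (S (t k) x).
    by apply: sumr_ge0 => k _; exact: rnorm_ge0.
  by have := rnorm_ge0 x; lra.
pose n := (Num.truncn M).+1.
have [_ [x]] := tP n; have := MP n x.
have : M * rnorm x <= n%:R * rnorm x.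
  by rewrite ler_wpM2r ?rnorm_ge0// ltW// truncnS_gt.
lra.
Qed.

(** Split a time in [0, b] into steps of length at most d; each costs a factor M >= 1. *)
Lemma sg_bound b : exists2 M : R, 0 <= M & forall t, 0 <= t <= b ->
  forall x, rnorm (S t x) <= M * rnorm x.
Proof.
have [d d0 [M' M'P]] := sg_bound0.
pose M := Num.max M' 1; have M1 : 1 <= M by rewrite le_max lexx orbT.
have M0 : 0 <= M by rewrite (le_trans ler01).
have MP t : 0 <= t <= d -> forall x, rnorm (S t x) <= M * rnorm x.
  by move=> /M'P h x; rewrite (le_trans (h x))// ler_wpM2r ?rnorm_ge0// le_max lexx.
have h n t : 0 <= t <= n%:R * d -> forall x, rnorm (S t x) <= M ^+ n * rnorm x.
  elim: n t => [|n IH] t /andP[t0 tn] x.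
    have -> : t = 0 by apply/eqP; rewrite eq_le t0 andbT -(mul0r d).
    by rewrite sg0 expr0 mul1r.
  have [td|dt] := leP t d.
    rewrite (le_trans (MP t _ x)) ?t0// ler_wpM2r ?rnorm_ge0//.
    by rewrite exprS ler_peMr// exprn_ege1.
  have t1 : 0 <= t - d by rewrite subr_ge0 ltW.
  rewrite -(subrKC d t) sgD ?(ltW d0)//.
  have dd : 0 <= d <= d by rewrite lexx ltW.
  rewrite (le_trans (MP d dd _))// exprS -mulrA ler_wpM2l//.
  by apply: IH; rewrite t1/= lerBlDr; move: tn; rewrite -[n.+1%:R]natr1 mulrDl mul1r.
pose n := (Num.truncn (b / d)).+1.
exists (M ^+ n); first exact: exprn_ge0.
move=> t /andP[t0 tb] x; apply: h; rewrite t0/= (le_trans tb)//.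
by rewrite -ler_pdivrMr// ltW// truncnS_gt.
Qed.

End Semigroup.

Lemma rdotZJ {R : realType} {V : hilbertType R} (a : R[i]) (x y : V) :
  rdot (a *: x) y = rdot x (a^*%C *: y).
Proof.
rewrite /rdot linearZl_LR linearZr_LR; congr (complex.Re (_ * _)).
exact/esym/conjcK.
Qed.

(** * Integrals of orbits *)

Section OrbitIntegral.
Context {R : realType} {H : hilbertType R} (S : R -> H -> H).
Hypothesis hS : C0_semigroup S.
Local Notation mu := (@lebesgue_measure R).
Local Notation MR := (measurableTypeR R).
Local Notation I b := (`[0, b]%classic : set MR).

Lemma sg_modulus b M x : (forall t, 0 <= t <= b -> forall x, rnorm (S t x) <= M * rnorm x) ->
  forall s t, 0 <= s <= b -> 0 <= t <= b ->
  rnorm (S t x - S s x) <= M * rnorm (S `|t - s| x - x).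
Proof.
move=> MP s t; wlog st : s t / s <= t => [h sb tb|].
  have [st|/ltW ts] := leP s t; first exact: h.
  by rewrite rnormC distrC; exact: h.
move=> /andP[s0 sb] /andP[t0 tb].
have ts : 0 <= t - s by rewrite subr_ge0.
have -> : S t x = S s (S (t - s) x) by rewrite -(sgD hS)// subrKC.
rewrite ger0_norm// -(linB (sg_lin hS s0)).
by apply: MP; rewrite s0.
Qed.

Lemma sg_orbit_cvg (b : R) x (t : R) (f : R -> R) {F : set_system R} {FF : Filter F} :
  0 <= t <= b -> f @ F --> t -> (\forall s \near F, 0 <= f s <= b) ->
  S (f s) x @[s --> F] --> S t x.
Proof.
move=> tb ft fb; have [M M0 MP] := sg_bound hS b.
apply/cvg_rnormP => e e0.
have M1 : 0 < M + 1 by rewrite ltr_wpDl.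
have [d d0 dP] := sg_cvg0 hS x (divr_gt0 e0 M1).
move/cvgrPdist_lt : ft => /(_ d d0) h.
apply: filterS2 fb h => s sb sd.
rewrite (le_lt_trans (sg_modulus x MP tb sb))//.
have := dP `|f s - t|; rewrite normr_ge0 distrC sd => /(_ isT).
rewrite ltr_pdivlMr// mulrC; apply: le_lt_trans.
by rewrite ler_wpM2r ?rnorm_ge0// lerDl.
Qed.

Lemma sg_orbit_within b x : {within I b, continuous (fun t => S t x)}.
Proof.
apply/subspace_continuousP => t; rewrite /= in_itv /= => tb.
apply: (@sg_orbit_cvg b) => //; first exact: cvg_within.
near=> s; have : I b s by near: s; exact: withinT.
by rewrite /= in_itv.
Unshelve. all: by end_near. Qed.

Lemma measurable_orbit b x y : measurable_fun (I b) (fun s => rdot (S s x) y).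
Proof.
apply: subspace_continuous_measurable_fun; first exact: measurable_I.
apply/subspace_continuousP => t It; apply: cvg_rdot.
by move/subspace_continuousP : (@sg_orbit_within b x) => /(_ t It).
Qed.

Lemma integrable_cst_I b (r : R) : mu.-integrable (I b) (EFin \o (fun=> r)).
Proof.
apply: measurable_bounded_integrable.
- exact: measurable_I.
- exact: mu_I_fin.
- exact: measurable_cst.
exists `|r|; split; first exact: num_real.
by move=> x rx s _ /=; exact: ltW.
Qed.

Lemma integrable_orbit b x y : mu.-integrable (I b) (EFin \o (fun s => rdot (S s x) y)).
Proof.
have [M M0 MP] := sg_bound hS b.
apply: (@integrable_rdot_dominated R H (I b) (@measurable_I R b) _ (fun=> M * rnorm x)).
- exact: measurable_orbit.
- exact: integrable_cst_I.
- by move=> t; rewrite /= in_itv /= => /MP.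
Qed.

Definition orbit_int b x : H := xget 0 [set z | weak_integral (I b) (fun s => S s x) z].

Lemma orbit_intP b x : weak_integral (I b) (fun s => S s x) (orbit_int b x).
Proof.
have [M M0 MP] := sg_bound hS b.
rewrite /orbit_int; case: xgetP => // /(_ _)/asboolP nz; exfalso.
have [z zP] : exists z, weak_integral (I b) (fun s => S s x) z.
  apply: (weak_integral_exists (measurable_I b) (k := fun=> M * rnorm x)).
  - exact: measurable_orbit.
  - exact: integrable_cst_I.
  - by move=> t; rewrite /= in_itv /= => /MP.
by have := nz z; rewrite asbool_neg => /asboolPn; exact.
Qed.

Lemma Rintegral_cst_I b (r : R) : 0 <= b -> Rintegral mu (I b) (fun=> r) = r * b.
Proof.
move=> b0; rewrite Rintegral_cst; last exact: measurable_I.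
congr (_ * _); rewrite /= lebesgue_measure_itv /= lte_fin.
have [_|b0'] := ltP 0 b; first by rewrite oppr0 addr0.
by apply/eqP; rewrite eq_le b0.
Qed.

Lemma orbit_int_le b M x : 0 <= b ->
  (forall t, 0 <= t <= b -> forall x, rnorm (S t x) <= M * rnorm x) ->
  rnorm (orbit_int b x) <= M * b * rnorm x.
Proof.
move=> b0 MP; rewrite mulrAC -Rintegral_cst_I//.
apply: (weak_integral_norm (measurable_I b) _ _ _ (orbit_intP b x)).
- exact: measurable_orbit.
- exact: integrable_cst_I.
- by move=> t; rewrite /= in_itv /= => /MP.
Qed.

Lemma orbit_int_linear b : linear (orbit_int b).
Proof.
move=> a x y; apply: (@weak_integral_unique _ _ (I b) _ _ _ (orbit_intP b _)) => v.
have t0 t : I b t -> 0 <= t by rewrite /= in_itv /= => /andP[].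
rewrite rdotDl.
have -> : rdot (a *: orbit_int b x) v = Rintegral mu (I b) (fun s => rdot (a *: S s x) v).
  rewrite rdotZJ orbit_intP; apply: eq_Rintegral => s _; by rewrite -rdotZJ.
rewrite (orbit_intP b y) -RintegralD//; last 2 first.
- have := integrable_orbit b x (a^*%C *: v); congr (_.-integrable _ _).
  by apply/funext => s /=; rewrite rdotZJ.
- exact: integrable_orbit.
apply: eq_Rintegral => s; rewrite inE => /t0 s0.
by rewrite (sg_lin hS s0) rdotDl.
Qed.

Lemma orbit_int_bounded b : 0 <= b -> bounded_linear (orbit_int b).
Proof.
move=> b0; split; first exact: orbit_int_linear.
have [M M0 MP] := sg_bound hS b; exists (M * b) => x.
exact: orbit_int_le.
Qed.

(** In the weak integral the adjoint of [S h] is moved onto the test vector. *)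
Lemma sg_orbit_int h b x : 0 <= h -> S h (orbit_int b x) = orbit_int b (S h x).
Proof.
move=> h0; apply: (@weak_integral_unique _ _ (I b) _ _ _ _ (orbit_intP b _)) => y.
have [G GP] := bounded_linear_adjoint (sg_bounded_linear hS h0).
have GP' u v : rdot (S h u) v = rdot u (G v) by rewrite /rdot GP.
rewrite GP' orbit_intP; apply: eq_Rintegral => s; rewrite inE /= in_itv /= => /andP[s0 _].
by rewrite -GP' -!(sgD hS)// addrC.
Qed.

Lemma Rintegral_split (f : R -> R) a b c : a <= b -> b <= c ->
  mu.-integrable (`[a, c]%classic : set MR) (EFin \o f) ->
  Rintegral mu (`[a, c]%classic : set MR) f =
  Rintegral mu (`[a, b]%classic : set MR) f + Rintegral mu (`[b, c]%classic : set MR) f.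
Proof.
move=> ab bc fi; have := @Rintegral_itvB R f (BLeft a) (BRight c) b fi.
rewrite !bnd_simp => /(_ ab bc) /eqP; rewrite subr_eq => /eqP ->.
rewrite addrC Rintegral_itv_obnd_cbnd//.
by apply: integrableS fi => //; apply: subset_itvr; rewrite bnd_simp.
Qed.

Lemma Rintegral_shift (f : R -> R) a b h :
  measurable_fun (`[a + h, b + h]%classic : set MR) f ->
  Rintegral mu (`[a, b]%classic : set MR) (fun t => f (t + h)) =
  Rintegral mu (`[a + h, b + h]%classic : set MR) f.
Proof.
move=> mf; rewrite -(@Rintegral_affine R 1 h (`[a + h, b + h]%classic : set MR))//; last by rewrite normr1.
rewrite (_ : _ @^-1` _ = `[a, b]%classic); last first.
  by apply/seteqP; split => t /=; rewrite !in_itv /= mul1r !lerD2r.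
by apply: eq_Rintegral => t _; rewrite mul1r.
Qed.

(* [S h] shifts the window [0, b] to [h, b + h]. *)
Lemma sg_orbit_int_shift h b x : 0 <= h -> 0 <= b ->
  S h (orbit_int b x) - orbit_int b x = orbit_int h (S b x - x).
Proof.
move=> h0 b0; apply: rdot_injl => y.
have Blin := @linB _ _ _ (orbit_int h) (orbit_int_linear h).
rewrite sg_orbit_int// Blin !rdotBl !orbit_intP.
set f := fun s => rdot (S s x) y.
have fi c : mu.-integrable (I c) (EFin \o f) by exact: integrable_orbit.
have fm c : measurable_fun (I c) f by exact: measurable_orbit.
have shift c d : 0 <= c -> 0 <= d -> Rintegral mu (I c) (fun s => rdot (S s (S d x)) y) =
    Rintegral mu (`[d, c + d]%classic : set MR) f.
  move=> c0 d0; have := @Rintegral_shift f 0 c d; rewrite add0r => <-.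
    by apply: eq_Rintegral => s; rewrite inE /= in_itv /= => /andP[s0 _]; rewrite /f (sgD hS).
  by apply: measurable_funS (fm (c + d)) => //; apply: subset_itvr; rewrite bnd_simp.
have hb : b <= h + b by rewrite lerDr.
have bh : h <= b + h by rewrite lerDr.
rewrite !shift//.
have := Rintegral_split h0 bh (fi (b + h)); have := Rintegral_split b0 hb (fi (h + b)).
rewrite (addrC b h) => -> /eqP; lra.
Qed.

Lemma orbit_int_deriv x : (h^-1)%:C *: orbit_int h x @[h --> 0^'+] --> x.
Proof.
apply/cvg_rnormP => e e0.
have e2 : 0 < e / 2 by rewrite divr_gt0.
have [d d0 dP] := sg_cvg0 hS x e2.
exists d => //= h; rewrite /= sub0r normrN => hd h0.
have hd' : h < d by rewrite -(gtr0_norm h0).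
rewrite (@le_lt_trans _ _ (e / 2))//; last by lra.
apply: rnorm_le_rdot; first exact: ltW.
move=> y; rewrite rdotBl rdotZl orbit_intP.
have -> : rdot x y = h^-1 * Rintegral mu (I h) (fun=> rdot x y).
  by rewrite Rintegral_cst_I ?ltW// mulrCA mulVf ?mulr1// gt_eqF.
have c0 : 0 <= e / 2 * rnorm y by rewrite mulr_ge0 ?rnorm_ge0 ?ltW.
rewrite -mulrBr -RintegralB//; last 2 first.
- exact: integrable_orbit.
- exact: integrable_cst_I.
rewrite ler_pdivrMl// mulrC -(Rintegral_cst_I _ (ltW h0)).
apply: le_Rintegral; first exact: measurable_I.
- by apply: integrable_RB; [exact: measurable_I|exact: integrable_orbit|exact: integrable_cst_I].
- exact: integrable_cst_I.
move=> s; rewrite /= in_itv /= => /andP[s0 sh].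
rewrite -rdotBl (le_trans (rdot_le _ _))// ler_wpM2r ?rnorm_ge0//.
by rewrite ltW// dP// s0 (le_lt_trans sh).
Qed.

End OrbitIntegral.

(** * The generator and its resolvent *)

Section Generator.
Context {R : realType} {H : hilbertType R} (S : R -> H -> H) (A : partialOp H H).
Hypotheses (hS : C0_semigroup S) (hA : is_generator S A).

Lemma gen_cvg x : dom A x -> (h^-1)%:C *: (S h x - x) @[h --> 0^'+] --> A x.
Proof. exact: hA.2. Qed.

Lemma gen_of_cvg x z : (h^-1)%:C *: (S h x - x) @[h --> 0^'+] --> z ->
  dom A x /\ A x = z.
Proof.
move=> hz; have dx : dom A x by apply/hA.1; exists z.
by split => //; apply: (cvg_unique (@norm_hausdorff _ _) (gen_cvg dx)).
Qed.

Lemma gen_of_cvg_near x z (f : R -> H) :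
  (forall h, 0 < h -> f h = (h^-1)%:C *: (S h x - x)) ->
  f @ 0^'+ --> z -> dom A x /\ A x = z.
Proof.
move=> fE fz; apply: gen_of_cvg; apply: cvg_trans fz; apply: near_eq_cvg.
by near=> h; rewrite fE.
Unshelve. all: by end_near. Qed.

Lemma gen_linear a x y : dom A x -> dom A y ->
  dom A (a *: x + y) /\ A (a *: x + y) = a *: A x + A y.
Proof.
move=> dx dy; apply: (gen_of_cvg_near
  (f := fun h => a *: ((h^-1)%:C *: (S h x - x)) + (h^-1)%:C *: (S h y - y))).
  move=> h h0; rewrite (sg_lin hS (ltW h0)) opprD addrACA -scalerBr [in RHS]scalerDr.
  by rewrite !scalerA mulrC.
apply: cvgD; last exact: gen_cvg.
by apply: cvgZ; [exact: cvg_cst|exact: gen_cvg].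
Qed.

Lemma gen0 : dom A 0 /\ A 0 = 0.
Proof.
apply: (gen_of_cvg_near (f := fun=> 0)); last exact: cvg_cst.
by move=> h h0; rewrite (lin0 (sg_lin hS (ltW h0))) subr0 scaler0.
Qed.

Lemma genZ a x : dom A x -> dom A (a *: x) /\ A (a *: x) = a *: A x.
Proof. by move=> /(gen_linear a) /(_ gen0.1); rewrite gen0.2 !addr0. Qed.

Lemma genB x y : dom A x -> dom A y -> dom A (x - y) /\ A (x - y) = A x - A y.
Proof.
by move=> dx dy; have := gen_linear (-1) dy dx; rewrite !scaleN1r ![- _ + _]addrC.
Qed.

Lemma gen_sg t x : 0 <= t -> dom A x -> dom A (S t x) /\ A (S t x) = S t (A x).
Proof.
move=> t0 dx; apply: (gen_of_cvg_near (f := fun h => S t ((h^-1)%:C *: (S h x - x)))).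
  move=> h h0; have lt := sg_lin hS t0.
  by rewrite (linZ lt) (linB lt) -(sgD hS x t0 (ltW h0)) -(sgD hS x (ltW h0) t0) (addrC t).
by apply: bounded_linear_cvg; [exact: sg_bounded_linear|exact: gen_cvg].
Qed.

(** By [sg_orbit_int_shift] the difference quotient of the orbit integral is the mean over [0, h] of
    the orbit of S b x - x, which tends to S b x - x. *)
Lemma gen_orbit_int b x : 0 <= b ->
  dom A (orbit_int S b x) /\ A (orbit_int S b x) = S b x - x.
Proof.
move=> b0; apply: (gen_of_cvg_near (f := fun h => (h^-1)%:C *: orbit_int S h (S b x - x))).
  by move=> h h0; rewrite -(sg_orbit_int_shift hS)// ltW.
exact: orbit_int_deriv.
Qed.

Lemma orbit_int_gen b x : 0 <= b -> dom A x -> orbit_int S b (A x) = S b x - x.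
Proof.
move=> b0 dx; have lin := orbit_int_linear hS b.
have [||_ <-] // := @gen_of_cvg_near (orbit_int S b x) (orbit_int S b (A x))
  (fun h => orbit_int S b ((h^-1)%:C *: (S h x - x))).
- by move=> h h0; rewrite (linZ lin) (linB lin) -(sg_orbit_int hS)// ltW.
- by apply: bounded_linear_cvg; [exact: orbit_int_bounded|exact: gen_cvg].
- exact: (gen_orbit_int x b0).2.
Qed.

(** The means of the orbit of x over short intervals [0, h] are in the domain and tend to x. *)
Lemma gen_dense x (e : R) : 0 < e -> exists2 z, dom A z & rnorm (z - x) < e.
Proof.
move=> e0; have /cvg_rnormP/(_ e e0) := @orbit_int_deriv _ _ _ hS x.
move=> hx; have hpos : \forall h \near 0^'+, (0 : R) < h by exact: nbhs_right_gt.
have [h [h0 hlt]] := filter_ex (filterI hpos hx).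
exists ((h^-1)%:C *: orbit_int S h x) => //.
exact: (genZ _ (gen_orbit_int x (ltW h0)).1).1.
Qed.

Lemma gen_dense_seq (x : H) : exists2 u : nat -> H, (forall n, dom A (u n)) & u @ \oo --> x.
Proof.
have /choice[u uP] : forall n : nat, exists z, dom A z /\ rnorm (z - x) < 2^-1 ^+ n.
  move=> n; have e0 : 0 < (2^-1 : R) ^+ n by rewrite exprn_gt0.
  by have [z] := gen_dense x e0; exists z.
exists u; first by move=> n; case: (uP n).
apply: (rnorm_squeeze (g := fun n => 2^-1 ^+ n)).
  by apply: nearW => n; rewrite ltW//; case: (uP n).
by apply: cvg_expr; rewrite ger0_norm// invf_lt1// ltr1n.
Qed.

Section ResolventSet.
Variable z : R[i].
Hypothesis rho_z : resolvent_set A z.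

Lemma resolventP y : dom A (resolvent A z y) /\
  z *: resolvent A z y - A (resolvent A z y) = y.
Proof.
rewrite /resolvent; case: xgetP => // nx; exfalso.
have [x [xP _]] := rho_z.1 y; exact: (nx x).
Qed.

Lemma resolvent_unique x y : dom A x -> z *: x - A x = y -> x = resolvent A z y.
Proof.
move=> dx xy; have [w [_ wu]] := rho_z.1 y.
by rewrite -(wu x)// -(wu (resolvent A z y))//; exact: resolventP.
Qed.

Lemma resolvent_linear : linear (resolvent A z).
Proof.
move=> a x y; have [dx xE] := resolventP x; have [dy yE] := resolventP y.
have [d dE] := gen_linear a dx dy.
apply/esym/resolvent_unique => //.
have -> : a *: x + y = a *: (z *: resolvent A z x - A (resolvent A z x)) +
    (z *: resolvent A z y - A (resolvent A z y)) by rewrite xE yE.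
by rewrite dE scalerDr scalerBr !scalerA (mulrC z) opprD addrACA.
Qed.

Lemma resolvent_bounded : bounded_linear (resolvent A z).
Proof.
split; first exact: resolvent_linear.
have [_ [M MP]] := rho_z; exists M => x.
by have [dx xE] := resolventP x; have := MP _ dx; rewrite xE.
Qed.

Lemma resolvent_sg t x : 0 <= t -> resolvent A z (S t x) = S t (resolvent A z x).
Proof.
move=> t0; have [dx xE] := resolventP x; have [d dE] := gen_sg t0 dx.
have lt := sg_lin hS t0.
apply/esym/resolvent_unique => //.
by rewrite dE -(linZ lt) -(linB lt) xE.
Qed.

Lemma resolvent_inj x : resolvent A z x = 0 -> x = 0.
Proof. by move=> x0; have [_ <-] := resolventP x; rewrite x0 scaler0 gen0.2 subr0. Qed.

End ResolventSet.
End Generator.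

(** * The rescaled semigroup e^(-lt) S(t) and its generator A - l *)

Section Rescaled.
Context {R : realType} {H : hilbertType R} (S : R -> H -> H) (A : partialOp H H).
Hypotheses (hS : C0_semigroup S) (hA : is_generator S A).

Definition rescaled (l : R) t x := (expR (- (l * t)))%:C *: S t x.
Definition shifted (l : R) := PartialOp (dom A) (fun x => A x - l%:C *: x).

Lemma expR_cvg0 (l : R) : expR (- (l * h)) @[h --> 0^'+] --> (1 : R).
Proof.
have : expR (- (l * h)) @[h --> (0 : R)] --> expR (- (l * 0)).
  apply: continuous_comp; last exact: continuous_expR.
  by apply: cvgN; apply: cvgM; [exact: cvg_cst|exact: cvg_id].
by rewrite mulr0 oppr0 expR0 => /cvg_at_right_filter.
Qed.

Lemma cvg_realC (f : R -> R) (l : R) {F : set_system R} {FF : Filter F} : f @ F --> l ->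
  (f t)%:C @[t --> F] --> (l%:C : R[i]^o).
Proof.
move=> fl; apply: (proj2 (@cvg_rnormP R R[i]^o _ _ _ (fun t => (f t)%:C) l%:C)) => e e0; move/cvgrPdist_lt : fl => /(_ e e0).
by apply: filterS => t; rewrite -rmorphB/= rnorm_real distrC.
Qed.

Lemma rescaled_C0 l : C0_semigroup (rescaled l).
Proof.
split.
- move=> t t0; have [linS [M MP]] := sg_bounded_linear hS t0.
  have lin : linear (rescaled l t).
    by move=> a x y; rewrite /rescaled linS scalerDr !scalerA mulrC.
  split => // x; apply: (@bounded_linear_cvg _ _ _ (rescaled l t) _ _ _ id) => //.
  split => //; exists (expR (- (l * t)) * M) => y.
  by rewrite /rescaled rnormZr gtr0_norm ?expR_gt0// -mulrA ler_wpM2l ?expR_ge0.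
- by move=> x; rewrite /rescaled mulr0 oppr0 expR0 scale1r (sg0 hS).
- move=> s t x s0 t0; rewrite /rescaled (sgD hS)// (linZ (sg_lin hS s0)) scalerA.
  by rewrite -rmorphM/= -expRD mulrDr opprD.
- move=> x; rewrite -[x in _ --> x]scale1r.
  apply: cvgZ; first by apply: cvg_realC; exact: expR_cvg0.
  by case: hS.
Qed.

(** From 1 + x <= e^x, used at x and at -x: e^x <= 1 / (1 - x), and 1 / (1 - x) - 1 - x = x^2 / (1 -
    x). *)
Lemma expR_taylor1 (x : R) : `|x| <= 2^-1 -> `|expR x - 1 - x| <= 2 * x ^+ 2.
Proof.
rewrite ler_norml => /andP[x1 x2].
have h1 := expR_ge1Dx x; have h2 := expR_ge1Dx (- x).
have h3 : expR x * expR (- x) = 1 by rewrite expRxMexpNx_1.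
have h4 := expR_gt0 x.
rewrite ger0_norm; last by lra.
have h5 := ler_wpM2l (ltW h4) h2; rewrite h3 in h5.
by nra.
Qed.

Lemma expR_deriv0 (l : R) : h^-1 * (expR (- (l * h)) - 1) @[h --> 0^'+] --> - l.
Proof.
apply/cvgrPdist_lt => e e0.
have l1 : 0 < 2 * l ^+ 2 + 2 * `|l| + 1.
  by have := sqr_ge0 l; have := normr_ge0 l; lra.
(* For h < d both 2 |l| h < 1, so that the Taylor bound applies, and 2 l^2 h < e, the size of its
   error. *)
pose d := Num.min 1 e / (2 * l ^+ 2 + 2 * `|l| + 1).
exists d; first by rewrite /= divr_gt0// lt_min ltr01.
move=> h; rewrite /= sub0r normrN => hd h0; move: hd; rewrite gtr0_norm// /d ltr_pdivlMr// lt_min => /andP[hd1 hd2].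
have lh : `|- (l * h)| <= 2^-1.
  rewrite normrN normrM (gtr0_norm h0).
  have : 0 <= l ^+ 2 * h := mulr_ge0 (sqr_ge0 l) (ltW h0).
  by move: hd1; set a := `|l|; nra.
have := expR_taylor1 lh; set E := expR _ => hE.
have -> : - l - h^-1 * (E - 1) = - (h^-1 * (E - 1 - - (l * h))) by field; rewrite gt_eqF.
rewrite normrN normrM gtr0_norm ?invr_gt0// ltr_pdivrMl// (le_lt_trans hE)//.
rewrite sqrrN exprMn [h ^+ 2]expr2 2!mulrA mulrC ltr_pM2l//.
have : 0 <= `|l| * h := mulr_ge0 (normr_ge0 l) (ltW h0).
by move: hd2; set a := `|l|; nra.
Qed.

(** The product rule for the difference quotient. That the domain does not grow is the same rule
    with the factor e^(lt), which undoes the rescaling. *)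
Lemma rescaled_gen l : is_generator (rescaled l) (shifted l).
Proof.
have key x z : (h^-1)%:C *: (S h x - x) @[h --> 0^'+] --> z ->
    (h^-1)%:C *: (rescaled l h x - x) @[h --> 0^'+] --> z - l%:C *: x.
  move=> xz.
  have : (expR (- (l * h)))%:C *: ((h^-1)%:C *: (S h x - x)) +
      (h^-1 * (expR (- (l * h)) - 1))%:C *: x @[h --> 0^'+] --> 1%:C *: z + (- l)%:C *: x.
    apply: cvgD.
      by apply: cvgZ => //; apply: cvg_realC; exact: expR_cvg0.
    apply: cvgZ; last exact: cvg_cst.
    by apply: cvg_realC; exact: expR_deriv0.
  rewrite scale1r rmorphN scaleNr; apply: cvg_trans; apply: near_eq_cvg.
  near=> h; rewrite /rescaled rmorphM rmorphB/= -scalerA scalerBl scale1r.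
  rewrite !scalerBr !scalerA [_ * (h^-1)%:C]mulrC addrA.
  by rewrite subrK.
have key' x z : (h^-1)%:C *: (rescaled l h x - x) @[h --> 0^'+] --> z ->
    (h^-1)%:C *: (S h x - x) @[h --> 0^'+] --> z + l%:C *: x.
  move=> xz.
  have : (expR (- (- l * h)))%:C *: ((h^-1)%:C *: (rescaled l h x - x)) +
      (h^-1 * (expR (- (- l * h)) - 1))%:C *: x @[h --> 0^'+] --> 1%:C *: z + (- - l)%:C *: x.
    apply: cvgD.
      by apply: cvgZ => //; apply: cvg_realC; exact: expR_cvg0.
    apply: cvgZ; last exact: cvg_cst.
    by apply: cvg_realC; exact: expR_deriv0.
  rewrite scale1r opprK; apply: cvg_trans; apply: near_eq_cvg.
  near=> h; rewrite /rescaled rmorphM rmorphB/= -scalerA scalerBl scale1r.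
  rewrite !scalerBr !scalerA [_ * (h^-1)%:C]mulrC addrA subrK.
  congr (_ *: _ - _); rewrite -mulrA -rmorphM/= -expRD mulNr opprK subrr expR0.
  by rewrite mulr1.
split => /= x; last first.
  by move=> dx; apply: key; exact: hA.2.
split => [/hA.1[z zP]|[z zP]]; first by exists (z - l%:C *: x); exact: key.
by apply/hA.1; exists (z + l%:C *: x); exact: key'.
Unshelve. all: by end_near. Qed.

End Rescaled.

(** * Finite Laplace integrals and the resolvent for large real l *)

Section Laplace.
Context {R : realType} {H : hilbertType R} (S : R -> H -> H) (A : partialOp H H).
Hypotheses (hS : C0_semigroup S) (hA : is_generator S A).
Local Notation mu := (@lebesgue_measure R).
Local Notation I b := (`[0, b]%classic : set (measurableTypeR R)).

(** The integral of e^(-ls) S(s) x over [0, b]. As an orbit integral of the rescaled semigroup it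
    inherits the facts on orbit integrals, with A - l as generator. *)
Definition laplace_int (l b : R) (x : H) : H := orbit_int (rescaled S l) b x.

Let hSl l := rescaled_C0 hS l.
Let hAl l := rescaled_gen hA l.

Lemma laplace_intE l b x y :
  rdot (laplace_int l b x) y = Rintegral mu (I b) (fun s => expR (- (l * s)) * rdot (S s x) y).
Proof.
rewrite (orbit_intP (hSl l)); apply: eq_Rintegral => s _.
by rewrite /rescaled rdotZl.
Qed.

Lemma laplace_int_linear l b : linear (laplace_int l b).
Proof. exact: orbit_int_linear. Qed.

Lemma laplace_int_dom l b x : 0 <= b -> dom A (laplace_int l b x) /\
  l%:C *: laplace_int l b x - A (laplace_int l b x) = x - (expR (- (l * b)))%:C *: S b x.
Proof.
move=> b0; have [d dE] := gen_orbit_int (hSl l) (hAl l) x b0; split => //.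
by rewrite -opprB -[A _ - _]/(shifted A l _) dE opprB.
Qed.

Lemma laplace_int_gen l b x : 0 <= b -> dom A x ->
  laplace_int l b (l%:C *: x - A x) = x - (expR (- (l * b)))%:C *: S b x.
Proof.
move=> b0 dx; have := orbit_int_gen (hSl l) (hAl l) b0 (x := x) dx.
rewrite /= -opprB -/(laplace_int l b _) (linN (laplace_int_linear l b)) => /eqP.
by rewrite eqr_oppLR opprB => /eqP.
Qed.

Lemma laplace_int_le l b M x : 0 <= l -> 0 <= b -> 0 <= M ->
  (forall t, 0 <= t <= b -> forall x, rnorm (S t x) <= M * rnorm x) ->
  rnorm (laplace_int l b x) <= M * b * rnorm x.
Proof.
move=> l0 b0 M0 MP; apply: (orbit_int_le (hSl l) x b0) => t tb y.
rewrite /rescaled rnormZr gtr0_norm ?expR_gt0//.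
rewrite (le_trans _ (MP t tb y))// ler_piMl ?rnorm_ge0// -expR0 ler_expR.
by rewrite oppr_le0 mulr_ge0//; case/andP: tb.
Qed.

(** With b = 1, l - A composed with the Laplace integral is 1 - K for K = e^(-l) S(1). Since e^l >=
    1 + l, K has norm at most 1/2 once l >= 2 M, and [neumann] inverts 1 - K; the bound 2 M does not
    depend on l. *)
Lemma resolvent_large : exists l0 : R, 0 <= l0 /\ exists c : R, forall l, l0 <= l ->
  resolvent_set A l%:C /\ forall x, rnorm (resolvent A l%:C x) <= c * rnorm x.
Proof.
have [M M0 MP] := sg_bound hS 1.
exists (2 * M); split; first by rewrite mulr_ge0.
exists (2 * M) => l lM; have l0 : 0 <= l by rewrite (le_trans _ lM)// mulr_ge0.
pose K x : H := (expR (- (l * 1)))%:C *: S 1 x.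
have linK : linear K := sg_lin (hSl l) ler01.
have KP x : rnorm (K x) <= 2^-1 * rnorm x.
  rewrite /K mulr1 rnormZr gtr0_norm ?expR_gt0//.
  have h1 : rnorm (S 1 x) <= M * rnorm x by apply: MP; rewrite lexx ler01.
  rewrite (le_trans (ler_wpM2l (expR_ge0 _) h1))// mulrA ler_wpM2r ?rnorm_ge0//.
  have h2 := expR_ge1Dx l; have h3 : expR (- l) * expR l = 1 by rewrite mulrC expRxMexpNx_1.
  by have h4 := expR_gt0 (- l); nra.
have uniq0 x : dom A x -> rnorm x <= 2 * M * rnorm (l%:C *: x - A x).
  move=> dx; have := laplace_int_gen l ler01 dx; rewrite -/(K x) => xE.
  have := laplace_int_le (l%:C *: x - A x) l0 ler01 M0 MP; rewrite xE mulr1.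
  have := rnorm_triangle x (K x) 0; rewrite !subr0; have := KP x; lra.
have rho : resolvent_set A l%:C.
  split; last by exists (2 * M).
  move=> y; have [w wE _] := neumann y linK KP.
  exists (laplace_int l 1 w); split.
    by have [d dE] := laplace_int_dom l w ler01; rewrite dE.
  move=> x [dx xy]; have [d dE] := laplace_int_dom l w ler01.
  have [dB BE] := genB hS hA d dx.
  have E0 : l%:C *: (laplace_int l 1 w - x) - A (laplace_int l 1 w - x) = 0.
    set p := laplace_int l 1 w in BE dE *.
    rewrite BE scalerBr (_ : _ - _ = l%:C *: p - A p - (l%:C *: x - A x)).
      by rewrite dE -/(K w) wE xy subrr.
    by rewrite !opprB addrACA [RHS]addrACA; congr (_ + _); exact: addrC.
  apply/eqP; rewrite -subr_eq0; apply/eqP/rnorm_eq0/eqP.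
  by rewrite eq_le rnorm_ge0 andbT (le_trans (uniq0 _ dB))// E0 rnorm0 mulr0.
split => // x; have [dx xE] := resolventP rho x.
by have := uniq0 _ dx; rewrite xE.
Qed.

(** The Laplace transform of the orbit cut at time b: its tail is again a resolvent, with the factor
    e^(-lb). Only the orbit on [0, b] is integrated. *)
Lemma resolvent_laplace l b x : 0 <= b -> resolvent_set A l%:C ->
  resolvent A l%:C x =
    laplace_int l b x + (expR (- (l * b)))%:C *: S b (resolvent A l%:C x).
Proof.
move=> b0 rho; have [dx xE] := resolventP rho x.
by have := laplace_int_gen l b0 dx; rewrite xE => ->; rewrite subrK.
Qed.

End Laplace.

(** * Abel means at 0 *)

Section AbelLimit.
Context {R : realType}.
Local Notation mu := (@lebesgue_measure R).
Local Notation MR := (measurableTypeR R).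
Local Notation I b := (`[0, b]%classic : set MR).

Lemma expRN_nat (n : nat) : expR (- n%:R : R) <= 2^-1 ^+ n.
Proof.
have h : expR (- 1 : R) <= 2^-1.
  have h1 := expR_ge1Dx (1 : R); have h2 : expR 1 * expR (- 1) = 1 :> R by rewrite expRxMexpNx_1.
  by have h3 := expR_gt0 (- 1 : R); nra.
have -> : (- n%:R : R) = n%:R * (- 1) by rewrite mulrN1.
by rewrite expRM_natl lerXn2r ?nnegrE ?expR_ge0.
Qed.

(** e^(-x) is the cube of e^(-y) with y = x / 3, and y e^(-y) <= 1. *)
Lemma expRN_cube (x : R) : 0 < x -> expR (- x) <= 27 / x ^+ 3.
Proof.
move=> x0; have x3 : 0 < x ^+ 3 by rewrite exprn_gt0.
rewrite ler_pdivlMr//.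
have -> : expR (- x) = (expR (- (x / 3))) ^+ 3.
  by rewrite -expRM_natl mulrN mulrCA divff ?mulr1// pnatr_eq0.
have h1 := expR_ge1Dx (x / 3).
have h2 : expR (x / 3) * expR (- (x / 3)) = 1 by rewrite expRxMexpNx_1.
have h3 := expR_gt0 (- (x / 3)); set E := expR (- (x / 3)) in h2 h3 *.
have h4 : E * x <= 3 by nra.
have -> : 27 = 3 ^+ 3 :> R by rewrite -natrX.
rewrite -exprMn lerXn2r// ?nnegrE// mulr_ge0// ltW//.
Qed.

(** Cubic decay of the exponential against a factor of degree 2 in l leaves order 1 / l. *)
Lemma expRN_poly_cvg0 (b c1 c2 : R) : 0 < b ->
  l * expR (- (l * b)) * (c1 + c2 * l) @[l --> +oo] --> (0 : R).
Proof.
move=> b0.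
have h (l : R) : 1 <= l -> `|l * expR (- (l * b)) * (c1 + c2 * l)| <=
    27 * (`|c1| + `|c2|) / b ^+ 3 * l^-1.
  move=> l1; have l0 : 0 < l by rewrite (lt_le_trans ltr01).
  rewrite !normrM (gtr0_norm l0) (gtr0_norm (expR_gt0 _)).
  have h1 : `|c1 + c2 * l| <= (`|c1| + `|c2|) * l.
    rewrite (le_trans (ler_normD _ _))// normrM (gtr0_norm l0) mulrDl lerD2r.
    by rewrite ler_peMr.
  have h2 := expRN_cube (mulr_gt0 l0 b0).
  have := ler_pM (mulr_ge0 (ltW l0) (expR_ge0 _)) (normr_ge0 _)
    (ler_wpM2l (ltW l0) h2) h1; move=> /le_trans; apply.
  rewrite le_eqVlt; apply/orP; left; apply/eqP; field.
  by rewrite !gt_eqF.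
have lim : 27 * (`|c1| + `|c2|) / b ^+ 3 * l^-1 @[l --> +oo] --> (0 : R).
  rewrite -(mulr0 (27 * (`|c1| + `|c2|) / b ^+ 3)); apply: cvgM; first exact: cvg_cst.
  by apply/gtr0_cvgV0; [exact: nbhs_pinfty_gt|exact: cvg_id].
apply: norm_cvg0.
apply: (@squeeze_cvgr _ _ _ _ (cst 0) (fun l => 27 * (`|c1| + `|c2|) / b ^+ 3 * l^-1)) => //.
  near=> l; rewrite normr_ge0/= h//; near: l; exact: nbhs_pinfty_ge.
exact: cvg_cst.
Unshelve. all: by end_near. Qed.

Section Abel.
Variables (b : R) (phi : R -> R).
Hypotheses (b0 : 0 < b) (phi0 : forall s, 0 <= phi s).
Hypothesis iphi : mu.-integrable (I b) (EFin \o phi).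

Let k l s := l * expR (- (l * s)) * phi s.

Lemma expR_measurable l (D : set MR) : measurable_fun D (fun s => expR (- (l * s))).
Proof.
apply: (@measurable_funS _ _ _ _ setT) => //.
apply: continuous_measurable_fun => s.
apply: continuous_comp; last exact: continuous_expR.
by apply: cvgN; apply: cvgM; [exact: cvg_cst|exact: cvg_id].
Qed.

Lemma integrable_laplace l : 0 <= l -> mu.-integrable (I b) (EFin \o k l).
Proof.
move=> l0; apply: (@le_integrable _ _ _ mu (I b) (measurable_I b) _ (EFin \o (fun s => l * phi s))).
- apply/measurable_EFinP; apply: measurable_funM.
    by apply: measurable_funM; [exact: measurable_cst|exact: expR_measurable].
  by case/integrableP : iphi => /measurable_EFinP.
- move=> s; rewrite /= in_itv /= => /andP[s0 _].
  rewrite lee_fin /k !ger0_norm ?mulr_ge0 ?expR_ge0// ler_wpM2r//.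
  by rewrite ler_piMr// -expR0 ler_expR oppr_le0 mulr_ge0.
- by apply: integrable_RZ => //; exact: measurable_I.
Qed.

(** On [k / l, (k + 1) / l] the factor e^(-ls) is at most 2^-k, and phi has integral at most e (k +
    1) / l up to (k + 1) / l. The sum of (k + 1) 2^-k over k < n is 4 - (2 n + 4) 2^-n. *)
Lemma laplace_dyadic (e d l : R) : 0 < l -> d <= b ->
  (forall h, 0 < h <= d -> Rintegral mu (I h) phi <= e * h) ->
  forall n : nat, n%:R / l <= d ->
  Rintegral mu (I (n%:R / l)) (k l) <= e * (4 - (2 * n%:R + 4) * 2^-1 ^+ n).
Proof.
move=> l0 db hd; elim=> [|n IH] nd.
  rewrite mul0r set_itv1 Rintegral_set1 expr0 mulr0 add0r mulr1 subrr mulr0.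
  by [].
have nn : n%:R / l <= n.+1%:R / l by rewrite ler_pM2r ?invr_gt0// ler_nat.
have sub c : c <= b -> mu.-integrable (I c) (EFin \o k l).
  move=> cb; apply: integrableS (integrable_laplace (ltW l0)) => //.
  by apply: subset_itvl; rewrite bnd_simp.
have nb : n.+1%:R / l <= b := le_trans nd db.
have n0 : 0 <= n%:R / l by rewrite divr_ge0// ltW.
rewrite (Rintegral_split n0 nn (sub _ nb)).
have h1 := IH (le_trans nn nd).
have n1 : 0 < n.+1%:R / l by rewrite divr_gt0.
have h2 := hd (n.+1%:R / l); rewrite n1 nd in h2; have {}h2 := h2 isT.
have subI : (`[n%:R / l, n.+1%:R / l]%classic : set MR) `<=` I (n.+1%:R / l).
  by apply: subset_itvr; rewrite bnd_simp.
have iphi1 : mu.-integrable (I (n.+1%:R / l)) (EFin \o phi).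
  by apply: integrableS iphi => //; apply: subset_itvl; rewrite bnd_simp.
have iphi2 : mu.-integrable (`[n%:R / l, n.+1%:R / l]%classic : set MR) (EFin \o phi).
  exact: integrableS iphi1.
have h3 : Rintegral mu (`[n%:R / l, n.+1%:R / l]%classic : set MR) (k l) <=
    l * 2^-1 ^+ n * Rintegral mu (I (n.+1%:R / l)) phi.
  apply: (@le_trans _ _ (l * 2^-1 ^+ n *
      Rintegral mu (`[n%:R / l, n.+1%:R / l]%classic : set MR) phi)).
    rewrite -RintegralZl//; apply: le_Rintegral => //.
    - exact: integrableS (sub _ nb).
    - exact: integrable_RZ.
    move=> s; rewrite /= in_itv /= => /andP[s1 _]; rewrite /k ler_wpM2r// ler_wpM2l ?(ltW l0)//.
    rewrite (le_trans _ (expRN_nat n))// ler_expR lerN2.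
    by rewrite -ler_pdivrMl// mulrC.
  rewrite ler_wpM2l//; first by rewrite mulr_ge0 ?exprn_ge0// ltW.
  rewrite (Rintegral_split n0 nn iphi1) lerDr.
  exact: Rintegral_ge0.
have h4 : l * 2^-1 ^+ n * Rintegral mu (I (n.+1%:R / l)) phi <= e * (n.+1%:R * 2^-1 ^+ n).
  rewrite (le_trans (ler_wpM2l _ h2))//; first by rewrite mulr_ge0 ?exprn_ge0// ltW.
  rewrite le_eqVlt; apply/orP; left; apply/eqP.
  by set p := (_ : R) ^+ n; field; rewrite gt_eqF.
rewrite (le_trans (lerD h1 (le_trans h3 h4)))//.
rewrite le_eqVlt; apply/orP; left; apply/eqP.
by rewrite [2^-1 ^+ n.+1]exprS -natr1; set p := (_ : R) ^+ n; field.
Qed.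

(** Near 0 the mean is controlled by the small averages of phi through [laplace_dyadic]; away from 0
    the exponential makes the kernel uniformly small. *)
Lemma abel_laplace_cvg0 :
  (forall e, 0 < e -> exists2 d, 0 < d & forall h, 0 < h <= d -> Rintegral mu (I h) phi <= e * h) ->
  Rintegral mu (I b) (k l) @[l --> +oo] --> (0 : R).
Proof.
move=> hphi; apply/cvgrPdist_lt => e e0.
(* [laplace_dyadic] costs a factor 4, so e / 8 yields e / 2. *)
have e8 : 0 < e / 8 by rewrite divr_gt0.
have [d' d'0 hd'] := hphi _ e8.
pose d := Num.min d' b.
have d0 : 0 < d by rewrite lt_min d'0.
have db : d <= b by rewrite ge_min lexx orbT.
have hd h : 0 < h <= d -> Rintegral mu (I h) phi <= e / 8 * h.
  by move=> /andP[h0 hd]; apply: hd'; rewrite h0 (le_trans hd)// ge_min lexx.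
have J0 : 0 <= Rintegral mu (I b) phi by exact: Rintegral_ge0.
(* The factor e^1 pays for rounding l d down to an integer n; the term 0 * l fits the form of
   [expRN_poly_cvg0]. *)
have tail : l * expR (- (l * d)) * (expR 1 * Rintegral mu (I b) phi + 0 * l) @[l --> +oo] --> (0 : R).
  exact: expRN_poly_cvg0.
have e2 : 0 < e / 2 by rewrite divr_gt0.
have tail' := (cvgrPdist_lt _ _).1 tail _ e2.
near=> l.
have l0 : 0 < l by near: l; exact: nbhs_pinfty_gt.
have tl : `|0 - l * expR (- (l * d)) * (expR 1 * Rintegral mu (I b) phi + 0 * l)| < e / 2.
  by near: l; exact: tail'.
pose n := Num.truncn (l * d).
have ld0 : 0 <= l * d by rewrite mulr_ge0// ltW.
have nl : n%:R <= l * d by rewrite truncn_le.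
have nl' : l * d < n.+1%:R by rewrite truncnS_gt.
have nd : n%:R / l <= d by rewrite ler_pdivrMr// mulrC.
have nb : n%:R / l <= b := le_trans nd db.
have n0 : 0 <= n%:R / l by rewrite divr_ge0// ltW.
have kl0 s : 0 <= k l s by rewrite /k !mulr_ge0 ?expR_ge0// ltW.
rewrite sub0r normrN ger0_norm; last by apply: Rintegral_ge0 => s _; exact: kl0.
rewrite (Rintegral_split n0 nb (integrable_laplace (ltW l0))).
have h1 := laplace_dyadic l0 db hd nd.
have h1' : Rintegral mu (I (n%:R / l)) (k l) <= e / 2.
  rewrite (le_trans h1)//.
  have : 0 <= (2 * n%:R + 4) * (2^-1 : R) ^+ n by rewrite mulr_ge0 ?exprn_ge0// addr_ge0// mulr_ge0.
  by nra.
have iphi2 : mu.-integrable (`[n%:R / l, b]%classic : set MR) (EFin \o phi).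
  by apply: integrableS iphi => //; apply: subset_itvr; rewrite bnd_simp.
have h3 : Rintegral mu (`[n%:R / l, b]%classic : set MR) (k l) <=
    l * expR (- (l * d)) * (expR 1 * Rintegral mu (I b) phi).
  apply: (@le_trans _ _ (l * expR (- (l * d)) * expR 1 *
      Rintegral mu (`[n%:R / l, b]%classic : set MR) phi)).
    rewrite -RintegralZl//; apply: le_Rintegral => //.
    - apply: integrableS (integrable_laplace (ltW l0)) => //.
      by apply: subset_itvr; rewrite bnd_simp.
    - exact: integrable_RZ.
    move=> s; rewrite /= in_itv /= => /andP[s1 _]; rewrite /k ler_wpM2r// -mulrA ler_wpM2l ?(ltW l0)//.
    rewrite -expRD ler_expR -lerBlDl opprK.
    move: s1; rewrite ler_pdivrMr// => s1.
    by move: nl'; rewrite -natr1; lra.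
  rewrite [leRHS]mulrA ler_wpM2l//; first by rewrite !mulr_ge0 ?expR_ge0// ltW.
  rewrite (Rintegral_split n0 nb iphi) lerDr.
  exact: Rintegral_ge0.
move: tl; rewrite sub0r normrN mul0r addr0 => /(le_lt_trans (ler_norm _)) tl.
by rewrite [ltRHS](splitr e) ler_ltD// (le_lt_trans h3).
Unshelve. all: by end_near. Qed.

End Abel.
End AbelLimit.

(** * Almost-everywhere statements *)

Section AlmostEverywhere.
Context {R : realType}.
Local Notation mu := (@lebesgue_measure R).

Lemma ae_imp (P Q : R -> Prop) : (forall t, P t -> Q t) ->
  {ae mu, forall t, P t} -> {ae mu, forall t, Q t}.
Proof.
by move=> PQ; apply: negligibleS => t /= nQ Pt; apply: nQ; exact: PQ.
Qed.

Lemma ae_imp2 (P Q S : R -> Prop) : (forall t, P t -> Q t -> S t) ->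
  {ae mu, forall t, P t} -> {ae mu, forall t, Q t} -> {ae mu, forall t, S t}.
Proof.
move=> PQ hP hQ; apply: negligibleS (negligibleU hP hQ) => t /= nS.
by apply: contrapT => /not_orP[/contrapT Pt /contrapT Qt]; apply: nS; exact: PQ.
Qed.

Lemma ae_neq (c : R) : {ae mu, forall t, t != c}.
Proof.
exists [set c]; split; [exact: measurable_set1|exact: lebesgue_measure_set1|].
by move=> t /= /negP; rewrite negbK => /eqP.
Qed.

End AlmostEverywhere.

(** * Null sets and Lebesgue points in L2 *)

Section LebesguePoints.
Context {R : realType} (T : R) (Y : hilbertType R).
Hypothesis sepY : separable Y.
Local Notation mu := (@lebesgue_measure R).
Local Notation MR := (measurableTypeR R).
Local Notation I b := (`[0, b]%classic : set MR).
Local Notation dom := (sip_dom (L2 T Y)).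
Local Notation N f := (@sip_norm R (L2 T Y) f).

Lemma L2_dom_bounded (f : R -> Y) (M : R) : strongly_measurable T f ->
  (forall t, t \in `[0, T] -> rnorm (f t) <= M) -> dom f.
Proof.
move=> mf fM; split => //.
have iM := integrable_cst_I T (M ^+ 2).
apply: le_lt_trans (integrable_lty (measurable_I T) iM).
apply: ge0_le_integral => //.
- by move=> t _; rewrite lee_fin sqr_ge0.
- by apply/measurable_EFinP; exact: measurable_sqnorm.
- by case/integrableP : iM.
- move=> t It; rewrite /= lee_fin lerXn2r ?nnegrE ?rnorm_ge0 ?fM//.
  by rewrite (le_trans _ (fM t It))// rnorm_ge0.
Qed.

Lemma L2_norm_eq0 (f g : R -> Y) : dom f -> dom g ->
  N (f - g) = 0 <-> {ae mu, forall t, t \in `[0, T] -> f t = g t}.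
Proof.
move=> df dg; have hL := hs_L2 T sepY.
have dfg : dom (f - g) by exact: (hs_domB hL).
pose sq t := rnorm ((f - g) t) ^+ 2; pose n2 := N (f - g) ^+ 2.
have msq : measurable_fun (I T) (EFin \o sq).
  by apply/measurable_EFinP; exact: (@measurable_sqnorm _ _ _ (f - g) dfg.1).
have intE : (\int[mu]_(t in I T) `|(EFin \o sq) t| = n2%:E)%E.
  rewrite (L2_sqnormE dfg); apply: eq_integral => t _ /=.
  by rewrite ger0_norm// sqr_ge0.
have ae0 := ae_eq_integral_abs mu (measurable_I T) msq; rewrite intE in ae0.
split => [N0|h].
  have : ae_eq mu (I T) (EFin \o sq) (cst 0) by apply/ae0; rewrite /n2 N0 expr0n.
  apply: ae_imp => t h It; have [/eqP] := h It.
  by rewrite sqrf_eq0 => /eqP/rnorm_eq0/eqP; rewrite subr_eq0 => /eqP.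
have : (n2%:E = 0)%E.
  apply/ae0; apply: ae_imp h => t h It /=.
  by rewrite /sq -[(f - g) t]/(f t - g t) h// subrr rnorm0 expr0n.
by move=> [/eqP]; rewrite sqrf_eq0 => /eqP.
Qed.

Lemma sip_rdot_eq_of_norm0 (V : sipSpace R) (hV : hilbert_sip V) (u v w : V) :
  sip_dom V u -> sip_dom V v -> sip_dom V w -> sip_norm (u - v) = 0 ->
  sip_rdot u w = sip_rdot v w.
Proof.
move=> du dv dw uv; apply/eqP; rewrite -subr_eq0 -(sip_rdotBl hV)//.
rewrite -normr_le0 (le_trans (sip_CS hV _ _))//; first exact: hs_domB.
by rewrite uv mul0r.
Qed.

Lemma integrable_rnormB (f : R -> Y) d : dom f ->
  mu.-integrable (I T) (EFin \o (fun t => rnorm (f t - d))).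
Proof.
move=> df.
have i1 : mu.-integrable (I T) (EFin \o (fun t => (1 + rnorm d) + rnorm (f t) ^+ 2)).
  apply: integrable_RD; [exact: measurable_I|exact: integrable_cst_I|].
  exact: integrable_sqnorm.
apply: le_integrable i1; first exact: measurable_I.
  by apply/measurable_EFinP; apply: measurable_rnormB; case: df.
move=> t _; rewrite lee_fin !ger0_norm ?rnorm_ge0 ?addr_ge0 ?sqr_ge0 ?rnorm_ge0//.
rewrite (le_trans (rnormB _ _))//.
by have := sqr_ge0 (rnorm (f t) - 1); have := rnorm_ge0 (f t); nra.
Qed.

(** Apply scalar Lebesgue differentiation to |f - q_n| for all points q_n of a dense sequence at
    once. At t choose q_n close to f t and use |f r - f t| <= | |f r - q_n| - |f t - q_n| | + 2 |f t
    - q_n|. *)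
Lemma lebesgue_point_L2 (f : R -> Y) : dom f ->
  {ae mu, forall t, 0 < t < T -> forall e, 0 < e -> exists2 d, 0 < d &
     forall h, 0 < h <= d -> t + h <= T /\
       Rintegral mu (I h) (fun s => rnorm (f (s + t) - f t)) <= e * h}.
Proof.
move=> df; have [q qdense] := separable_seq sepY.
pose phi n := (fun r => rnorm (f r - q n)) \_ (I T).
have lint n : locally_integrable [set: R] (phi n).
  apply: integrable_locally_restrict; first exact: measurable_I.
  exact: integrable_rnormB.
have := ae_foralln (fun n => lebesgue_differentiation (lint n)).
apply: ae_imp => t tleb /andP[t0 tT] e e0.
(* The ball of radius 2 h has measure 4 h, so an average below e / 8 means an integral below e / 2 *
   h; and 2 |f t - q n| < e / 4. *)
have e8 : 0 < e / 8 by rewrite divr_gt0.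
have [n nt] := qdense (f t) _ e8.
have := tleb n; rewrite /lebesgue_pt.
move=> /fine_cvgP[fin_near /cvgrPdist_lt/(_ _ e8) lt_near].
have [d1 d10 d1P] := filterI fin_near lt_near.
have tT' : 0 < T - t by rewrite subr_gt0.
(* d1 / 4 keeps the radius 2 h below d1, and T - t keeps [t, t + h] inside [0, T]. The doubled
   radius lets the open ball contain this closed interval. *)
exists (Num.min (d1 / 4) (T - t)); first by rewrite lt_min tT' divr_gt0.
move=> h /andP[h0]; rewrite le_min => /andP[hd1 hT].
have thT : t + h <= T by rewrite -lerBrDl.
split => //.
have h2 : 0 < 2 * h by rewrite mulr_gt0.
have [/= fin2 lt2] : davg (phi n) t (2 * h) \is a fin_num /\
   `|0 - (fine \o davg (phi n) t) (2 * h)| < e / 8.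
  apply: d1P => //=; rewrite sub0r normrN gtr0_norm//.
  have : 0 < d1 by [].
  by move: hd1; lra.
have phiE r : 0 <= r <= T -> phi n r = rnorm (f r - q n).
  by move=> rT; rewrite /phi patchE mem_set//= in_itv.
pose g y := `|phi n y - phi n t|.
have mphi : measurable_fun setT (phi n) by case: (lint n).
have mg D : measurable_fun D (EFin \o g).
  apply: (@measurable_funS _ _ _ _ setT) => //.
  by apply/measurable_EFinP; apply: measurableT_comp => //; exact: measurable_funB.
pose B : set MR := ball t (2 * h).
have gball : (\int[mu]_(y in B) (g y)%:E < (e / 2 * h)%:E)%E.
  move: lt2; rewrite sub0r normrN ger0_norm; last by rewrite fine_ge0// davg_ge0.
  rewrite -lte_fin fineK// /davg /iavg lebesgue_measure_ball ?ltW//.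
  have -> : (2 * h *+ 2) = 4 * h by ring.
  rewrite inver gt_eqF ?mulr_gt0// lte_pdivrMl ?mulr_gt0// -EFinM.
  by have -> : 4 * h * (e / 8) = e / 2 * h by field.
have sub : (`[t, t + h]%classic : set MR) `<=` ball t (2 * h).
  move=> r; rewrite /= in_itv /= => /andP[r1 r2].
  by rewrite -ball_normE /= ltr_norml; apply/andP; split; lra.
have mJ : measurable (`[t, t + h]%classic : set MR) by exact: measurable_itv.
have gJ : (\int[mu]_(y in (`[t, (t + h)%R]%classic : set MR)) (g y)%:E <= (e / 2 * h)%:E)%E.
  apply: le_trans (ltW gball); apply: ge0_subset_integral => //.
    exact: measurable_ball.
  by move=> y _; rewrite lee_fin /g.
have igJ : mu.-integrable (`[t, t + h]%classic : set MR) (EFin \o g).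
  apply/integrableP; split => //.
  apply: le_lt_trans (_ : (e / 2 * h)%:E < +oo)%E; last exact: ltry.
  apply: le_trans gJ; apply: ge0_le_integral => //.
    by apply: measurableT_comp => //; exact: mg.
  by move=> y _ /=; rewrite /g normr_id.
have icst (r : R) : mu.-integrable (`[t, t + h]%classic : set MR) (EFin \o (fun=> r)).
  have := integrable_cst_I T r; apply: integrableS => //.
  by move=> s; rewrite /= !in_itv /= => /andP[s1 s2]; rewrite (le_trans (ltW t0) s1) (le_trans s2 thT).
have iF : mu.-integrable (`[t, t + h]%classic : set MR) (EFin \o (fun r => rnorm (f r - f t))).
  have := integrable_rnormB (f t) df; apply: integrableS => //.
  by move=> s; rewrite /= !in_itv /= => /andP[s1 s2]; rewrite (le_trans (ltW t0) s1) (le_trans s2 thT).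
have -> : Rintegral mu (I h) (fun s => rnorm (f (s + t) - f t)) =
    Rintegral mu (`[t, t + h]%classic : set MR) (fun r => rnorm (f r - f t)).
  have := @Rintegral_shift R (fun r => rnorm (f r - f t)) 0 h t.
  rewrite add0r addrC => -> //.
  by case/integrableP : iF => /measurable_EFinP.
apply: (@le_trans _ _ (Rintegral mu (`[t, t + h]%classic : set MR) (fun r => g r + e / 2))).
  apply: le_Rintegral => //; first exact: integrable_RD.
  move=> r; rewrite /= in_itv /= => /andP[r1 r2].
  have rT : 0 <= r <= T by apply/andP; split; lra.
  have tT2 : 0 <= t <= T by apply/andP; split; lra.
  rewrite /g !phiE//.
  have := rnorm_triangle (f r) (q n) (f t).
  have := ler_norm (rnorm (f r - q n) - rnorm (f t - q n)).
  rewrite (rnormC (f t) (q n)).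
  by move: nt; lra.
rewrite RintegralD// Rintegral_cst//= lebesgue_measure_itv /= lte_fin ltrDl h0 -EFinD/=.
have : Rintegral mu (`[t, t + h]%classic : set MR) g <= e / 2 * h.
  rewrite -lee_fin /Rintegral fineK//; exact: integrable_fin_num.
have -> : t + h - t = h by rewrite addrC addKr.
lra.
Qed.

End LebesguePoints.

(** * Observation operators along orbits and output maps *)

Section Observation.
Context {R : realType} {H Y : hilbertType R} (S : R -> H -> H) (A : partialOp H H).
Hypotheses (sepY : separable Y) (hS : C0_semigroup S) (hA : is_generator S A).
Variables (beta : R[i]) (C : H -> Y).
Hypotheses (rho : resolvent_set A beta) (bddC : bounded_on_H1 A beta C).
Local Notation mu := (@lebesgue_measure R).
Local Notation MR := (measurableTypeR R).
Local Notation I b := (`[0, b]%classic : set MR).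

(** C is bounded only for the graph norm; composed with the resolvent it is bounded on H, and C is
    estimated below through this composition. *)
Lemma obs_resolvent_bounded : bounded_linear (fun w => C (resolvent A beta w)).
Proof.
have [linC [M MP]] := bddC; have linR := resolvent_linear hS hA rho.
split => [a x y|].
  by rewrite linR linC//; case: (resolventP rho x) => //; case: (resolventP rho y).
by exists M => x; have [dx xE] := resolventP rho x; have := MP _ dx; rewrite xE.
Qed.

Lemma obs_resolventE z : dom A z -> C z = C (resolvent A beta (beta *: z - A z)).
Proof. by move=> dz; congr C; exact: (resolvent_unique rho dz). Qed.

Lemma obs_orbitE t x : 0 <= t -> dom A x ->
  C (S t x) = C (resolvent A beta (S t (beta *: x - A x))).
Proof.
move=> t0 dx; have [d dE] := gen_sg hS hA t0 dx; rewrite obs_resolventE// dE.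
by rewrite (linB (sg_lin hS t0)) (linZ (sg_lin hS t0)).
Qed.

Lemma obs_orbit_measurable b x : dom A x -> strongly_measurable b (fun t => C (S t x)).
Proof.
move=> dx; apply: strongly_measurableP_cont => //.
apply/subspace_continuousP => t It.
have t0 : 0 <= t by move: It; rewrite /= in_itv /= => /andP[].
have h : (C (resolvent A beta (S s (beta *: x - A x))) @[s --> within (I b) (nbhs t)]) -->
    C (resolvent A beta (S t (beta *: x - A x))).
  apply: (bounded_linear_cvg obs_resolvent_bounded).
  by move/subspace_continuousP : (@sg_orbit_within _ _ _ hS b (beta *: x - A x)) => /(_ t It).
rewrite -(obs_orbitE t0 dx) in h.
apply: cvg_trans h; apply: near_eq_cvg.
rewrite near_withinE; apply: nearW => s; rewrite /= in_itv /= => /andP[s0 _].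
first [exact: (obs_orbitE s0 dx)|exact/esym/(obs_orbitE s0 dx)].
Qed.

Lemma obs_orbit_dom b x : dom A x -> sip_dom (L2 b Y) (fun t => C (S t x)).
Proof.
move=> dx; have [M M0 MP] := sg_bound hS b.
have [_ [K KP]] := obs_resolvent_bounded.
apply: (L2_dom_bounded (M := Num.max K 0 * (M * rnorm (beta *: x - A x)))).
  exact: obs_orbit_measurable.
move=> t; rewrite in_itv /= => /andP[t0 tb]; rewrite (obs_orbitE t0 dx).
rewrite (le_trans (KP _))//.
apply: (@le_trans _ _ (Num.max K 0 * rnorm (S t (beta *: x - A x)))).
  by rewrite ler_wpM2r ?rnorm_ge0// le_max lexx.
by rewrite ler_wpM2l ?le_max ?lexx ?orbT// MP// t0.
Qed.

(** The Laplace integral L of z is in the domain of A, and (beta - A) L = (beta - l) L + z - e^(-lb)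
    S(b) z is bounded in z. *)
Lemma obs_laplace_bounded l b : 0 <= b -> bounded_linear (fun z => C (laplace_int S l b z)).
Proof.
move=> b0; have [linC _] := bddC; have linL := laplace_int_linear hS l b.
split => [a x y|].
  by rewrite linL linC//; exact: (proj1 (laplace_int_dom hS hA l _ b0)).
have [linCR [M MP]] := obs_resolvent_bounded.
have [_ [K KP]] := orbit_int_bounded (rescaled_C0 hS l) b0.
have [_ [M' MP']] := sg_bounded_linear hS b0.
pose a : R := rnorm (beta - l%:C : R[i]^o).
exists (Num.max M 0 * (a * K + 1 + expR (- (l * b)) * M')) => z.
have [d dE] := laplace_int_dom hS hA l z b0.
rewrite obs_resolventE//.
set L := laplace_int S l b z in d dE *.
have -> : beta *: L - A L = (beta - l%:C) *: L + (z - (expR (- (l * b)))%:C *: S b z).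
  by rewrite -dE scalerBl addrA subrK.
rewrite (le_trans (MP _))// -mulrA.
apply: (@le_trans _ _ (Num.max M 0 * rnorm ((beta - l%:C) *: L + (z - (expR (- (l * b)))%:C *: S b z)))).
  by rewrite ler_wpM2r ?rnorm_ge0// le_max lexx.
rewrite ler_wpM2l ?le_max ?lexx ?orbT//.
rewrite (le_trans (rnormD _ _))// 2!mulrDl mul1r -addrA lerD//.
  by rewrite rnormZ -/a -mulrA ler_wpM2l ?rnorm_ge0//; exact: KP.
rewrite (le_trans (rnormB _ _))// lerD// rnormZr gtr0_norm ?expR_gt0// -mulrA.
by rewrite ler_wpM2l ?expR_ge0.
Qed.

(** For x in the domain of A, beta - A commutes with the Laplace integral, so the bounded operator C
    R(beta, A) is what has to pass under the integral; its adjoint does this. *)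
Lemma obs_laplaceE l b x y : 0 <= b -> dom A x ->
  rdot (C (laplace_int S l b x)) y =
  Rintegral mu (I b) (fun s => expR (- (l * s)) * rdot (C (S s x)) y).
Proof.
move=> b0 dx; have [G GP] := bounded_linear_adjoint obs_resolvent_bounded.
have GP' w : rdot (C (resolvent A beta w)) y = rdot w (G y) by rewrite /rdot GP.
have [d dE] := laplace_int_dom hS hA l x b0.
have linL := laplace_int_linear hS l b.
rewrite obs_resolventE// GP'.
have -> : beta *: laplace_int S l b x - A (laplace_int S l b x) =
    laplace_int S l b (beta *: x - A x).
  have h : A (laplace_int S l b x) = laplace_int S l b (A x).
    have := laplace_int_gen hS hA l b0 dx; rewrite -dE (linB linL) (linZ linL).
    by move=> /addrI/oppr_inj.
  by rewrite (linB linL) (linZ linL) h.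
rewrite laplace_intE//; apply: eq_Rintegral => s; rewrite inE /= in_itv /= => /andP[s0 _].
by rewrite -GP' -obs_orbitE.
Qed.

Lemma additive_zero_of_dense (F : H -> R) (D : set H) (K : R) :
  (forall u v, F (u - v) = F u - F v) -> (forall u, `|F u| <= K * rnorm u) ->
  (forall x : H, exists2 u : nat -> H, (forall n, D (u n)) & u @ \oo --> x) ->
  (forall u, D u -> F u = 0) -> forall x, F x = 0.
Proof.
move=> FB FK Dd FD x; have [u Du ux] := Dd x.
apply/eqP; rewrite -normr_le0.
have h : K * rnorm (u n - x) @[n --> \oo] --> (0 : R).
  by rewrite -(mulr0 K); apply: cvgM; [exact: cvg_cst|exact/cvg_rnorm0P].
apply: (cvgr_to_ge h); apply: nearW => n.
by have := FK (u n - x); rewrite FB FD// sub0r normrN.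
Qed.

Section OutputMap.
Variables (T : R) (Psi : H -> R -> Y).
Hypothesis bddPsi : bounded_operator (V := sip_of H) (W := L2 T Y) Psi.
Hypothesis aePsi : forall x, dom A x ->
  {ae mu, forall t, t \in `[0, T] -> Psi x t = C (S t x)}.
Local Notation dom2 := (sip_dom (L2 T Y)).
Let hL := hs_L2 T sepY.

(** The element of L2 whose pairing with F is the Laplace integral, at l, of F started at time t, in
    the direction y. *)
Definition laplace_test (l t : R) (y : Y) (r : R) : Y :=
  if `[< (`[t, +oo[%classic : set MR) r >] then (expR (- (l * (r - t))))%:C *: y else 0.

Lemma laplace_test_dom l t y : 0 <= l -> dom2 (laplace_test l t y).
Proof.
move=> l0; apply: (L2_dom_bounded (M := rnorm y)).
  apply: strongly_measurable_if; first exact: measurable_itv.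
    apply: strongly_measurableP_cont => //; apply: continuous_subspaceT => r.
    apply: cvgZ; last exact: cvg_cst.
    apply: cvg_realC; apply: continuous_comp; last exact: continuous_expR.
    apply: cvgN; apply: cvgM; first exact: cvg_cst.
    by apply: cvgB; [exact: cvg_id|exact: cvg_cst].
  exact: strongly_measurable_cst.
move=> r _; rewrite /laplace_test; case: asboolP => [|_]; last by rewrite rnorm0 rnorm_ge0.
rewrite /= in_itv /= andbT => tr.
rewrite rnormZr gtr0_norm ?expR_gt0// ler_piMl ?rnorm_ge0// -expR0 ler_expR.
by rewrite oppr_le0 mulr_ge0// subr_ge0.
Qed.

Lemma laplace_testE l t y (F : R -> Y) : 0 <= l -> 0 <= t <= T -> dom2 F ->
  sip_rdot (F : L2 T Y) (laplace_test l t y) =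
  Rintegral mu (I (T - t)) (fun s => expR (- (l * s)) * rdot (F (s + t)) y).
Proof.
move=> l0 /andP[t0 tT] dF; rewrite L2_rdotE.
have iF := integrable_rdot dF (laplace_test_dom t y l0).
set g := fun r => rdot (F r) (laplace_test l t y r) in iF *.
have z0 : Rintegral mu (`[0, t]%classic : set MR) g = 0.
  rewrite -Rintegral_itv_bndo_bndc; last first.
    apply: integrableS iF => //.
    by apply: subset_itvl; rewrite bnd_simp.
  rewrite -[RHS](Rintegral_set0 mu g) Rintegral_set0.
  rewrite /Rintegral integral0_eq// => r; rewrite /= in_itv /= => /andP[r0 rt].
  rewrite /g /laplace_test; case: asboolP => [|_]; last by rewrite rdot0r.
  by rewrite /= in_itv /= andbT leNgt rt.
rewrite (Rintegral_split t0 tT iF) z0 add0r.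
pose k r := expR (- (l * (r - t))) * rdot (F r) y.
transitivity (Rintegral mu (`[t, T]%classic : set MR) k).
  apply: eq_Rintegral => r; rewrite inE /= in_itv /= => /andP[tr _].
  rewrite /g /laplace_test asboolT; last by rewrite /= in_itv /= tr.
  by rewrite rdotZr.
have mk : measurable_fun (`[t, T]%classic : set MR) k.
  apply: measurable_funM.
    apply: (@measurable_funS _ _ _ _ setT) => //.
    apply: continuous_measurable_fun => s.
    apply: continuous_comp; last exact: continuous_expR.
    apply: cvgN; apply: cvgM; first exact: cvg_cst.
    by apply: cvgB; [exact: cvg_id|exact: cvg_cst].
  apply: (@measurable_funS _ _ _ _ (I T)) => //; first by apply: subset_itvr; rewrite bnd_simp.
  exact: (measurable_rdot dF.1 (strongly_measurable_cst T y)).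
have := @Rintegral_shift R k 0 (T - t) t; rewrite add0r subrK => /(_ mk) <-.
by apply: eq_Rintegral => s _; rewrite /k addrK.
Qed.

(** Both sides are bounded and additive in x and agree on the domain of A by [obs_laplaceE]; the
    domain is dense. This extends [obs_laplaceE] to all x, with [Psi x] in place of the output of
    C. *)
Lemma output_rdotE l t x y : 0 <= l -> 0 <= t <= T ->
  rdot (C (laplace_int S l (T - t) (S t x))) y =
  sip_rdot (Psi x : L2 T Y) (laplace_test l t y).
Proof.
move=> l0 tT; have [t0 tT'] := andP tT.
have b0 : 0 <= T - t by rewrite subr_ge0.
have [dPsi linPsi [K KP]] := bddPsi.
have dg := laplace_test_dom t y l0; set g := laplace_test l t y in dg *.
have dP x' : dom2 (Psi x') by exact: dPsi.
have [linG [K1 K1P]] := obs_laplace_bounded l b0.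
have linS := sg_lin hS t0.
have [_ [K2 K2P]] := sg_bounded_linear hS t0.
apply/eqP; rewrite -subr_eq0; apply/eqP; move: x.
pose F x := rdot (C (laplace_int S l (T - t) (S t x))) y - sip_rdot (Psi x : L2 T Y) g.
rewrite -/(forall x, F x = 0).
apply: (@additive_zero_of_dense F (dom A) (Num.max K1 0 * K2 * rnorm y + K * sip_norm (g : L2 T Y))).
- move=> u v; rewrite /F (linB linS) (linB linG) rdotBl.
  have : sip_norm (Psi (u - v) - (Psi u - Psi v) : L2 T Y) = 0.
    by have := linPsi (-1) v u Logic.I Logic.I; rewrite !scaleN1r ![- _ + _]addrC.
  move=> /(sip_rdot_eq_of_norm0 hL (dP _) (hs_domB hL (dP _) (dP _)) dg) ->.
  by rewrite (sip_rdotBl hL)//; lra.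
- move=> u; rewrite (le_trans (ler_normB _ _))// mulrDl lerD//.
    rewrite (le_trans (rdot_CS _ _))// mulrAC ler_wpM2r ?rnorm_ge0//.
    rewrite (le_trans (K1P _))//.
    apply: (@le_trans _ _ (Num.max K1 0 * rnorm (S t u))).
      by rewrite ler_wpM2r ?rnorm_ge0// le_max lexx.
    by rewrite -mulrA ler_wpM2l ?le_max ?lexx ?orbT.
  rewrite (le_trans (sip_CS hL _ _))// mulrAC ler_wpM2r ?sip_norm_ge0//.
  by have := KP u Logic.I; rewrite sip_norm_of.
- by move=> x; have := gen_dense_seq hS hA x.
- move=> u du; rewrite /F.
  have du2 := obs_orbit_dom T du.
  have -> : sip_rdot (Psi u : L2 T Y) g = sip_rdot ((fun r => C (S r u)) : L2 T Y) g.
    apply: (sip_rdot_eq_of_norm0 hL) => //.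
    by apply/L2_norm_eq0 => //; exact: aePsi.
  rewrite laplace_testE//; apply/eqP; rewrite subr_eq0; apply/eqP.
  rewrite obs_laplaceE//; last by case: (gen_sg hS hA t0 du).
  apply: eq_Rintegral => s; rewrite inE /= in_itv /= => /andP[s0 _].
  by rewrite (sgD hS).
Qed.

End OutputMap.
End Observation.

(** * Laplace integrals of constants and shifted integrands *)

Section ConstantSemigroup.
Context {R : realType} {Y : hilbertType R}.
Local Notation mu := (@lebesgue_measure R).
Local Notation MR := (measurableTypeR R).
Local Notation I b := (`[0, b]%classic : set MR).

Lemma constant_C0 : C0_semigroup (fun (_ : R) (y : Y) => y).
Proof.
split => //; last by move=> x; exact: cvg_cst.
by move=> t _; split => // x; exact: cvg_id.
Qed.

Lemma constant_gen : is_generator (fun (_ : R) (y : Y) => y) (PartialOp setT (fun=> 0 : Y)).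
Proof.
have h (x : Y) : (h^-1)%:C *: (x - x) @[h --> (0 : R)^'+] --> (0 : Y).
  by under eq_cvg do rewrite subrr scaler0; exact: cvg_cst.
by split => /= x; [split => // _; exists 0|move=> _].
Qed.

(* Read off the constant semigroup, whose generator is 0. *)
Lemma Rintegral_laplace_cst l b (v y : Y) : 0 <= b ->
  l * Rintegral mu (I b) (fun s => expR (- (l * s)) * rdot v y) =
  (1 - expR (- (l * b))) * rdot v y.
Proof.
move=> b0; have [_] := laplace_int_dom constant_C0 constant_gen l v b0.
rewrite subr0 => /(congr1 (rdot^~ y)); rewrite rdotZl laplace_intE; last exact: constant_C0.
by move=> ->; rewrite rdotBl rdotZl mulrBl mul1r.
Qed.

Lemma integrable_shift (f : R -> R) (b t : R) :
  mu.-integrable (`[t, b + t]%classic : set MR) (EFin \o f) ->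
  mu.-integrable (I b) (EFin \o (fun s => f (s + t))).
Proof.
move=> /integrableP[mf foo].
have mD : measurable (`[t, b + t]%classic : set MR) by exact: measurable_itv.
have pre : (fun s => 1 * s + t) @^-1` (`[t, b + t]%classic : set MR) = I b.
  by apply/seteqP; split => s /=; rewrite !in_itv /= mul1r lerDr lerD2r.
apply/integrableP; split.
  apply/measurable_EFinP; rewrite -pre.
  have /measurable_EFinP mf' := mf.
  have := @measurable_fun_affine R 1 t _ _ mD mf'.
  by congr measurable_fun; apply/funext => s; rewrite mul1r.
apply: le_lt_trans foo.
rewrite -(@ge0_integral_affine R 1 t _ _ (normr1 _) mD)//; last first.
  by apply: measurableT_comp.
rewrite pre le_eqVlt; apply/orP; left; apply/eqP.
by apply: eq_integral => s _; rewrite /= mul1r.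
Qed.

Lemma integrable_expRM (F : R -> R) (l b : R) : 0 <= l ->
  mu.-integrable (I b) (EFin \o F) ->
  mu.-integrable (I b) (EFin \o (fun s => expR (- (l * s)) * F s)).
Proof.
move=> l0 iF; apply: le_integrable (iF); first exact: measurable_I.
  apply/measurable_EFinP; apply: measurable_funM; first exact: expR_measurable.
  by case/integrableP : iF => /measurable_EFinP.
move=> s; rewrite /= in_itv /= => /andP[s0 _].
rewrite lee_fin normrM ger0_norm ?expR_ge0// ler_piMl// -expR0 ler_expR.
by rewrite oppr_le0 mulr_ge0.
Qed.

End ConstantSemigroup.

(** * The Yosida extension along orbits *)

Section Yosida.
Context {R : realType} {H Y : hilbertType R} (S : R -> H -> H) (A : partialOp H H).
Hypotheses (sepY : separable Y) (hS : C0_semigroup S) (hA : is_generator S A).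
Variables (beta : R[i]) (C : H -> Y).
Hypotheses (rho : resolvent_set A beta) (bddC : bounded_on_H1 A beta C).
Local Notation mu := (@lebesgue_measure R).
Local Notation MR := (measurableTypeR R).
Local Notation I b := (`[0, b]%classic : set MR).
Variables (T : R) (Psi : H -> R -> Y).
Hypothesis bddPsi : bounded_operator (V := sip_of H) (W := L2 T Y) Psi.
Hypothesis aePsi : forall x, dom A x ->
  {ae mu, forall t, t \in `[0, T] -> Psi x t = C (S t x)}.

Let phi x t s := rnorm (Psi x (s + t) - Psi x t).

Lemma integrable_phi x t : 0 <= t -> mu.-integrable (I (T - t)) (EFin \o phi x t).
Proof.
move=> t0; apply: (@integrable_shift R (fun r => rnorm (Psi x r - Psi x t))).
rewrite subrK; have [dP _ _] := bddPsi.
have := integrable_rnormB (Psi x t) (dP x Logic.I); apply: integrableS => //.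
by apply: subset_itvr; rewrite bnd_simp.
Qed.

(** The difference is the weak integral of l e^(-ls) (Psi x (s + t) - Psi x t): constants contribute
    1 - e^(-l(T - t)) by [Rintegral_laplace_cst]. *)
Lemma obs_laplace_near x t l : 0 < t < T -> 0 <= l ->
  rnorm (l%:C *: C (laplace_int S l (T - t) (S t x)) -
         (1 - expR (- (l * (T - t))))%:C *: Psi x t) <=
  Rintegral mu (I (T - t)) (fun s => l * expR (- (l * s)) * phi x t s).
Proof.
move=> /andP[t0 tT] l0; have [dP _ _] := bddPsi.
have b0 : 0 <= T - t by rewrite subr_ge0 ltW.
have tT' : 0 <= t <= T by rewrite !ltW.
have mphi y : measurable_fun (I (T - t)) (fun s => rdot (Psi x (s + t)) y).
  have mD : measurable (`[t, T]%classic : set MR) by exact: measurable_itv.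
  have mr : measurable_fun (`[t, T]%classic : set MR) (fun r => rdot (Psi x r) y).
    apply: (@measurable_funS _ _ _ _ (I T)) => //; first by apply: subset_itvr; rewrite bnd_simp ltW.
    exact: (measurable_rdot (dP x Logic.I).1 (strongly_measurable_cst T y)).
  have := @measurable_fun_affine R 1 t _ _ mD mr.
  rewrite (_ : _ @^-1` _ = I (T - t)); last first.
    by apply/seteqP; split => s /=; rewrite !in_itv /= mul1r lerDr lerBrDr.
  by congr measurable_fun; apply/funext => s; rewrite mul1r.
have mexp : measurable_fun (I (T - t)) (fun s => expR (- (l * s))) by exact: expR_measurable.
have iphi := integrable_phi x (ltW t0).
apply: (@weak_integral_norm R Y (I (T - t)) (measurable_I _)
  (fun s => (l * expR (- (l * s)))%:C *: (Psi x (s + t) - Psi x t))).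
- move=> y; rewrite (_ : (fun s => _) = (fun s => l * expR (- (l * s)) *
      (rdot (Psi x (s + t)) y - rdot (Psi x t) y))); last first.
    by apply/funext => s; rewrite rdotZl rdotBl.
  apply: measurable_funM; first by apply: measurable_funM => //; exact: measurable_cst.
  by apply: measurable_funB => //; exact: measurable_cst.
- apply: integrable_laplace => //; first by move=> s; exact: rnorm_ge0.
- by move=> s _; rewrite rnormZr ger0_norm// mulr_ge0// expR_ge0.
move=> y; rewrite rdotBl !rdotZl (output_rdotE sepY hS hA rho bddC bddPsi aePsi)//.
rewrite (laplace_testE sepY y l0 tT' (dP x Logic.I)) -Rintegral_laplace_cst//.
have i1 : mu.-integrable (I (T - t)) (EFin \o (fun s => rdot (Psi x (s + t)) y)).
  apply: (@integrable_shift R (fun r => rdot (Psi x r) y)).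
  have dy : sip_dom (L2 T Y) (fun=> y).
    by apply: (L2_dom_bounded (M := rnorm y)) => //; exact: strongly_measurable_cst.
  rewrite subrK; apply: integrableS (integrable_rdot (dP x Logic.I) dy) => //.
  by apply: subset_itvr; rewrite bnd_simp ltW.
have i2 := integrable_expRM l0 i1.
have i3 := integrable_expRM l0 (integrable_cst_I (T - t) (rdot (Psi x t) y)).
rewrite -mulrBr -RintegralB// -RintegralZl//; last exact: (integrable_RB (measurable_I _) i2 i3).
by apply: eq_Rintegral => s _; rewrite rdotZl rdotBl; ring.
Qed.

(** (beta - A) R(l, A) = (beta - l) R(l, A) + 1, and R(l, A) is bounded uniformly for large l; hence
    growth at most linear in l, enough against the exponential tail. *)
Lemma obs_resolvent_le : exists l0 : R, 0 <= l0 /\ exists c1 c2 : R, 0 <= c1 /\ 0 <= c2 /\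
  forall l, l0 <= l -> resolvent_set A l%:C /\
  forall w, rnorm (C (resolvent A l%:C w)) <= (c1 + c2 * l) * rnorm w.
Proof.
have [l0 [l00 [c cP]]] := resolvent_large hS hA.
have [linCR [K KP]] := obs_resolvent_bounded hS hA rho bddC.
pose K' := Num.max K 0; pose c' := Num.max c 0.
have K'0 : 0 <= K' by rewrite le_max lexx orbT.
have c'0 : 0 <= c' by rewrite le_max lexx orbT.
pose a : R := rnorm (beta : R[i]^o); have a0 : 0 <= a by exact: rnorm_ge0.
exists l0; split => //; exists (K' * (a * c' + 1)), (K' * c').
split; first by rewrite mulr_ge0// addr_ge0// mulr_ge0.
split; first exact: mulr_ge0.
move=> l ll; have [rl rlP] := cP l ll; split => // w.
have l0' : 0 <= l := le_trans l00 ll.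
have [d dE] := resolventP rl w.
rewrite (obs_resolventE _ rho d).
set r := resolvent A l%:C w in d dE *.
have rc : rnorm r <= c' * rnorm w.
  by rewrite (le_trans (rlP w))// ler_wpM2r ?rnorm_ge0// le_max lexx.
have -> : beta *: r - A r = (beta *: r - l%:C *: r) + w by rewrite -dE addrA subrK.
rewrite (le_trans (KP _))//.
apply: (@le_trans _ _ (K' * rnorm (beta *: r - l%:C *: r + w))).
  by rewrite ler_wpM2r ?rnorm_ge0// le_max lexx.
have -> : (K' * (a * c' + 1) + K' * c' * l) * rnorm w =
    K' * (a * (c' * rnorm w) + l * (c' * rnorm w) + rnorm w) by ring.
rewrite ler_wpM2l// (le_trans (rnormD _ _))// lerD2r.
rewrite (le_trans (rnormB _ _))// rnormZ rnormZr ger0_norm//.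
by rewrite lerD// ler_wpM2l.
Qed.

(* Weiss: the limit holds at the Lebesgue points of the output function. *)
Theorem yosida_orbit_cvg x :
  {ae mu, forall t, t \in `[0, T] ->
     C (l%:C *: resolvent A l%:C (S t x)) @[l --> +oo] --> Psi x t}.
Proof.
have [dP linPsi KP] := bddPsi.
have hleb := lebesgue_point_L2 sepY (dP x Logic.I).
apply: ae_imp2 (ae_imp2 _ (ae_neq 0) (ae_neq T)) hleb => [t|]; last first.
  by move=> t t0 tT; exact: (conj t0 tT).
move=> [t0 tT] tleb; rewrite in_itv /= => /andP[t0' tT'].
have {}t0 : 0 < t by rewrite lt_neqAle eq_sym t0.
have {}tT : t < T by rewrite lt_neqAle tT.
have tb : 0 < t < T by rewrite t0.
have b0 : 0 < T - t by rewrite subr_gt0.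
have [l0 [l00 [c1 [c2 [c10 [c20 hl0]]]]]] := obs_resolvent_le.
have abel : Rintegral mu (I (T - t)) (fun s => l * expR (- (l * s)) * phi x t s)
    @[l --> +oo] --> (0 : R).
  apply: abel_laplace_cvg0 => //.
  - by move=> s; exact: rnorm_ge0.
  - exact: integrable_phi.
  move=> e e0; have [d d0 dP'] := tleb tb e e0.
  by exists d => // h hd; case: (dP' h hd).
(* S(T - t) applied to S(t) x: the tail of the resolvent at [S t x] is e^(-l(T - t)) R(l, A) w. *)
pose w := S T x.
have tail := expRN_poly_cvg0 (rnorm (Psi x t) + c1 * rnorm w) (c2 * rnorm w) b0.
apply: (rnorm_squeeze (g := fun l => Rintegral mu (I (T - t)) (fun s => l * expR (- (l * s)) * phi x t s)
   + l * expR (- (l * (T - t))) * (rnorm (Psi x t) + c1 * rnorm w + c2 * rnorm w * l))); last first.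
  by rewrite -[X in _ --> X](addr0 (0 : R)); apply: cvgD.
near=> l.
have l1 : 1 <= l by near: l; exact: nbhs_pinfty_ge.
have ll : l0 <= l by near: l; apply: nbhs_pinfty_ge; exact: num_real.
have l0' : 0 <= l := le_trans ler01 l1.
have [rl rlP] := hl0 l ll.
set E := expR (- (l * (T - t))); have E0 : 0 <= E by exact: expR_ge0.
set L := laplace_int S l (T - t) (S t x).
have resE : resolvent A l%:C (S t x) = E%:C *: resolvent A l%:C w + L.
  rewrite (resolvent_laplace hS hA (S t x) (ltW b0) rl) addrC; congr (_ *: _ + _).
  rewrite -(resolvent_sg hS hA rl _ (ltW b0)); congr resolvent.
  by rewrite -(sgD hS) ?(ltW b0)// subrK.
have [linC _] := bddC.
have dL : dom A L := (laplace_int_dom hS hA l (S t x) (ltW b0)).1.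
have dr := (resolventP rl w).1.
have dE := (genZ hS hA E%:C dr).1.
have CE : C (l%:C *: resolvent A l%:C (S t x)) =
    l%:C *: C L + (l * E)%:C *: C (resolvent A l%:C w).
  have d0 := (gen0 hS hA).1.
  have Clin a u : dom A u -> C (a *: u) = a *: C u.
    move=> du; have C0 : C 0 = 0.
      have := linC 1 0 0 d0 d0; rewrite scaler0 addr0 scale1r -{1}[C 0]addr0.
      by move=> /addrI <-.
    by rewrite -[a *: u]addr0 linC// C0 addr0.
  rewrite Clin; last by rewrite resE; exact: (gen_linear hS hA _ dr dL).1.
  by rewrite resE linC// scalerDr scalerA -rmorphM/= addrC.
rewrite CE.
(* The first bracket is the Abel mean of [obs_laplace_near]; the second collects what carries the
   decaying factor E. *)
have -> : l%:C *: C L + (l * E)%:C *: C (resolvent A l%:C w) - Psi x t =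
   (l%:C *: C L - (1 - E)%:C *: Psi x t) +
   ((l * E)%:C *: C (resolvent A l%:C w) - E%:C *: Psi x t).
  rewrite rmorphB/= scalerBl scale1r opprB addrACA; congr (_ + _).
  by rewrite addrAC subrr add0r.
rewrite (le_trans (rnormD _ _))// lerD//; first exact: obs_laplace_near.
rewrite (le_trans (rnormB _ _))// !rnormZr !ger0_norm ?mulr_ge0//.
have h1 := ler_wpM2l (mulr_ge0 l0' E0) (rlP w).
have h2 : E * rnorm (Psi x t) <= l * E * rnorm (Psi x t).
  by rewrite ler_wpM2r ?rnorm_ge0// ler_peMl.
rewrite addrC (le_trans (lerD h2 h1))//.
by rewrite le_eqVlt; apply/orP; left; apply/eqP; ring.
Unshelve. all: by end_near. Qed.

Corollary yosida_orbit_eq x :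
  {ae mu, forall t, t \in `[0, T] -> yosida A C (S t x) = Psi x t}.
Proof.
apply: ae_imp (yosida_orbit_cvg x) => t h It.
by apply: cvg_lim; [exact: norm_hausdorff|exact: h].
Qed.

End Yosida.

(** * Integrals of nonnegative functions: null sets and Tonelli for sums *)

Section LowerIntegral.
Context {R : realType}.
Local Notation mu := (@lebesgue_measure R).
Local Notation MR := (measurableTypeR R).

(* The integral of a nonnegative function, measurable or not, is the supremum of the *)
(* integrals of the simple functions below it.                               *)
Lemma ge0_integral_mono (D : set MR) (f g : MR -> \bar R) :
  (forall t, D t -> (0 <= f t)%E) -> (forall t, D t -> (f t <= g t)%E) ->
  (\int[mu]_(t in D) f t <= \int[mu]_(t in D) g t)%E.
Proof.
move=> f0 fg.
have g0 t : D t -> (0 <= g t)%E by move=> Dt; rewrite (le_trans (f0 t Dt))// fg.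
rewrite !ge0_integralE//; apply: ereal_sup_le => _ [h /= hf <-].
exists h => //= t; rewrite (le_trans (hf t))//.
by rewrite !patchE; case: ifPn => // /set_mem; exact: fg.
Qed.

(** The function f comes from the Yosida extension and is known only off a null set. It lies between
    the two copies of g set to 0 and to +oo on that null set, and both have the integral of g. *)
Lemma ge0_integral_ae_eq (D : set MR) (f g : MR -> \bar R) : measurable D ->
  measurable_fun D g -> (forall t, D t -> (0 <= f t)%E) -> (forall t, D t -> (0 <= g t)%E) ->
  {ae mu, forall t, D t -> f t = g t} ->
  (\int[mu]_(t in D) f t = \int[mu]_(t in D) g t)%E.
Proof.
move=> mD mg f0 g0 [N [mN N0 subN]].
pose k (b : \bar R) t := if `[< N t >] then b else g t.
have mk b : measurable_fun D (k b).
  apply: measurable_fun_if => //; last exact: measurable_funS mg.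
  apply: (measurable_fun_bool true).
  have Nb : (fun t => `[< N t >]) @^-1` [set true] = N.
    by apply/seteqP; split => t /= h; apply/asboolP.
  by rewrite Nb; exact: measurableI.
have kE b : (0 <= b)%E -> (\int[mu]_(t in D) k b t = \int[mu]_(t in D) g t)%E.
  move=> b0; apply: ge0_ae_eq_integral => //.
    by move=> t Dt; rewrite /k; case: asboolP => // _; exact: g0.
  exists N; split => // t /= h; apply: contrapT => nN; apply: h => _.
  by rewrite /k asboolF.
have out t : D t -> ~ N t -> f t = g t.
  by move=> Dt nN; apply: contrapT => h; apply: nN; apply: subN => /= /(_ Dt).
apply/eqP; rewrite eq_le; apply/andP; split.
  rewrite -(kE +oo%E)//; apply: ge0_integral_mono => // t Dt; rewrite /k.
  by case: asboolP => nN; [exact: leey|rewrite out].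
rewrite -(kE 0%E)//; apply: ge0_integral_mono => // t Dt; rewrite /k.
  by case: asboolP => // _; exact: g0.
by case: asboolP => nN; [exact: f0|rewrite out].
Qed.

(** An injection of E into the natural numbers turns the sum into a series of nonnegative functions,
    with 0 off the image. *)
Lemma ge0_integral_esum (K : choiceType) (E : set K) (D : set MR) (f : K -> MR -> \bar R) :
  countable E -> measurable D ->
  (forall e, E e -> measurable_fun D (f e)) ->
  (forall e t, E e -> D t -> (0 <= f e t)%E) ->
  measurable_fun D (fun t => \esum_(e in E) f e t)%E /\
  (\int[mu]_(t in D) (\esum_(e in E) f e t) = \esum_(e in E) (\int[mu]_(t in D) f e t))%E.
Proof.
move=> /countable_injP[c cinj] mD mf f0.
have [e0E|E0] := pselect (exists e0, E e0); last first.
  have -> : E = set0 by apply/seteqP; split => // e Ee; apply: E0; exists e.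
  rewrite esum_set0; split.
    by under eq_fun do rewrite esum_set0; exact: measurable_cst.
  by rewrite integral0_eq// => t _; rewrite esum_set0.
pose d n := xget (projT1 (cid e0E)) [set e | E e /\ c e = n].
have dK e : E e -> d (c e) = e.
  move=> Ee; rewrite /d; case: xgetP => [x _ [Ex cx]|/(_ e)]; last by move=> /(_ (conj Ee erefl)).
  by apply: cinj; rewrite ?inE.
have bij : set_bij (c @` E) E d.
  split.
  - by move=> _ [e Ee <-]; rewrite dK.
  - by move=> _ _ /set_mem[e Ee <-] /set_mem[e' Ee' <-]; rewrite !dK// => ->.
  - by move=> e Ee; exists (c e); [exists e|exact: dK].
have esumE (g : K -> \bar R) : (forall e, E e -> (0 <= g e)%E) -> (\esum_(e in E) g e =
    \sum_(0 <= n <oo) if n \in c @` E then g (d n) else 0)%E.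
  move=> g0; rewrite (@reindex_esum R nat K (c @` E) E d g bij) esum_mkcond nneseries_esumT// => n.
  by case: ifPn => // /set_mem[e Ee <-]; rewrite dK//; exact: g0.
pose h n t := if n \in c @` E then f (d n) t else 0%E.
have h0 n t : D t -> (0 <= h n t)%E.
  by move=> Dt; rewrite /h; case: ifPn => // /set_mem[e Ee <-]; rewrite dK//; exact: f0.
have mh n : measurable_fun D (h n).
  have [nin|nin] := boolP (n \in c @` E); rewrite /h ?nin ?(negbTE nin); last exact: measurable_cst.
  by have [e Ee <-] := set_mem nin; rewrite dK//; exact: mf.
have eqD t : D t -> (\esum_(e in E) f e t = \sum_(0 <= n <oo) h n t)%E.
  by move=> Dt; rewrite esumE// => e Ee; exact: f0.
split.
  apply: (eq_measurable_fun (fun t => \sum_(0 <= n <oo) h n t)%E).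
    by move=> t /set_mem Dt; rewrite eqD.
  apply: (@ge0_emeasurable_sum _ _ _ D h predT) => //.
  by move=> n t Dt _; exact: h0.
transitivity (\int[mu]_(t in D) \sum_(0 <= n <oo) h n t)%E.
  by apply: eq_integral => t /set_mem Dt; rewrite eqD.
rewrite integral_nneseries// esumE; last by move=> e Ee; apply: integral_ge0 => t Dt; exact: f0.
apply: eq_eseriesr => n _; rewrite /h; case: ifPn => // _.
by rewrite integral0_eq.
Qed.

End LowerIntegral.

(** * Countability of orthonormal sets *)

Section CountableBasis.
Context {R : realType} {H : hilbertType R}.

(** Distinct elements are at distance sqrt 2, so points of a dense sequence within 1/2 of them are
    distinct. *)
Lemma orthonormal_countable (E : set H) : separable H ->
  orthonormal_set (V := sip_of H) E -> countable E.
Proof.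
move=> /separable_seq[q qd] [_ oE].
have /choice[c cP] : forall e : H, exists n, rnorm (q n - e) < 2^-1.
  by move=> e; apply: qd; rewrite invr_gt0.
apply/countable_injP; exists c => e f /set_mem Ee /set_mem Ef cef.
apply: contrapT => /eqP ef.
have : rnorm (e - f) ^+ 2 = 2.
  rewrite -rdotE rdotBl !rdotBr.
  have ee (g g' : H) : E g -> E g' -> rdot g g' = (g == g')%:R.
    by move=> Eg Eg'; rewrite /rdot [inner _ _]oE//; case: eqVneq.
  by rewrite !ee// !eqxx [f == e]eq_sym (negbTE ef) /= mulr0n mulr1n; lra.
have h1 : rnorm (e - f) < 1.
  have := rnorm_triangle e (q (c e)) f; have := cP e; have := cP f.
  rewrite (rnormC e (q (c e))) cef; lra.
have := rnorm_ge0 (e - f); nra.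
Qed.

End CountableBasis.

(** * Adjoints of operators between spaces of representatives *)

Section OperatorAdjoint.
Context {R : realType} (V W : sipSpace R).
Hypotheses (hV : hilbert_sip V) (hW : hilbert_sip W).

Lemma operator_rdotP (F : V -> W) a u v w : bounded_operator F ->
  sip_dom V u -> sip_dom V v -> sip_dom W w ->
  sip_rdot (F (a *: u + v)) w = complex.Re (a * sip_dot W (F u) w) + sip_rdot (F v) w.
Proof.
move=> [dF lF _] du dv dw.
have dau : sip_dom W (a *: F u) by apply: (hs_domZ hW); exact: dF.
rewrite (sip_rdot_eq_of_norm0 hW (v := a *: F u + F v))//; last 3 first.
- by apply: dF; exact: (hs_domP hV).
- by apply: (hs_domP hW); exact: dF.
- exact: lF.
by rewrite (sip_rdotDl hW)//; [rewrite /sip_rdot (sip_dotZl hW)//; exact: dF|exact: dF].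
Qed.

(** Riesz gives a representative of G w for each w separately, so G is linear only up to vectors of
    norm 0; this is checked by duality with [sip_norm_ge_rdot]. *)
Lemma operator_adjoint (F : V -> W) : bounded_operator F ->
  exists2 G : W -> V, bounded_operator G &
    forall v w, sip_dom V v -> sip_dom W w -> sip_dot W (F v) w = sip_dot V v (G w).
Proof.
move=> bF; have [dF lF [M MP]] := bF.
have /choice[G GP] : forall w, exists z, sip_dom W w ->
    sip_dom V z /\ forall v, sip_dom V v -> sip_rdot (F v) w = sip_rdot v z.
  move=> w; have [dw|ndw] := pselect (sip_dom W w); last by exists 0.
  have [r x y dx dy|x dx|z dz zP] := @riesz _ _ hV (fun v => sip_rdot (F v) w) (M * sip_norm w).
  - rewrite operator_rdotP//; congr (_ + _); rewrite /sip_rdot.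
    by case: (sip_dot W (F x) w) => a b /=; rewrite mul0r subr0.
  - rewrite (le_trans (sip_CS hW _ _))//; first exact: dF.
    by rewrite mulrAC ler_wpM2r ?sip_norm_ge0// MP.
  by exists z.
have F0 w : sip_dom W w -> sip_rdot (F 0) w = 0.
  by move=> dw; rewrite (GP w dw).2 ?/sip_rdot ?(sip_dot0l hV)//; [exact: (GP w dw).1|exact: (hs_dom0 hV)].
have GE v w : sip_dom V v -> sip_dom W w -> sip_dot W (F v) w = sip_dot V v (G w).
  move=> dv dw; have [dG h] := GP w dw.
  have h1 := h v dv; have h2 := h ('i *: v) (hs_domZ hV 'i dv).
  move: h2; rewrite -[X in F X]addr0 operator_rdotP//; last exact: (hs_dom0 hV).
  rewrite F0// addr0 => h2; move: h1 h2; rewrite /sip_rdot (sip_dotZl hV)//.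
  case: (sip_dot W (F v) w) => a b; case: (sip_dot V v (G w)) => p q /= ->.
  by rewrite !mul0r !mul1r !sub0r => /oppr_inj ->.
exists G => //; split.
- by move=> w dw; exact: (GP w dw).1.
- move=> a u v du dv.
  have [dGu dGv] := ((GP u du).1, (GP v dv).1).
  have duv := hs_domP hW a du dv; have dGuv := (GP _ duv).1.
  have d1 : sip_dom V (a *: G u + G v) by exact: (hs_domP hV).
  have sw y x : sip_dom W y -> sip_dom V x -> sip_dot V (G y) x = sip_dot W y (F x).
    move=> dy dx; rewrite (hs_dotC hV dx (GP y dy).1) -GE// -(hs_dotC hW) //; exact: dF.
  apply/eqP; rewrite eq_le sip_norm_ge0 andbT.
  apply: (sip_norm_ge_rdot hV) => // [|x dx]; first exact: (hs_domB hV).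
  rewrite mul0r (sip_rdotBl hV)// [X in X - _]/sip_rdot sw// [X in _ - X](sip_rdotDl hV)//; last exact: (hs_domZ hV).
  rewrite /sip_rdot (sip_dotZl hV)// !sw// (hs_dotP hW)//; last exact: dF.
  by rewrite raddfD subrr.
- have M0 : 0 <= Num.max M 0 by rewrite le_max lexx orbT.
  exists (Num.max M 0) => w dw; have [dG h] := GP w dw.
  apply: (sip_norm_ge_rdot hV) => // [|x dx]; first by rewrite mulr_ge0 ?sip_norm_ge0.
  rewrite (sip_rdotC hV)// -h// (le_trans (sip_rdot_le hW (dF _ dx) dw))//.
  rewrite mulrAC ler_wpM2r ?sip_norm_ge0// (le_trans (MP _ dx))// ler_wpM2r ?sip_norm_ge0//.
  by rewrite le_max lexx.
Qed.

End OperatorAdjoint.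

(** * Hilbert-Schmidt operators and extension by density *)

Section HilbertSchmidt.
Context {R : realType} {H : hilbertType R} (W : sipSpace R).
Hypothesis hW : hilbert_sip W.
Implicit Types (F : H -> W).

(** Passing to adjoints, F K becomes K' G, where the bound on K' applies to each term. Returning
    from G to F may use another basis, so K = id gives independence of the basis. *)
Lemma esum_sqr_bounded_le (E : set H) F (K : H -> H) (M : R) :
  orthonormal_basis (V := sip_of H) E -> bounded_operator (V := sip_of H) F ->
  linear K -> (forall x, rnorm (K x) <= M * rnorm x) -> 0 <= M ->
  forall E' : set H, orthonormal_basis (V := sip_of H) E' ->
  (\esum_(e in E) (sip_norm (F (K e)) ^+ 2)%:E <=
   (M ^+ 2)%:E * (\esum_(e in E') (sip_norm (F e) ^+ 2)%:E))%E.
Proof.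
move=> bE bF linK KM M0 E' bE'.
have [L bL] := exists_orthonormal_basis hW.
have [G _ GE] := operator_adjoint hs_sip_of hW bF.
have GP v w (dw : sip_dom W w) : sip_dot W (F v) w = inner v (G w) := GE v w Logic.I dw.
have [|K' K'P] := @bounded_linear_adjoint _ _ _ K; first by split => //; exists M.
have [dF _ _] := bF; have d x : sip_dom W (F x) by exact: dF.
have hH := @hs_sip_of R H.
have -> : (\esum_(e in E) (sip_norm (F (K e)) ^+ 2)%:E =
    \esum_(l in L) (sip_norm (K' (G l) : sip_of H) ^+ 2)%:E)%E.
  apply: (@esum_sqr_adjoint _ (sip_of H) W hH hW E L (F \o K) (K' \o G)) => //.
    by move=> v _ /=; exact: d.
  by move=> v w _ dw /=; rewrite GP// K'P.
have -> : (\esum_(e in E') (sip_norm (F e) ^+ 2)%:E =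
    \esum_(l in L) (sip_norm (G l : sip_of H) ^+ 2)%:E)%E.
  exact: (@esum_sqr_adjoint _ (sip_of H) W hH hW E' L F G).
have K'M x : rnorm (K' x) <= M * rnorm x.
  apply: rnorm_le_rdot; first by rewrite mulr_ge0// rnorm_ge0.
  move=> y; rewrite rdotC /rdot -K'P -/(rdot _ _) (le_trans (rdot_le _ _))//.
  by rewrite mulrAC ler_wpM2r ?rnorm_ge0.
have mulE : ((M ^+ 2)%:E * (\esum_(l in L) (sip_norm (G l : sip_of H) ^+ 2)%:E) =
    \esum_(l in L) ((M ^+ 2)%:E * (sip_norm (G l : sip_of H) ^+ 2)%:E))%E.
  (* The other case divides by M^2. *)
  have [->|M1] := eqVneq M 0.
    by rewrite expr0n /= mul0e; apply/esym/esum1 => l _; rewrite mul0e.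
  apply/eqP; rewrite eq_le; apply/andP; split.
    have M2 : 0 < M ^+ 2 by rewrite exprn_gt0// lt_neqAle eq_sym M1.
    rewrite -lee_pdivlMl//; apply: ge_ereal_sup => _ [X [finX XL] <-].
    rewrite lee_pdivlMl//; apply: esum_ge; exists X => //.
    rewrite !fsbig_finite//= ge0_sume_distrr// => l _; by rewrite lee_fin sqr_ge0.
  apply: ge_ereal_sup => _ [X [finX XL] <-].
  rewrite !fsbig_finite//= -ge0_sume_distrr//; last by move=> l _; rewrite lee_fin sqr_ge0.
  apply: lee_wpmul2l; first by rewrite lee_fin sqr_ge0.
  by apply: esum_ge; exists X => //; rewrite fsbig_finite.
rewrite mulE; apply: le_esum => l _ /=.
rewrite -EFinM lee_fin -exprMn lerXn2r ?nnegrE ?sip_norm_ge0 ?mulr_ge0 ?sip_norm_ge0//.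
by rewrite !sip_norm_of.
Qed.

Lemma hilbert_schmidt_basis (E : set H) F : orthonormal_basis (V := sip_of H) E ->
  hilbert_schmidt (V := sip_of H) F <->
  bounded_operator (V := sip_of H) F /\ (\esum_(e in E) (sip_norm (F e) ^+ 2)%:E < +oo)%E.
Proof.
move=> bE; split => [[bF [E' bE' E'oo]]|[bF Eoo]]; last by split => //; exists E.
split => //; apply: le_lt_trans E'oo.
have lid : linear (@idfun H) by [].
have := @esum_sqr_bounded_le E F idfun 1 bE bF lid _ ler01 E' bE'.
by rewrite expr1n mul1e; apply => x; rewrite mul1r.
Qed.

(** The value at x is a limit of values on D, characterised by its distance to every F u being at
    most M' |u - x|. Linearity and boundedness follow from this estimate by approximating the
    arguments. *)
Lemma bounded_operator_extend (D : set H) (F : H -> W) (M : R) :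
  (forall a u v, D u -> D v -> D (a *: u + v)) ->
  (forall x e, 0 < e -> exists2 d, D d & rnorm (d - x) < e) ->
  (forall u, D u -> sip_dom W (F u)) ->
  (forall a u v, D u -> D v -> sip_norm (F (a *: u + v) - (a *: F u + F v)) = 0) ->
  (forall u, D u -> sip_norm (F u) <= M * rnorm u) ->
  exists Psi, bounded_operator (V := sip_of H) (W := W) Psi /\
    forall u, D u -> sip_norm (Psi u - F u) = 0.
Proof.
move=> DP Dd dF lF FM.
pose M' := Num.max M 0; have M'0 : 0 <= M' by rewrite le_max lexx orbT.
have DB u v : D u -> D v -> D (u - v).
  by move=> Du Dv; rewrite addrC -scaleN1r; exact: DP.
have FB u v : D u -> D v -> sip_norm (F u - F v) <= M' * rnorm (u - v).
  move=> Du Dv; have Duv := DB _ _ Du Dv.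
  have h := lF (-1) v u Dv Du; rewrite !scaleN1r ![- _ + _]addrC in h.
  have [du dv] := (dF _ Du, dF _ Dv); have duv := dF _ Duv.
  have dB := hs_domB hW du dv.
  have := sip_triangle hW dB duv (hs_dom0 hW); rewrite !subr0 (sip_normC hW dB duv) h add0r.
  move=> /le_trans -> //; rewrite (le_trans (FM _ Duv))// ler_wpM2r ?rnorm_ge0//.
  by rewrite le_max lexx.
have /choice[Psi PsiP] : forall x, exists f, sip_dom W f /\
    forall u, D u -> sip_norm (F u - f) <= M' * rnorm (u - x).
  move=> x.
  (* The rate matches [hs_complete]. *)
  have /choice[d dP] : forall n : nat, exists d, D d /\ rnorm (d - x) < 8^-1 ^+ n.
    move=> n; have e0 : 0 < (8^-1 : R) ^+ n by rewrite exprn_gt0.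
    by have [z] := Dd x _ e0; exists z.
  have Dd' n := (dP n).1.
  have [n|f df fP] := hs_complete hW (f := fun n => F (d n)) (c := M' * 2) (fun n => dF _ (Dd' n)).
    rewrite (le_trans (FB _ _ (Dd' _) (Dd' _)))// -mulrA ler_wpM2l//.
    have := rnorm_triangle (d n.+1) x (d n); have := (dP n).2; have := (dP n.+1).2.
    rewrite (rnormC x) exprS; have : 0 < (8^-1 : R) ^+ n by rewrite exprn_gt0.
    by set p := (_ : R) ^+ n; lra.
  exists f; split => // u Du.
  have lim : M' * rnorm (u - d n) + sip_norm (F (d n) - f) @[n --> \oo] -->
      M' * rnorm (u - x) + 0.
    apply: cvgD => //; apply: cvgM; first exact: cvg_cst.
    apply: cvg_rnorm; apply: cvgB; first exact: cvg_cst.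
    apply: (rnorm_squeeze (g := fun n => 8^-1 ^+ n)).
      by apply: nearW => n; rewrite ltW//; case: (dP n).
    by apply: cvg_expr; rewrite ger0_norm// invf_lt1// ltr1n.
  rewrite addr0 in lim; apply: (cvgr_to_ge lim); apply: nearW => n.
  rewrite (le_trans (sip_triangle hW (dF _ Du) (dF _ (Dd' n)) df))// lerD2r.
  exact: FB.
have dPsi x := (PsiP x).1.
have le_eps (a b c : R) : 0 <= c -> (forall e, 0 < e -> a <= b + c * e) -> a <= b.
  move=> c0 h; apply/ler_addgt0Pr => e e0.
  have c1 : 0 < c + 1 by rewrite ltr_wpDl.
  rewrite (le_trans (h _ (divr_gt0 e0 c1)))// lerD2l mulrA ler_pdivrMr//.
  by rewrite mulrC ler_wpM2l ?ltW// ltrDl.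
exists Psi; split; last first.
  move=> u Du; apply/eqP; rewrite eq_le sip_norm_ge0 andbT.
  by rewrite (sip_normC hW (dPsi u) (dF _ Du)); have := (PsiP u).2 u Du; rewrite subrr rnorm0 mulr0.
split.
- by move=> x _; exact: dPsi.
- move=> a u v _ _; apply/eqP; rewrite eq_le sip_norm_ge0 andbT.
  pose ra := rnorm (a : R[i]^o); have ra0 : 0 <= ra by exact: rnorm_ge0.
  (* Approximating u and v to within e costs M' (ra + 1) e for the value at the combination and as
     much for the combination of the values. *)
  apply: (@le_eps _ _ (M' * (2 * (ra + 1)))).
    by rewrite !mulr_ge0// addr_ge0.
  move=> e e0; have [x Dx xu] := Dd u e e0; have [y Dy yv] := Dd v e e0.
  have Dxy := DP a _ _ Dx Dy.
  have [dx [dy dxy]] := (dF _ Dx, (dF _ Dy, dF _ Dxy)).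
  have h1 := (PsiP (a *: u + v)).2 _ Dxy.
  have h2 := (PsiP u).2 _ Dx; have h3 := (PsiP v).2 _ Dy.
  have h4 := lF a x y Dx Dy.
  have d1 : sip_dom W (a *: F x + F y) by exact: (hs_domP hW).
  have d2 : sip_dom W (a *: Psi u + Psi v) by exact: (hs_domP hW).
  have t1 := sip_triangle hW (dPsi (a *: u + v)) dxy d2.
  have t2 := sip_triangle hW dxy d1 d2.
  have t3 : sip_norm (a *: F x + F y - (a *: Psi u + Psi v)) <=
      ra * sip_norm (F x - Psi u) + sip_norm (F y - Psi v).
    rewrite opprD addrACA -scalerBr -(sip_normZ hW)//; last exact: hs_domB.
    by apply: (sip_normD hW); [apply: hs_domZ => //; exact: hs_domB|exact: hs_domB].
  have t4 : rnorm (a *: x + y - (a *: u + v)) <= ra * e + e.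
    rewrite opprD addrACA -scalerBr (le_trans (rnormD _ _))// rnormZ.
    by apply: lerD (ltW yv); rewrite (ler_wpM2l ra0)// ltW.
  rewrite (sip_normC hW (dPsi (a *: u + v)) dxy) in t1.
  have h1' : sip_norm (F (a *: x + y) - Psi (a *: u + v)) <= M' * (ra * e + e).
    by rewrite (le_trans h1)// (ler_wpM2l M'0).
  have h3' : sip_norm (F y - Psi v) <= M' * e.
    by rewrite (le_trans h3)// (ler_wpM2l M'0)// ltW.
  have h2' : ra * sip_norm (F x - Psi u) <= ra * (M' * e).
    by rewrite (ler_wpM2l ra0)// (le_trans h2)// (ler_wpM2l M'0)// ltW.
  rewrite add0r.
  have -> : M' * (2 * (ra + 1)) * e = M' * (ra * e + e) + (ra * (M' * e) + M' * e) by ring.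
  by lra.
exists M' => v _; rewrite (sip_norm_of v).
apply: (@le_eps _ _ (M' * 2)); first by rewrite mulr_ge0.
move=> e e0; have [x Dx xv] := Dd v e e0.
have dx := dF _ Dx; have h := (PsiP v).2 _ Dx.
have := sip_triangle hW (dPsi v) dx (hs_dom0 hW); rewrite !subr0 (sip_normC hW (dPsi v) dx).
have h2 : sip_norm (F x) <= M' * rnorm x.
  by rewrite (le_trans (FM _ Dx))// ler_wpM2r ?rnorm_ge0// le_max lexx.
have h3 : rnorm x <= rnorm v + e.
  have := rnormD (x - v) v; rewrite subrK; lra.
have h4 : M' * rnorm x <= M' * (rnorm v + e) by rewrite ler_wpM2l.
have h5 : M' * rnorm (x - v) <= M' * e by rewrite ler_wpM2l// ltW.
by rewrite mulrDr in h4; lra.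
Qed.

End HilbertSchmidt.

(** * Restricting and gluing functions of time *)

Section Gluing.
Context {R : realType} {Y : hilbertType R}.
Local Notation mu := (@lebesgue_measure R).
Local Notation MR := (measurableTypeR R).
Local Notation I b := (`[0, b]%classic : set MR).
Implicit Types (f g : R -> Y).

Lemma strongly_measurable_affine (V : normedModType R[i]) (s c T T' : R) (f : R -> V) :
  (forall t, t \in `[0, T'] -> s * t + c \in `[0, T]) ->
  strongly_measurable T f -> strongly_measurable T' (fun t => f (s * t + c)).
Proof.
move=> TT' [p sp pf]; exists (fun n t => p n (s * t + c)) => [n|t tT']; last exact/pf/TT'.
have [fp mp] := sp n; split.
  by apply: sub_finite_set fp => _ [t _ <-]; exists (s * t + c).
move=> v; have := @measurable_affine R s c measurableT _ (mp v).
by rewrite setTI.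
Qed.

Lemma L2_dom_le T T1 f : T <= T1 -> sip_dom (L2 T1 Y) f -> sip_dom (L2 T Y) f /\
  sip_norm (f : L2 T Y) <= sip_norm (f : L2 T1 Y).
Proof.
move=> TT1 df; have [[p sp pf] foo] := df.
have mf : strongly_measurable T f.
  exists p => // t tT; apply: pf; move: tT; rewrite !in_itv /= => /andP[-> tT].
  exact: le_trans TT1.
have le : (sqnorm_integral T f <= sqnorm_integral T1 f)%E.
  apply: ge0_subset_integral; [exact: measurable_I|exact: measurable_I| | |].
  - by apply/measurable_EFinP; apply: measurable_sqnorm => //; case: df.
  - by move=> t _; rewrite lee_fin sqr_ge0.
  - by apply: subset_itvl; rewrite bnd_simp.
have df' : sip_dom (L2 T Y) f by split => //; exact: le_lt_trans foo.
split => //; move: le; rewrite -!L2_sqnormE// lee_fin.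
by rewrite ler_sqr ?nnegrE ?sip_norm_ge0.
Qed.

Definition time_glue (T : R) f g t : Y := if `[< T < t >] then g (t - T) else f t.

Lemma time_glueZD T (a : R[i]) f g f' g' :
  time_glue T (a *: f + f') (a *: g + g') = a *: time_glue T f g + time_glue T f' g'.
Proof. by apply/funext => t; rewrite /time_glue !fctE; case: ifP. Qed.

Lemma time_glueB T f g f' g' : time_glue T (f - f') (g - g') = time_glue T f g - time_glue T f' g'.
Proof. by apply/funext => t; rewrite /time_glue !fctE; case: ifP. Qed.

Lemma time_glue_sqnorm T f g : 0 <= T -> sip_dom (L2 T Y) f -> sip_dom (L2 T Y) g ->
  strongly_measurable (T + T) (time_glue T f g) /\
  (sqnorm_integral (T + T) (time_glue T f g) = sqnorm_integral T f + sqnorm_integral T g)%E.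
Proof.
move=> T0 [mf foo] [mg goo].
have mG : strongly_measurable (T + T) (time_glue T f g).
  have [p sp pf] := mf; have [q sq qg] := mg.
  exists (fun n t => if `[< T < t >] then q n (t - T) else p n t).
    move=> n; apply: (@simple_if _ _ (fun t => T < t)) => //.
      rewrite (_ : (fun t => _) = `]T, +oo[%classic :> set MR); first exact: measurable_itv.
      by apply/seteqP; split => t /=; rewrite in_itv /= andbT.
    have [fq mq] := sq n; split.
      by apply: sub_finite_set fq => _ [t _ <-]; exists (t - T).
    move=> v; have := @measurable_affine R 1 (- T) measurableT _ (mq v).
    rewrite setTI; congr measurable; apply/seteqP; split => t /=; by rewrite mul1r.
  move=> t; rewrite in_itv /= /time_glue => /andP[t0 tT]; case: asboolP => Tt.
    by apply: qg; rewrite in_itv /=; apply/andP; split; lra.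
  by apply: pf; rewrite in_itv /= t0 leNgt; exact/negP.
split => //.
have mN := measurable_sqnorm mG.
have ITT : I (T + T) = I T `|` (`]T, T + T]%classic : set MR).
  by rewrite (@itv_bndbnd_setU _ _ (BLeft 0) (BRight T) (BRight (T + T)))// !bnd_simp// lerDl.
have mf2 := measurable_sqnorm mf; have mg2 := measurable_sqnorm mg.
rewrite /sqnorm_integral [X in (\int[mu]_(_ in X) _)%E]ITT ge0_integral_setU//=; last 3 first.
- by rewrite -ITT; apply/measurable_EFinP.
- by move=> t _; rewrite lee_fin sqr_ge0.
- apply/disj_setPS => t /= []; rewrite !in_itv /= => /andP[_ tT] /andP[Tt _].
  by have := lt_le_trans Tt tT; rewrite ltxx.
congr (_ + _)%E.
  apply: eq_integral => t; rewrite inE /= in_itv /= => /andP[_ tT].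
  by rewrite /time_glue; case: asboolP => //; rewrite ltNge tT.
transitivity (\int[mu]_(t in `]T, (T + T)%R]) (rnorm (g (1 * t - T)) ^+ 2)%:E)%E.
  apply: eq_integral => t; rewrite inE /= in_itv /= => /andP[Tt _].
  by rewrite /time_glue mul1r; case: asboolP.
have pre : (fun t => 1 * t - T) @^-1` (I T) = `[T, T + T]%classic :> set MR.
  apply/seteqP; split => t /=; rewrite !in_itv /= mul1r => /andP[? ?];
    by apply/andP; split; lra.
have m2 : measurable_fun (`[T, T + T]%classic : set MR) (fun t => rnorm (g (1 * t - T)) ^+ 2).
  by rewrite -pre; apply: (@measurable_fun_affine R 1 (- T) _ _ (measurable_I T) mg2).
rewrite (@integral_itv_obnd_cbnd R T (BRight (T + T)) (fun t => (rnorm (g (1 * t - T)) ^+ 2)%:E)); last first.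
  apply/measurable_EFinP; apply: measurable_funS m2; first exact: measurable_itv.
  by apply: subset_itvr; rewrite bnd_simp.
rewrite -pre (@ge0_integral_affine R 1 (- T) (I T) (fun t => (rnorm (g t) ^+ 2)%:E))//.
- by rewrite normr1.
- by apply/measurable_EFinP.
- by move=> t _; rewrite lee_fin sqr_ge0.
Qed.

Lemma time_glue_norm T f g : 0 <= T -> sip_dom (L2 T Y) f -> sip_dom (L2 T Y) g ->
  sip_dom (L2 (T + T) Y) (time_glue T f g) /\
  sip_norm (time_glue T f g : L2 (T + T) Y) ^+ 2 =
    sip_norm (f : L2 T Y) ^+ 2 + sip_norm (g : L2 T Y) ^+ 2.
Proof.
move=> T0 df dg; have [mG sE] := time_glue_sqnorm T0 df dg.
have dG : sip_dom (L2 (T + T) Y) (time_glue T f g).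
  by split => //; rewrite sE lte_add_pinfty//; [case: df|case: dg].
by split => //; apply: EFin_inj; rewrite EFinD !L2_sqnormE.
Qed.

End Gluing.

(** * Independence of S-admissibility from the length of the window *)

Section ObservationAdmissibility.
Context {R : realType} {H Y : hilbertType R}.
Hypothesis sepH : separable H.
Hypothesis sepY : separable Y.
Variables (S : R -> H -> H) (A : partialOp H H).
Hypothesis hS : C0_semigroup S.
Hypothesis hA : is_generator S A.
Variables (beta : R[i]) (C : H -> Y).
Hypothesis rho : resolvent_set A beta.
Hypothesis bddC : bounded_on_H1 A beta C.
Local Notation mu := (@lebesgue_measure R).
Local Notation MR := (measurableTypeR R).
Local Notation I b := (`[0, b]%classic : set MR).

Lemma obs_outputP T (Psi : H -> R -> Y) :
  bounded_operator (V := sip_of H) (W := L2 T Y) Psi ->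
  (forall x, dom A x -> {ae mu, forall t, t \in `[0, T] -> Psi x t = C (S t x)}) <->
  (forall x, dom A x -> sip_norm (Psi x - (fun t => C (S t x)) : L2 T Y) = 0).
Proof.
move=> [dP _ _]; split=> h x dx; apply/(L2_norm_eq0 sepY);
  by [exact: dP|exact: (obs_orbit_dom sepY hS hA rho bddC)|exact: h].
Qed.

Lemma S_admissible_obs_le T T1 : T <= T1 -> S_admissible_obs S A C T1 -> S_admissible_obs S A C T.
Proof.
move=> TT1 [Psi [[dP lP [M MP]] [E bE Eoo]] aeP].
have dPle x := (L2_dom_le TT1 (dP x Logic.I)).1.
have Nle x := (L2_dom_le TT1 (dP x Logic.I)).2.
have hL := hs_L2 T1 sepY.
exists Psi; last first.
  move=> x dx; apply: ae_imp (aeP x dx) => t tP; rewrite in_itv /= => /andP[t0 tT].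
  by apply: tP; rewrite in_itv /= t0 (le_trans tT).
split; last first.
  exists E; first exact: bE.
  have le : (\esum_(e in E) (sip_norm (Psi e : L2 T Y) ^+ 2)%:E <=
      \esum_(e in E) (sip_norm (Psi e : L2 T1 Y) ^+ 2)%:E)%E.
    by apply: le_esum => e _; rewrite lee_fin lerXn2r ?nnegrE ?sip_norm_ge0.
  exact: le_lt_trans le Eoo.
split.
- by move=> x _; exact: dPle.
- move=> a u v _ _; apply/eqP; rewrite eq_le sip_norm_ge0 andbT -(lP a u v)//.
  apply: (L2_dom_le TT1 _).2; apply: (hs_domB hL); first exact: dP.
  by apply: (hs_domP hL); exact: dP.
- by exists M => v _; rewrite (le_trans (Nle v))// MP.
Qed.

(** The output on ]T, 2 T] is that of the state S(T) x, so Psi x is glued to Psi (S T x). The second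
    half is Hilbert-Schmidt by [esum_sqr_bounded_le] with K = S(T). *)
Lemma S_admissible_obs_double T : 0 <= T ->
  S_admissible_obs S A C T -> S_admissible_obs S A C (T + T).
Proof.
move=> T0 [Psi [bP [E bE Eoo]] aeP].
have [dP lP [M MP]] := bP; have {}dP x : sip_dom (L2 T Y) (Psi x) by exact: dP.
have NP := proj1 (obs_outputP bP) aeP.
have hL := hs_L2 T sepY; have linST := sg_lin hS T0.
have [K K0 KP] := sg_bound hS T.
have {}KP x : rnorm (S T x) <= K * rnorm x by apply: KP; rewrite T0 lexx.
pose Psi2 x := time_glue T (Psi x) (Psi (S T x)).
have dC x : dom A x -> sip_dom (L2 T Y) (fun t => C (S t x)) by exact: (obs_orbit_dom sepY hS hA rho bddC).
have d2 x := (time_glue_norm T0 (dP x) (dP (S T x))).1.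
have N2 x := (time_glue_norm T0 (dP x) (dP (S T x))).2.
have b2 : bounded_operator (V := sip_of H) (W := L2 (T + T) Y) Psi2.
  split.
  - by move=> x _; exact: d2.
  - move=> a u v _ _; apply/eqP; rewrite -sqrf_eq0; apply/eqP.
    rewrite /Psi2 linST -time_glueZD -time_glueB.
    have dD u' v' : sip_dom (L2 T Y) (Psi (a *: u' + v') - (a *: Psi u' + Psi v')).
      by apply: (hs_domB hL) => //; exact: (hs_domP hL).
    rewrite (time_glue_norm T0 (dD _ _) (dD _ _)).2.
    by rewrite (lP a u v Logic.I Logic.I) (lP a (S T u) (S T v) Logic.I Logic.I) !expr0n addr0.
  - exists (Num.max M 0 + Num.max M 0 * K) => x _; rewrite sip_norm_of.
    have M0 : 0 <= Num.max M 0 by rewrite le_max lexx orbT.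
    have MP' y : sip_norm (Psi y : L2 T Y) <= Num.max M 0 * rnorm y.
      rewrite (le_trans (MP y Logic.I))// sip_norm_of ler_wpM2r ?rnorm_ge0//.
      by rewrite le_max lexx.
    apply: (@le_trans _ _ (sip_norm (Psi x : L2 T Y) + sip_norm (Psi (S T x) : L2 T Y))).
      rewrite -ler_sqr ?nnegrE ?addr_ge0 ?sip_norm_ge0// N2 sqrrD.
      by rewrite -addrA lerD2l lerDr mulrn_wge0// mulr_ge0// sip_norm_ge0.
    rewrite mulrDl lerD// (le_trans (MP' _))// -mulrA ler_wpM2l//.
exists Psi2; last first.
  apply/(obs_outputP b2) => x dx.
  have [dSx _] := gen_sg hS hA T0 dx.
  have h0 : sip_norm (time_glue T (Psi x) (Psi (S T x)) -
      time_glue T (fun t => C (S t x)) (fun t => C (S t (S T x))) : L2 (T + T) Y) = 0.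
    apply/eqP; rewrite -sqrf_eq0 -time_glueB.
    have dB y dy := hs_domB hL (dP y) (dC y dy).
    by rewrite (time_glue_norm T0 (dB _ dx) (dB _ dSx)).2 !NP// !expr0n addr0.
  apply/(L2_norm_eq0 sepY); first exact: d2.
    exact: (obs_orbit_dom sepY hS hA rho bddC).
  have := proj1 (L2_norm_eq0 sepY (d2 x) (time_glue_norm T0 (dC _ dx) (dC _ dSx)).1) h0.
  apply: ae_imp => t tP tT; rewrite [LHS](tP tT) /time_glue; case: asboolP => // Tt.
  by rewrite -(sgD hS)// ?subrK// subr_ge0 ltW.
split; first exact: b2.
exists E; first exact: bE.
under eq_esum do rewrite N2 EFinD.
rewrite esumD; [|by move=> e _; rewrite lee_fin sqr_ge0..].
apply: lte_add_pinfty; first exact: Eoo.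
apply: (le_lt_trans (esum_sqr_bounded_le hL bE bP linST KP K0 bE)).
by apply: lte_mul_pinfty; rewrite ?lee_fin ?sqr_ge0.
Qed.

(** Double the window until it exceeds T, then restrict. *)
Lemma S_admissible_obs_indep T T1 : 0 < T1 -> S_admissible_obs S A C T1 ->
  S_admissible_obs S A C T.
Proof.
move=> T10 h1.
have dbl n : S_admissible_obs S A C (2 ^+ n * T1).
  elim: n => [|n IHn]; first by rewrite expr0 mul1r.
  rewrite exprS -mulrA mulr_natl mulr2n; apply: S_admissible_obs_double => //.
  by rewrite mulr_ge0 ?exprn_ge0// ltW.
pose n := Num.truncn (T / T1).
apply: (@S_admissible_obs_le _ (2 ^+ n.+1 * T1)) => //.
rewrite -ler_pdivrMr// ltW// (lt_le_trans (truncnS_gt _))//.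
by rewrite -natrX ler_nat ltnW// ltn_expl.
Qed.

End ObservationAdmissibility.

(** * The Hilbert-Schmidt integral of the Yosida extension, and part (i) *)

Lemma ae_countable {R : realType} (K : Type) (E : set K) (P : K -> R -> Prop) :
  countable E -> (forall e, E e -> {ae @lebesgue_measure R, forall t, P e t}) ->
  {ae @lebesgue_measure R, forall t, forall e, E e -> P e t}.
Proof.
move=> /countable_injP[f finj] h.
have : {ae @lebesgue_measure R, forall t, forall n e, E e -> f e = n -> P e t}.
  apply/ae_foralln => n.
  have [[e Ee fe]|none] := pselect (exists2 e, E e & f e = n).
    apply: ae_imp (h e Ee) => t Pt e' Ee' fe'.
    by rewrite (finj e' e) ?inE// fe' fe.
  by apply: aeW => t e Ee fe; case: none; exists e.
by apply: ae_imp => t h' e Ee; exact: (h' (f e)).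
Qed.

Section YosidaIntegral.
Context {R : realType} {H Y : hilbertType R}.
Hypothesis sepH : separable H.
Hypothesis sepY : separable Y.
Variables (S : R -> H -> H) (A : partialOp H H).
Hypothesis hS : C0_semigroup S.
Hypothesis hA : is_generator S A.
Variables (beta : R[i]) (C : H -> Y).
Hypothesis rho : resolvent_set A beta.
Hypothesis bddC : bounded_on_H1 A beta C.
Local Notation mu := (@lebesgue_measure R).
Local Notation MR := (measurableTypeR R).
Local Notation I b := (`[0, b]%classic : set MR).

(** The basis is countable, so for almost every t the values of the Yosida extension and of Psi
    agree at all basis vectors together; Tonelli exchanges sum and integral. *)
Lemma yosida_HS_integralE (E : set H) T (Psi : H -> R -> Y) :
  orthonormal_basis (V := sip_of H) E ->
  bounded_operator (V := sip_of H) (W := L2 T Y) Psi ->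
  (forall x, dom A x -> {ae mu, forall t, t \in `[0, T] -> Psi x t = C (S t x)}) ->
  (yosida_HS_integral S A C E T = \esum_(e in E) (sip_norm (Psi e : L2 T Y) ^+ 2)%:E)%E.
Proof.
move=> bE bP aeP.
have dP x : sip_dom (L2 T Y) (Psi x) by case: bP => h _ _; exact: h.
have cE := orthonormal_countable sepH (orthonormal_of_basis bE).
have mP e : measurable_fun (I T) (fun t => (rnorm (Psi e t) ^+ 2)%:E).
  by apply/measurable_EFinP; apply: measurable_sqnorm; case: (dP e).
have [mS iS] := @ge0_integral_esum R H E (I T) (fun e t => (rnorm (Psi e t) ^+ 2)%:E)
  cE (measurable_I T) (fun e _ => mP e) (fun e t _ _ => ltac:(by rewrite lee_fin sqr_ge0)).
transitivity (\int[mu]_(t in I T) (\esum_(e in E) (rnorm (Psi e t) ^+ 2)%:E)%E)%E.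
  apply: ge0_integral_ae_eq => //.
  - by move=> t _; apply: esum_ge0 => e _; rewrite lee_fin sqr_ge0.
  - by move=> t _; apply: esum_ge0 => e _; rewrite lee_fin sqr_ge0.
  have := ae_countable cE (fun e _ => yosida_orbit_eq sepY hS hA rho bddC bP aeP e).
  by apply: ae_imp => t h tT; apply: eq_esum => e Ee; rewrite h.
rewrite iS; apply: eq_esum => e Ee.
by rewrite (L2_sqnormE (dP e)).
Qed.

Lemma yosida_HS_integral_le (E : set H) T T1 : T <= T1 ->
  (yosida_HS_integral S A C E T <= yosida_HS_integral S A C E T1)%E.
Proof.
move=> TT1; rewrite /yosida_HS_integral integral_mkcond [leRHS]integral_mkcond.
have p0 b t : (0 <= ((fun t => \esum_(e in E) (rnorm (yosida A C (S t e)) ^+ 2)%:E) \_ (I b)) t)%E.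
  rewrite patchE; case: ifP => // _.
  by apply: esum_ge0 => e _; rewrite lee_fin sqr_ge0.
apply: ge0_integral_mono => t _ //.
rewrite [leLHS]patchE; case: ifPn => [|_]; last exact: p0.
rewrite inE /= in_itv /= => /andP[t0 tT].
by rewrite patchE mem_set//= in_itv /= t0 (le_trans tT).
Qed.

(** Forward, the bound of Psi gives admissibility. Backward, admissibility extends the output map to
    a bounded operator, and by [yosida_HS_integralE] the finite integral is its Hilbert-Schmidt
    sum. *)
Lemma S_admissible_obsP (E : set H) T : 0 < T -> orthonormal_basis (V := sip_of H) E ->
  S_admissible_obs S A C T <->
    (admissible_obs S A C /\
     exists2 T' : R, 0 < T' & (yosida_HS_integral S A C E T' < +oo)%E).
Proof.
move=> T0 bE; split=> [[Psi hs aeP]|[[al al0 [g g0 gP]] [T1 T10 fin]]].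
  have [bP Eoo] := (hilbert_schmidt_basis (hs_L2 T sepY) Psi bE).1 hs.
  split; last by exists T => //; rewrite (yosida_HS_integralE bE bP aeP).
  have NP := (obs_outputP sepY hS hA rho bddC bP).1 aeP.
  have [dP _ [M MP]] := bP; have {}dP x : sip_dom (L2 T Y) (Psi x) by exact: dP.
  exists T => //; exists (Num.max M 1); first by rewrite lt_max ltr01 orbT.
  move=> x dx; have dC := obs_orbit_dom sepY hS hA rho bddC T dx.
  rewrite -(L2_sqnormE dC) lee_fin -exprMn lerXn2r ?nnegrE ?sip_norm_ge0//.
    by rewrite mulr_ge0 ?rnorm_ge0// le_max ler01 orbT.
  have hL := hs_L2 T sepY.
  have := sip_triangle hL dC (dP x) (hs_dom0 hL).
  rewrite !subr0 (sip_normC hL dC (dP x)) NP// add0r => /le_trans; apply.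
  rewrite (le_trans (MP x Logic.I))// sip_norm_of ler_wpM2r ?rnorm_ge0//.
  by rewrite le_max lexx.
(* On this window both the admissibility estimate and the finiteness of the integral are
   available. *)
pose T2 := Num.min al T1.
have T20 : 0 < T2 by rewrite lt_min al0.
apply: (S_admissible_obs_indep sepY hS hA rho bddC T T20).
have hL := hs_L2 T2 sepY.
have dC x (dx : dom A x) := obs_orbit_dom sepY hS hA rho bddC al dx.
have T2al : T2 <= al by rewrite ge_min lexx.
have [|||||Psi [bP PsiE]] := @bounded_operator_extend R H (L2 T2 Y) hL (dom A)
    (fun x t => C (S t x)) g.
- by move=> a u v du dv; exact: (gen_linear hS hA a du dv).1.
- by move=> x e e0; exact: (gen_dense hS hA x e0).
- by move=> u du; exact: (L2_dom_le T2al (dC u du)).1.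
- move=> a u v du dv.
  have dC2 x (dx : dom A x) := obs_orbit_dom sepY hS hA rho bddC T2 dx.
  apply/(L2_norm_eq0 sepY).
  + by apply: dC2; exact: (gen_linear hS hA a du dv).1.
  + by apply: (hs_domP hL); exact: dC2.
  apply: aeW => t; rewrite in_itv /= => /andP[t0 _].
  rewrite (sg_lin hS t0) !fctE; case: bddC => lC _; apply: lC; exact: (gen_sg hS hA t0 _).1.
- move=> u du; have [_ /le_trans] := L2_dom_le T2al (dC u du); apply.
  have gu : 0 <= g * rnorm u by rewrite mulr_ge0 ?rnorm_ge0// ltW.
  rewrite -ler_sqr ?nnegrE ?sip_norm_ge0//.
  by rewrite -lee_fin L2_sqnormE; [rewrite exprMn gP|exact: dC].
have aeP := (obs_outputP sepY hS hA rho bddC bP).2 PsiE.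
exists Psi => //; apply/(hilbert_schmidt_basis hL _ bE); split => //.
rewrite -(yosida_HS_integralE bE bP aeP).
by apply: le_lt_trans fin; apply: yosida_HS_integral_le; rewrite ge_min lexx orbT.
Qed.

End YosidaIntegral.

(** * The adjoint semigroup and its generator *)

Lemma total_adjointE {R : realType} {V W : hilbertType R} (F : V -> W) x y :
  bounded_linear F -> inner (F x) y = inner x (adjoint (PartialOp setT F) y).
Proof.
move=> /bounded_linear_adjoint[G GP].
exact: (@xgetI _ 0 [set z | forall x, setT x -> inner (F x) y = inner x z] (G y)
  (fun x _ => GP x y)).
Qed.

Lemma inner_injr {R : realType} {V : hilbertType R} (D : set V) (y z : V) :
  (forall x : V, exists2 u : nat -> V, (forall n, D (u n)) & u @ \oo --> x) ->
  (forall x, D x -> inner x y = inner x z) -> y = z.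
Proof.
move=> Dd h; apply: rdot_injr => x; have [u Du ux] := Dd x.
have hy w : rdot (u n) w @[n --> \oo] --> rdot x w by exact: cvg_rdot.
apply: (cvg_unique (@Rhausdorff R) (hy y)).
rewrite (_ : (fun n => rdot (u n) y) = fun n => rdot (u n) z); first exact: hy.
by apply/funext => n; rewrite /rdot h.
Qed.

Section AdjointSemigroup.
Context {R : realType} {H : hilbertType R} (S : R -> H -> H) (A : partialOp H H).
Hypotheses (hS : C0_semigroup S) (hA : is_generator S A).
Variables (beta : R[i]) (rho : resolvent_set A beta).
Local Notation mu := (@lebesgue_measure R).
Local Notation I b := (`[0, b]%classic : set (measurableTypeR R)).
Local Notation As := (adjoint A).
Local Notation Ss := (adjoint_semigroup S).

Lemma adjoint_sgE t x y : 0 <= t -> inner (S t x) y = inner x (Ss t y).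
Proof. by move=> t0; exact: (total_adjointE x y (sg_bounded_linear hS t0)). Qed.

Lemma adjoint_sg_rdot t x y : 0 <= t -> rdot (S t x) y = rdot x (Ss t y).
Proof. by move=> t0; rewrite /rdot adjoint_sgE. Qed.

Lemma adjointP y : dom As y -> forall x, dom A x -> inner (A x) y = inner x (As y).
Proof.
move=> [z zP].
exact: (@xgetI _ 0 [set z | forall x, dom A x -> inner (A x) y = inner x z] z zP).
Qed.

Lemma adjoint_rdot y x : dom As y -> dom A x -> rdot (A x) y = rdot x (As y).
Proof. by move=> dy dx; rewrite /rdot (adjointP dy). Qed.

(** [adjoint] picks a value by [xget]; density of the domain of A makes it the only one. *)
Lemma adjoint_of y z : (forall x, dom A x -> inner (A x) y = inner x z) ->
  dom As y /\ As y = z.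
Proof.
move=> h; have dy : dom As y by exists z.
split=> //; apply: (inner_injr (gen_dense_seq hS hA)) => x dx.
by rewrite -(adjointP dy)// h.
Qed.

Lemma adjoint_sg_linear t : 0 <= t -> linear (Ss t).
Proof.
move=> t0 a x y; apply: rdot_injr => z.
rewrite -adjoint_sg_rdot// !rdotDr; congr (_ + _); last exact: adjoint_sg_rdot.
rewrite rdotC rdotZJ [RHS]rdotC rdotZJ [RHS]rdotC -adjoint_sg_rdot// (linZ (sg_lin hS t0)).
exact: rdotC.
Qed.

Lemma adjoint_sg_le t M y : 0 <= t -> 0 <= M -> (forall x, rnorm (S t x) <= M * rnorm x) ->
  rnorm (Ss t y) <= M * rnorm y.
Proof.
move=> t0 M0 h; apply: rnorm_le_rdot => [|x]; first by rewrite mulr_ge0// rnorm_ge0.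
rewrite rdotC -adjoint_sg_rdot// (le_trans (rdot_le _ _))// mulrAC ler_wpM2r ?rnorm_ge0//.
Qed.

Local Notation Rs := (adjoint (PartialOp setT (resolvent A beta))).

Lemma resolvent_adjoint_rdot x y : rdot (resolvent A beta x) y = rdot x (Rs y).
Proof. by rewrite /rdot (total_adjointE x y (resolvent_bounded hS hA rho)). Qed.

Lemma adjoint_of_rdot y z : (forall x, dom A x -> rdot (A x) y = rdot x z) ->
  dom As y /\ As y = z.
Proof.
move=> h; apply: adjoint_of => x dx; apply: inner_eq_rdot; first exact: h.
have [dix Aix] := genZ hS hA 'i dx.
by apply: oppr_inj; rewrite -!rdotiC -Aix h.
Qed.

Lemma resolvent_genE x : dom A x -> resolvent A beta (A x) = beta *: resolvent A beta x - x.
Proof.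
move=> dx; have linR := resolvent_linear hS hA rho.
rewrite {3}(resolvent_unique rho dx erefl) (linB linR) (linZ linR).
by rewrite opprB addrC subrK.
Qed.

(** The adjoint [Rs] of the resolvent inverts conj(beta) minus the adjoint of A: transpose R(beta,
    A) A x = beta R(beta, A) x - x. *)
Lemma resolvent_adjoint_dom y : dom As (Rs y) /\ beta^*%C *: Rs y - As (Rs y) = y.
Proof.
have [] : dom As (Rs y) /\ As (Rs y) = beta^*%C *: Rs y - y.
  apply: adjoint_of_rdot => x dx.
  rewrite -resolvent_adjoint_rdot resolvent_genE// rdotBr -rdotZJ -resolvent_adjoint_rdot.
  by rewrite rdotBl (linZ (resolvent_linear hS hA rho)).
by move=> d ->; split => //; rewrite opprB addrC subrK.
Qed.

Lemma resolvent_adjoint_unique y : dom As y -> Rs (beta^*%C *: y - As y) = y.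
Proof.
move=> dy; apply: rdot_injr => x; rewrite -resolvent_adjoint_rdot rdotBr -rdotZJ.
have [dR RE] := resolventP rho x.
by rewrite -adjoint_rdot// -rdotBl RE.
Qed.

Lemma resolvent_adjoint_le : exists2 M : R, 0 <= M & forall y, rnorm (Rs y) <= M * rnorm y.
Proof.
have [_ [M MP]] := resolvent_bounded hS hA rho.
exists (Num.max M 0) => [|y]; first by rewrite le_max lexx orbT.
apply: rnorm_le_rdot => [|x]; first by rewrite mulr_ge0 ?rnorm_ge0// le_max lexx orbT.
rewrite rdotC -resolvent_adjoint_rdot (le_trans (rdot_le _ _))// mulrAC ler_wpM2r ?rnorm_ge0//.
by rewrite (le_trans (MP x))// ler_wpM2r ?rnorm_ge0// le_max lexx.
Qed.

Lemma adjoint_resolvent_set : resolvent_set As beta^*%C.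
Proof.
split=> [y|].
  have [d e] := resolvent_adjoint_dom y; exists (Rs y); split => // x [dx <-].
  exact: resolvent_adjoint_unique.
have [M M0 MP] := resolvent_adjoint_le; exists M => x dx.
by rewrite -{1}(resolvent_adjoint_unique dx) MP.
Qed.

(** A vector u orthogonal to the range of [Rs] satisfies |R u|^2 = <u, Rs (R u)> = 0 with R the
    resolvent, and R is injective. *)
Lemma adjoint_dense (x : H) (e : R) : 0 < e -> exists2 y, dom As y & rnorm (y - x) < e.
Proof.
move=> e0.
have hD (r : R) u v : range Rs u -> range Rs v -> range Rs (r%:C *: u + v).
  move=> [u' _ <-] [v' _ <-]; exists (r%:C *: u' + v') => //.
  apply: rdot_injr => z; rewrite -resolvent_adjoint_rdot !rdotDr !rdotZr.
  by rewrite !resolvent_adjoint_rdot.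
have h0 : range Rs 0.
  by exists 0 => //; apply: rdot_injr => z; rewrite -resolvent_adjoint_rdot !rdot0r.
have [|y yR yx] := @dense_of_orthogonal R (sip_of H) hs_sip_of (range Rs) (fun _ _ => Logic.I) h0 hD _ x Logic.I.
  move=> u _ h; suff -> : u = 0 by rewrite (sip_norm0 hs_sip_of).
  apply: (resolvent_inj hS hA rho); apply: rnorm_eq0; apply/eqP; rewrite -sqrf_eq0 -rdotE.
  rewrite resolvent_adjoint_rdot rdotC; apply/eqP; apply: h.
  by exists (resolvent A beta u).
have [N _ hN] := (cvgrPdist_lt _ _).1 yx _ e0.
exists (y N).
  by have [z _ <-] := yR N; exact: (resolvent_adjoint_dom z).1.
have := hN N (leqnn N); rewrite sub0r normrN sip_norm_of.
by apply: le_lt_trans; rewrite ler_norm.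
Qed.

Lemma adjoint_sg_sub t y x : 0 <= t -> dom As y ->
  rdot x (Ss t y - y) = rdot (orbit_int S t x) (As y).
Proof.
move=> t0 dy; have [dI AI] := gen_orbit_int hS hA x t0.
by rewrite rdotBr -adjoint_sg_rdot// -rdotBl -AI adjoint_rdot.
Qed.

(** For y in the domain of the adjoint, [adjoint_sg_sub] bounds |Ss t y - y| by M |As y| t. Density
    and the uniform bound of the semigroup extend the continuity at 0 to all of H. *)
Lemma adjoint_sg_C0 : C0_semigroup Ss.
Proof.
split.
- move=> t t0; split; first exact: adjoint_sg_linear.
  have [_ [M MP]] := sg_bounded_linear hS t0.
  move=> x; apply: bounded_linear_cvg; last exact: cvg_id.
  split; first exact: adjoint_sg_linear.
  exists (Num.max M 0) => y; apply: adjoint_sg_le => [//||z]; first by rewrite le_max lexx orbT.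
  by rewrite (le_trans (MP z))// ler_wpM2r ?rnorm_ge0// le_max lexx.
- by move=> x; apply: rdot_injr => z; rewrite -adjoint_sg_rdot// (sg0 hS).
- move=> s t x s0 t0; apply: rdot_injr => z.
  rewrite -!adjoint_sg_rdot ?addr_ge0// addrC (sgD hS)//.
move=> x; have [M M0 MP] := sg_bound hS 1.
apply/cvg_rnormP => e e0.
(* Replacing x by y twice costs (M + 1) |x - y| < e / 2; the rest is left for M |As y| t. *)
have d0 : 0 < e / (2 * (M + 2)) by rewrite divr_gt0// mulr_gt0// ltr_wpDl.
have [y dy yx] := adjoint_dense x d0.
have K0 : 0 <= M * rnorm (As y) by rewrite mulr_ge0 ?rnorm_ge0.
have le1 t : 0 <= t <= 1 -> rnorm (Ss t y - y) <= M * rnorm (As y) * t.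
  move=> /andP[t0 t1]; apply: rnorm_le_rdot => [|z]; first by rewrite mulr_ge0.
  rewrite rdotC adjoint_sg_sub// (le_trans (rdot_le _ _))//.
  rewrite (_ : M * _ * t * _ = M * t * rnorm z * rnorm (As y)); last by ring.
  apply: (ler_wpM2r (rnorm_ge0 _)); apply: (orbit_int_le hS) => // u /andP[u0 ut].
  by apply: MP; rewrite u0 (le_trans ut).
have d1 : 0 < Num.min 1 (e / (2 * (M * rnorm (As y) + 1))).
  rewrite lt_min ltr01 /= divr_gt0// mulr_gt0//; exact: ltr_wpDl.
near=> t.
have t0 : 0 < t by near: t; exact: nbhs_right_gt.
have tlt : t < Num.min 1 (e / (2 * (M * rnorm (As y) + 1))) by near: t; exact: nbhs_right_lt.
move: tlt; rewrite lt_min => /andP[t1 t2].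
have t01 : 0 <= t <= 1 by rewrite !ltW.
have h1 := le1 _ t01.
have h2 : rnorm (Ss t (x - y)) <= M * rnorm (x - y).
  by apply: adjoint_sg_le; rewrite ?(ltW t0)// => z; exact: MP.
rewrite (linB (adjoint_sg_linear (ltW t0))) in h2.
have h3 : M * rnorm (As y) * t < e / 2.
  have K1 : 0 < M * rnorm (As y) + 1 by rewrite ltr_wpDl.
  rewrite invfM mulrA ltr_pdivlMr// in t2; apply: le_lt_trans t2.
  by rewrite mulrC (ler_wpM2l (ltW t0))// lerDl.
have h4 : (M + 1) * rnorm (x - y) < e / 2.
  rewrite rnormC in yx; have M2 : 0 < M + 2 by rewrite ltr_wpDl.
  rewrite invfM mulrA ltr_pdivlMr// in yx; apply: le_lt_trans yx.
  by rewrite mulrC (ler_wpM2l (rnorm_ge0 _))// lerD2l ler1n.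
have e1 : Ss t x - x = (Ss t x - Ss t y) + (Ss t y - y) + (y - x).
  by rewrite !subrKA.
rewrite e1 (le_lt_trans (rnormD _ _))// (le_lt_trans (lerD (rnormD _ _) (lexx _)))//.
rewrite mulrDl mul1r in h4; rewrite (rnormC y x); lra.
Unshelve. all: by end_near.
Qed.

Lemma adjoint_sg_orbit_int b y : 0 <= b -> dom As y -> Ss b y - y = orbit_int Ss b (As y).
Proof.
move=> b0 dy; apply: rdot_injr => x; rewrite adjoint_sg_sub// (rdotC x).
rewrite (orbit_intP adjoint_sg_C0 b (As y) x) (orbit_intP hS b x (As y)).
apply: eq_Rintegral => t; rewrite inE /= in_itv /= => /andP[t0 _].
by rewrite adjoint_sg_rdot// rdotC.
Qed.

(** On the domain of the adjoint, Ss b y - y is the orbit integral of [As y], which has derivative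
    [As y] at 0. Conversely, if the difference quotients at y converge, transposing them against
    those of S shows that y is in the domain. *)
Lemma adjoint_is_generator : is_generator Ss As.
Proof.
have lim y : dom As y -> (h^-1)%:C *: (Ss h y - y) @[h --> 0^'+] --> As y.
  move=> dy; have := orbit_int_deriv adjoint_sg_C0 (x := As y).
  apply: cvg_trans; apply: near_eq_cvg; near=> h.
  have h0 : 0 < h by near: h; exact: nbhs_right_gt.
  by rewrite adjoint_sg_orbit_int// ltW.
split=> [y|y dy]; last exact: lim.
split=> [dy|[z zP]]; first by exists (As y); exact: lim.
apply: (proj1 (adjoint_of_rdot (z := z) _)) => x dx.
have l1 : rdot ((h^-1)%:C *: (S h x - x)) y @[h --> 0^'+] --> rdot (A x) y.
  by apply: cvg_rdot; exact: (gen_cvg hA).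
have l2 : rdot ((h^-1)%:C *: (Ss h y - y)) x @[h --> 0^'+] --> rdot z x.
  exact: cvg_rdot.
rewrite (rdotC x); apply: (cvg_unique (@Rhausdorff R) l1).
move: l2; apply: cvg_trans; apply: near_eq_cvg; near=> h.
have h0 : 0 < h by near: h; exact: nbhs_right_gt.
rewrite !rdotZl; congr (_ * _); rewrite !rdotBl adjoint_sg_rdot ?ltW//.
by rewrite rdotC (rdotC y).
Unshelve. all: by end_near.
Qed.

End AdjointSemigroup.

(** * Limits along dense maps and linear isometries *)

Section DenseLimits.
Context {R : realType}.

Lemma cvg_of_rate {V : normedModType R[i]} (u : nat -> V) z :
  (forall n, rnorm (u n - z) <= 2^-1 ^+ n) -> u @ \oo --> z.
Proof.
move=> h; apply: (rnorm_squeeze (g := fun n => 2^-1 ^+ n)); first exact: nearW.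
by apply: cvg_expr; rewrite ger0_norm// invf_lt1// ltr1n.
Qed.

Lemma dense_rate {V : normedModType R[i]} (D : set V) z : dense D ->
  exists2 u : nat -> V, (forall n, D (u n)) & forall n, rnorm (u n - z) <= 2^-1 ^+ n.
Proof.
move=> dD.
have /choice[u uP] : forall n : nat, exists x, D x /\ rnorm (x - z) <= 2^-1 ^+ n.
  move=> n; have r0 : 0 < (2^-1 : R) ^+ n by rewrite exprn_gt0.
  have xB : (ball z ((2^-1 : R) ^+ n)%:C)^° !=set0.
    by exists z; apply: nbhsx_ballx; rewrite ltcR.
  have [y [yB Dy]] := dD _ xB (open_interior _); exists y; split => //.
  have := interior_subset yB.
  by rewrite -ball_normE /= rnormE ltcR rnormC => /ltW.
by exists u => n; case: (uP n).
Qed.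

Lemma rate_cauchy {V : normedModType R[i]} (u : nat -> V) z n :
  (forall n, rnorm (u n - z) <= 2^-1 ^+ n) -> rnorm (u n.+1 - u n) <= 2 * 2^-1 ^+ n.
Proof.
move=> h; rewrite (le_trans (rnorm_triangle _ z _))// (rnormC z).
have := h n; have := h n.+1; rewrite exprS.
have : 0 <= (2^-1 : R) ^+ n by rewrite exprn_ge0.
move: (_ ^+ n) => p; lra.
Qed.

Lemma rnorm_cvg_unique {V : normedModType R[i]} (u : nat -> V) (x y : V) :
  u @ \oo --> x -> u @ \oo --> y -> x = y.
Proof. by move=> ux uy; exact: (cvg_unique (@norm_hausdorff _ _) ux uy). Qed.

(** The real and imaginary parts are each bounded by the real Cauchy-Schwarz inequality; the factor
    2 is harmless for continuity. *)
Lemma rnorm_inner_le {V : hilbertType R} (x y : V) :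
  rnorm (inner x y : R[i]^o) <= 2 * (rnorm x * rnorm y).
Proof.
have h1 := rdot_CS x y; have h2 := rdot_CS x ('i *: y).
rewrite rnormZ -Im_inner in h2; rewrite /rdot in h1.
have i1 : rnorm ('i : R[i]^o) = 1.
  by apply/eqP; rewrite -(@eqrXn2 _ 2)// ?rnorm_ge0// sqr_rnormE /= expr0n expr1n add0r.
rewrite i1 mul1r in h2; have p0 := le_trans (normr_ge0 _) h1.
rewrite -ler_sqr ?nnegrE ?mulr_ge0 ?rnorm_ge0// sqr_rnormE.
rewrite -(real_normK (num_real (complex.Re _))) -(real_normK (num_real (complex.Im _))).
move: h1 h2 p0; move: (normr_ge0 (complex.Re (inner x y))) (normr_ge0 (complex.Im (inner x y))).
move: `|_| `|_| (_ * _) => a b p a0 b0 ap bp p0.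
have := ler_pM a0 a0 ap ap; have := ler_pM b0 b0 bp bp; rewrite -!expr2 exprMn.
have := sqr_ge0 p; lra.
Qed.

(** Density provides a sequence along which the value chosen by [xget] and w are limits of the same
    sequence. *)
Lemma dense_extensionE {X : Type} {Z W : normedModType R[i]} (j : X -> Z) (f : X -> W) z w :
  dense (range j) ->
  (forall x : nat -> X, j (x n) @[n --> \oo] --> z -> f (x n) @[n --> \oo] --> w) ->
  dense_extension j f z = w.
Proof.
move=> dj h; rewrite /dense_extension; case: xgetP => [w' _ w'P|/(_ w)/(_ h)//].
have [u uj uz] := dense_rate z dj.
have /choice[x xP] : forall n, exists x, j x = u n by move=> n; have [x _ <-] := uj n; exists x.
have jx : j (x n) @[n --> \oo] --> z.
  by rewrite (_ : (fun n => j (x n)) = u); [exact: cvg_of_rate|exact/funext].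
exact: (rnorm_cvg_unique (w'P x jx) (h x jx)).
Qed.

End DenseLimits.

Section LinearIsometry.
Context {R : realType} {V W : normedModType R[i]} (J : V -> W).
Hypotheses (linJ : linear J) (JN : forall z, rnorm (J z) = rnorm z).

Lemma isometry_bounded_linear : bounded_linear J.
Proof. by split => //; exists 1 => z; rewrite JN mul1r. Qed.

Lemma isometry_inj z w : J z = J w -> z = w.
Proof.
by move=> e; apply/eqP; rewrite -subr_eq0; apply/eqP/rnorm_eq0; rewrite -JN (linB linJ) e subrr rnorm0.
Qed.

Lemma isometry_cvg (u : nat -> V) z : J (u n) @[n --> \oo] --> J z -> u @ \oo --> z.
Proof.
move=> /cvg_rnorm0P h; apply/cvg_rnorm0P.
by under eq_fun do rewrite -JN (linB linJ).
Qed.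

End LinearIsometry.

(** * The extrapolation space realised in H by an isometry *)

Section Extrapolation.
Context {R : realType} {H : hilbertType R} {Hm1 : completeNormedModType R[i]}.
Variables (S : R -> H -> H) (A : partialOp H H).
Hypotheses (hS : C0_semigroup S) (hA : is_generator S A).
Variables (beta : R[i]) (rho : resolvent_set A beta).
Variables (j : {linear H -> Hm1}) (extrapH : is_extrapolation_space A beta j).
Local Notation Rb := (resolvent A beta).
Let linR := resolvent_linear hS hA rho.

Lemma extrapolation_seq (z : Hm1) : exists2 x : nat -> H,
  (forall n, rnorm (j (x n) - z) <= 2^-1 ^+ n) & j (x n) @[n --> \oo] --> z.
Proof.
have [u uj uz] := dense_rate z extrapH.2.
have /choice[x xP] : forall n, exists x, j x = u n by move=> n; have [x _ <-] := uj n; exists x.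
have h n : rnorm (j (x n) - z) <= 2^-1 ^+ n by rewrite xP.
by exists x => //; exact: cvg_of_rate.
Qed.

Lemma extrapolation_normB x y : rnorm (j x - j y) = rnorm (Rb x - Rb y).
Proof. by rewrite -linearB extrapH.1 (linB linR). Qed.

(** Since |j x| = |R(beta, A) x|, the resolvent extends from the dense range of j to an isometry. It
    is onto because the range of the resolvent is dense in H and H_{-1} is complete. *)
Lemma extrapolation_isometry : exists J : Hm1 -> H,
  [/\ linear J, forall z, rnorm (J z) = rnorm z, forall x, J (j x) = Rb x
    & forall v, exists z, J z = v].
Proof.
have /choice[J JP] : forall z : Hm1, exists v : H, forall x : nat -> H,
    j (x n) @[n --> \oo] --> z -> Rb (x n) @[n --> \oo] --> v.
  move=> z; have [u uz juz] := extrapolation_seq z.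
  have [n|l ul _] := @geometric_cauchy_cvg _ _ (fun n => Rb (u n)) 2.
    by rewrite -extrapolation_normB (rate_cauchy n uz).
  exists l => x xz.
  have h0 : Rb (x n) - Rb (u n) @[n --> \oo] --> (0 : H).
    have : j (x n) - j (u n) @[n --> \oo] --> (0 : Hm1) by rewrite -(subrr z); exact: cvgB.
    move=> /cvg_rnorm0P h; apply/cvg_rnorm0P.
    under eq_fun do rewrite subr0 -extrapolation_normB -[_ - _]subr0.
    exact: h.
  rewrite -[l]add0r (_ : (fun n => Rb (x n)) = fun n => (Rb (x n) - Rb (u n)) + Rb (u n)).
    exact: cvgD.
  by apply/funext => n; rewrite subrK.
have Jj x : J (j x) = Rb x.
  by apply: (rnorm_cvg_unique (u := fun=> Rb x)); [apply: JP|]; exact: cvg_cst.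
have JN z : rnorm (J z) = rnorm z.
  have [u uz juz] := extrapolation_seq z.
  have h1 : rnorm (Rb (u n)) @[n --> \oo] --> rnorm z.
    by under eq_fun do rewrite -extrapH.1; exact: cvg_rnorm.
  apply: (cvg_unique (@Rhausdorff R)) h1.
  by apply: cvg_rnorm; exact: JP.
have linJ : linear J.
  move=> a z w; have [u _ juz] := extrapolation_seq z; have [v _ jvw] := extrapolation_seq w.
  have h : j (a *: u n + v n) @[n --> \oo] --> a *: z + w.
    by under eq_fun do rewrite linearP; apply: cvgD => //; exact: cvgZr.
  apply: (rnorm_cvg_unique (JP _ _ h)).
  by under eq_fun do rewrite linR; apply: cvgD; [apply: cvgZr|]; exact: JP.
exists J; split => // v.
have [u du _] := gen_dense_seq hS hA v.
have /choice[w wP] : forall n : nat, exists x, rnorm (Rb x - v) <= 2^-1 ^+ n.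
  move=> n; have e0 : 0 < (2^-1 : R) ^+ n by rewrite exprn_gt0.
  have [x dx xv] := gen_dense hS hA v e0; exists (beta *: x - A x).
  by rewrite -(resolvent_unique rho dx erefl) ltW.
have [n|z jz _] := @geometric_cauchy_cvg _ _ (fun n => j (w n)) 2.
  by rewrite extrapolation_normB (rate_cauchy n wP).
exists z; apply: (rnorm_cvg_unique (JP z w jz)).
exact: cvg_of_rate.
Qed.

Section Isometry.
Variable J : Hm1 -> H.
Hypotheses (linJ : linear J) (JN : forall z, rnorm (J z) = rnorm z).
Hypotheses (Jj : forall x, J (j x) = Rb x) (Jsurj : forall v, exists z, J z = v).

(** The resolvent commutes with the semigroup, so J conjugates the extension to S. Surjectivity of J
    supplies the limit that [dense_extensionE] needs. *)
Lemma extrapolated_sgE t z : 0 <= t -> J (extrapolated_semigroup j S t z) = S t (J z).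
Proof.
move=> t0; have [w wE] := Jsurj (S t (J z)).
rewrite /extrapolated_semigroup (@dense_extensionE _ _ _ _ _ _ z w) //; first exact: extrapH.2.
move=> x xz; apply: (isometry_cvg linJ JN); under eq_fun do rewrite Jj (resolvent_sg hS hA rho)//.
rewrite wE; apply: (bounded_linear_cvg (sg_bounded_linear hS t0)).
under eq_fun do rewrite -Jj.
exact: (bounded_linear_cvg (isometry_bounded_linear linJ JN)).
Qed.

(** On H this is <x, y> = <R(beta, A) x, conj(beta) y - adjoint A y>; the right side is continuous
    for the norm of H_{-1} and so gives the extension. *)
Lemma pivot_pairingE z y : dom (adjoint A) y ->
  pivot_pairing j z y = inner (J z) (beta^*%C *: y - adjoint A y).
Proof.
move=> dy; rewrite /pivot_pairing.
apply: (@dense_extensionE R H Hm1 R[i]^o j (fun x => inner x y) z); first exact: extrapH.2.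
move=> x xz.
have h : J (j (x n)) @[n --> \oo] --> J z by exact: (bounded_linear_cvg (isometry_bounded_linear linJ JN)).
set w := beta^*%C *: y - _.
have xE n : inner (x n) y = inner (J (j (x n))) w.
  have e u : rdot u y = rdot (Rb u) w.
    have [dR RE] := resolventP rho u.
    by rewrite /w rdotBr -rdotZJ -adjoint_rdot// -rdotBl RE.
  rewrite Jj; apply: inner_eq_rdot => //.
  by apply: oppr_inj; rewrite -!rdotiC e (linZ linR).
under eq_fun do rewrite xE.
apply: (@rnorm_squeeze _ R[i]^o _ _ _ _ _ (fun n => 2 * (rnorm (J (j (x n)) - J z) * rnorm w))).
  by apply: nearW => n; rewrite -linearBl rnorm_inner_le.
rewrite -[X in _ --> X](mulr0 2); apply: cvgM; first exact: cvg_cst.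
rewrite -[X in _ --> X](mul0r (rnorm w)); apply: cvgM; last exact: cvg_cst.
exact/cvg_rnorm0P.
Qed.

End Isometry.
End Extrapolation.

(** * The Bochner integral in a space isometric to a Hilbert space *)

Section BochnerIntegral.
Context {R : realType} {V : normedModType R[i]} {H : hilbertType R}.
Variable J : V -> H.
Hypotheses (linJ : linear J) (JN : forall z, rnorm (J z) = rnorm z).
Hypothesis Jsurj : forall v, exists z, J z = v.
Variable T : R.
Local Notation mu := (@lebesgue_measure R).
Local Notation MR := (measurableTypeR R).
Local Notation I := (`[0, T]%classic : set MR).
Let mI : measurable I := measurable_I T.

Lemma strongly_measurable_isometry (f : R -> V) :
  strongly_measurable T (fun t => J (f t)) -> strongly_measurable T f.
Proof.
have /choice[K KP] := Jsurj.
move=> [p sp pf]; exists (fun n t => K (p n t)) => [n|t tT].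
  have [fp mp] := sp n; split.
    apply: (sub_finite_set _ (finite_image K fp)) => _ [t _ <-].
    by exists (p n t) => //; exists t.
  move=> v; rewrite (_ : _ @^-1` _ = p n @^-1` [set J v])//.
  apply/seteqP; split=> t /= e; first by rewrite -e KP.
  by apply: (isometry_inj linJ JN); rewrite KP.
by apply: (isometry_cvg linJ JN); under eq_fun do rewrite KP; exact: pf.
Qed.

Lemma simple_integral_rdot (s : R -> V) y : simple s ->
  mu.-integrable I (EFin \o (fun t => rdot (J (s t)) y)) /\
  rdot (J (simple_integral T s)) y = Rintegral mu I (fun t => rdot (J (s t)) y).
Proof.
move=> [fs ms]; pose X : seq V := finmap.enum_fset (fset_set (range s)).
have JE (K : choiceType) (r : seq K) (F : K -> V) :
    rdot (J (\sum_(i <- r) F i)) y = \sum_(i <- r) rdot (J (F i)) y.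
  by elim/big_rec2: _ => [|i a b _ <-]; rewrite ?(lin0 linJ) ?rdot0l// (linD linJ) rdotDl.
pose c v := rdot (J v) y.
have gE v t : \1_(s @^-1` [set v]) t = (s t == v)%:R :> R.
  by rewrite indicE; congr ((nat_of_bool _)%:R); apply/idP/eqP; rewrite inE.
have cE t : rdot (J (s t)) y = \sum_(v <- X) c v * \1_(s @^-1` [set v]) t.
  have sX : s t \in X by rewrite in_fset_set// inE; exists t.
  under eq_bigr do rewrite gE.
  rewrite (bigD1_seq (s t)) ?finmap.fset_uniq//= eqxx mulr1 big1 ?addr0//.
  by move=> v; rewrite eq_sym => /negPf ->; rewrite mulr0.
have iX v : mu.-integrable I (EFin \o (fun t => c v * \1_(s @^-1` [set v]) t)).
  apply: integrable_RZ => //; apply: (le_integrable mI _ _ (integrable_cst_I T 1)).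
    by apply/measurable_EFinP; apply: measurable_indic; exact: ms.
  by move=> t _; rewrite /= lee_fin normr1 indicE; case: (_ \in _); rewrite ?normr1 ?normr0.
have h (r : seq V) : mu.-integrable I (EFin \o (fun t => \sum_(v <- r) c v * \1_(s @^-1` [set v]) t)) /\
    Rintegral mu I (fun t => \sum_(v <- r) c v * \1_(s @^-1` [set v]) t) =
    \sum_(v <- r) c v * fine (mu (I `&` s @^-1` [set v])).
  elim: r => [|v r [ir IHr]].
    under [X in EFin \o X]eq_fun do rewrite big_nil.
    under [X in Rintegral mu I X]eq_fun do rewrite big_nil.
    by split; [exact: integrable_cst_I|rewrite big_nil Rintegral_cst// mul0r].
  under [X in EFin \o X]eq_fun do rewrite big_cons.
  under [X in Rintegral mu I X]eq_fun do rewrite big_cons.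
  split; first exact: integrable_RD.
  rewrite RintegralD// IHr big_cons; congr (_ + _).
  rewrite RintegralZl//; last first.
    apply: (le_integrable mI _ _ (integrable_cst_I T 1)).
      by apply/measurable_EFinP; apply: measurable_indic; exact: ms.
    by move=> t _; rewrite /= lee_fin normr1 indicE; case: (_ \in _); rewrite ?normr1 ?normr0.
  by rewrite /Rintegral integral_indic; [rewrite setIC| |exact: ms].
rewrite (_ : (fun t => rdot (J (s t)) y) = fun t => \sum_(v <- X) c v * \1_(s @^-1` [set v]) t);
  last exact/funext.
split; first exact: (h X).1.
rewrite (h X).2 /simple_integral fsbig_finite//= JE; apply: eq_bigr => v _.
by rewrite (linZ linJ) rdotZl mulrC.
Qed.

Section Integrand.
Variable f : R -> V.
Hypothesis mf : strongly_measurable T f.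
Hypothesis intf : (\int[mu]_(t in I) (rnorm (f t))%:E < +oo)%E.

Lemma isometry_measurable_rdot y : measurable_fun I (fun t => rdot (J (f t)) y).
Proof.
apply: (measurable_fun_caratheodory (phi := fun=> fun v => rdot (J v) y) mf).
  by move=> v; exact: measurable_cst.
move=> t _ x l xl; apply: cvg_rdot.
exact: (bounded_linear_cvg (isometry_bounded_linear linJ JN)).
Qed.

Lemma integrable_rnorm : mu.-integrable I (EFin \o (fun t => rnorm (f t))).
Proof.
apply/integrableP; split; first by apply/measurable_EFinP; exact: measurable_rnorm.
by under eq_integral do rewrite /= ger0_norm ?rnorm_ge0//.
Qed.

Lemma isometry_weak_integral : exists w, weak_integral I (fun t => J (f t)) w.
Proof.
apply: (weak_integral_exists mI (k := fun t => rnorm (f t))).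
- exact: isometry_measurable_rdot.
- exact: integrable_rnorm.
- by move=> t _; rewrite JN.
Qed.

Lemma simple_integral_dist (s : R -> V) w : simple s ->
  weak_integral I (fun t => J (f t)) w ->
  ((rnorm (J (simple_integral T s) - w))%:E <= \int[mu]_(t in I) (rnorm (f t - s t))%:E)%E.
Proof.
move=> ss wP.
have [->|foo] := eqVneq (\int[mu]_(t in I) (rnorm (f t - s t))%:E)%E +oo%E; first exact: leey.
have md : measurable_fun I (fun t => rnorm (f t - s t)).
  apply: (measurable_fun_simple (phi := fun t v => rnorm (f t - v)) ss) => v.
  exact: measurable_rnormB.
have id : mu.-integrable I (EFin \o (fun t => rnorm (f t - s t))).
  apply/integrableP; split; first exact/measurable_EFinP.
  by under eq_integral do rewrite /= ger0_norm ?rnorm_ge0//; rewrite ltey.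
have If y : mu.-integrable I (EFin \o (fun t => rdot (J (f t)) y)).
  apply: (integrable_rdot_dominated mI y isometry_measurable_rdot integrable_rnorm).
  by move=> t _; rewrite JN.
have dE t y : rdot (J (f t - s t)) y = rdot (J (f t)) y - rdot (J (s t)) y.
  by rewrite (linB linJ) rdotBl.
have h : weak_integral I (fun t => J (f t - s t)) (w - J (simple_integral T s)).
  move=> y; have [is_ sE] := simple_integral_rdot y ss.
  by under eq_Rintegral do rewrite dE; rewrite RintegralB// rdotBl sE wP.
have mj y : measurable_fun I (fun t => rdot (J (f t - s t)) y).
  rewrite (_ : (fun t => _) = fun t => rdot (J (f t)) y - rdot (J (s t)) y);
    last by apply/funext => t; exact: dE.
  apply: measurable_funB; first exact: isometry_measurable_rdot.
  by have [/integrableP[/measurable_EFinP]] := simple_integral_rdot y ss.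
have nj (t : MR) : I t -> rnorm (J (f t - s t)) <= rnorm (f t - s t) by rewrite JN.
rewrite rnormC; have := weak_integral_norm mI mj id nj h.
rewrite -lee_fin => /le_trans; apply.
by rewrite /Rintegral fineK//; exact: integrable_fin_num id.
Qed.

Lemma simple_integral_cvg (s : nat -> R -> V) w : (forall n, simple (s n)) ->
  weak_integral I (fun t => J (f t)) w ->
  (\int[mu]_(t in I) (rnorm (f t - s n t))%:E)%E @[n --> \oo] --> 0%E ->
  J (simple_integral T (s n)) @[n --> \oo] --> w.
Proof.
move=> ss wP h; apply/cvg_rnorm0P.
suff : (rnorm (J (simple_integral T (s n)) - w))%:E @[n --> \oo] --> 0%E by move/fine_cvgP => [].
apply: (squeeze_cvge _ (cvg_cst 0%E) h); apply: nearW => n.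
by rewrite lee_fin rnorm_ge0 simple_integral_dist.
Qed.

(** The given simple functions converge pointwise only. Setting them to 0 where their norm exceeds 2
    |f| keeps the limit and bounds the error by 3 |f|, so dominated convergence applies. *)
Lemma simple_approx : exists2 s : nat -> R -> V, (forall n, simple (s n)) &
  (\int[mu]_(t in I) (rnorm (f t - s n t))%:E)%E @[n --> \oo] --> 0%E.
Proof.
have [p sp pf] := mf.
pose B n : set MR := I `&` [set t | rnorm (p n t) <= 2 * rnorm (f t)].
have mp n : measurable_fun I (fun t => rnorm (p n t)).
  by apply: (measurable_fun_simple (phi := fun=> rnorm) (sp n)) => v; exact: measurable_cst.
have mB n : measurable (B n).
  apply: measurable_fun_le => //; apply: measurable_funM => //; exact: measurable_rnorm.
pose s n t := if `[< B n t >] then p n t else 0.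
have ss n : simple (s n) by apply: simple_if => //; exact: simple_cst.
exists s => //.
have sle n t : I t -> rnorm (f t - s n t) <= 3 * rnorm (f t).
  move=> It; rewrite /s; case: asboolP => [[_ /= Bt]|_].
    by have := rnormB (f t) (p n t); lra.
  by rewrite subr0; have := rnorm_ge0 (f t); lra.
have scvg t : I t -> rnorm (f t - s n t) @[n --> \oo] --> (0 : R).
  move=> It; have pft := pf t It.
  have [f0|fn0] := eqVneq (rnorm (f t)) 0.
    rewrite (_ : (fun n => _) = fun=> 0); first exact: cvg_cst.
    apply/funext => n; apply/eqP; rewrite eq_le rnorm_ge0 andbT.
    by rewrite (le_trans (sle n t It))// f0 mulr0.
  have f0 : 0 < rnorm (f t) by rewrite lt_neqAle eq_sym fn0 rnorm_ge0.
  have /cvg_rnorm0P := pft; apply: cvg_trans; apply: near_eq_cvg.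
  have /cvg_rnormP/(_ _ f0) := pft; apply: filterS => n pn.
  rewrite rnormC /s asboolT// /B; split => //=.
  by have := rnormD (p n t - f t) (f t); rewrite subrK; lra.
have md n : measurable_fun I (fun t => rnorm (f t - s n t)).
  apply: (measurable_fun_simple (phi := fun t v => rnorm (f t - v)) (ss n)) => v.
  exact: measurable_rnormB.
have ig : mu.-integrable I (EFin \o (fun t => 3 * rnorm (f t))).
  by apply: integrable_RZ => //; exact: integrable_rnorm.
have [] := @dominated_convergence _ MR R mu I mI (fun n t => (rnorm (f t - s n t))%:E)
  (cst 0%E) (EFin \o (fun t => 3 * rnorm (f t))).
- by move=> n; exact/measurable_EFinP.
- exact: measurable_cst.
- by apply: aeW => t It; apply: cvg_EFin; [exact: nearW|exact: scvg].
- exact: ig.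
- by apply: aeW => t n It; rewrite /= lee_fin ger0_norm ?rnorm_ge0// sle.
by move=> _ _; rewrite integral0.
Qed.

(** The weak integral w of J f exists by Riesz, and by [simple_integral_dist] the integrals of any
    simple functions approximating f in mean converge to it. This shows both that a Bochner integral
    exists and that the one chosen by [xget] is sent to w. *)
Lemma bochner_integralE : weak_integral I (fun t => J (f t)) (J (bochner_integral T f)).
Proof.
have [w wP] := isometry_weak_integral; have [z zw] := Jsurj w.
have [s ss sf] := simple_approx.
have zP : is_bochner_integral T f z.
  split => //; exists s; split => //; apply: (isometry_cvg linJ JN).
  by rewrite zw; exact: simple_integral_cvg.
have [_ [s' [ss' sf' sz']]] := xgetI 0 zP : is_bochner_integral T f (bochner_integral T f).
have h1 := simple_integral_cvg ss' wP sf'.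
have h2 : J (simple_integral T (s' n)) @[n --> \oo] --> J (bochner_integral T f).
  exact: (bounded_linear_cvg (isometry_bounded_linear linJ JN)).
by rewrite -(rnorm_cvg_unique h1 h2).
Qed.

End Integrand.
End BochnerIntegral.

(** * Reversal of time on L2 *)

Section TimeReversal.
Context {R : realType} {Y : hilbertType R}.
Hypothesis sepY : separable Y.
Variable T : R.
Local Notation mu := (@lebesgue_measure R).
Local Notation MR := (measurableTypeR R).
Local Notation I := (`[0, T]%classic : set MR).
Implicit Types f g : R -> Y.

(** The time T - t, written in the form s * t + c of the affine lemmas with s = -1. *)
Definition time_rev f t : Y := f (- 1 * t + T).

Lemma time_revK f : time_rev (time_rev f) = f.
Proof. by apply/funext => t; rewrite /time_rev; congr f; ring. Qed.

Lemma time_revB f g : time_rev (f - g) = time_rev f - time_rev g.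
Proof. by []. Qed.

Lemma time_rev_itv t : t \in `[0, T] -> - 1 * t + T \in `[0, T].
Proof. by rewrite !in_itv /= => /andP[t0 tT]; apply/andP; split; lra. Qed.

Lemma time_rev_norm f : sip_dom (L2 T Y) f ->
  sip_dom (L2 T Y) (time_rev f) /\ sip_norm (time_rev f : L2 T Y) = sip_norm (f : L2 T Y).
Proof.
move=> df; have [mf foo] := df.
have mr : strongly_measurable T (time_rev f).
  exact: (strongly_measurable_affine (s := -1) (c := T) time_rev_itv mf).
have sE : sqnorm_integral T (time_rev f) = sqnorm_integral T f.
  have pre : (fun t => -1 * t + T) @^-1` I = I.
    apply/seteqP; split => t /=; last exact: time_rev_itv.
    by rewrite !in_itv /= => /andP[? ?]; apply/andP; split; lra.
  have := @ge0_integral_affine R (-1) T I (fun t => (rnorm (f t) ^+ 2)%:E) _ (measurable_I T).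
  rewrite pre; apply; first by rewrite normrN1.
    by apply/measurable_EFinP; exact: measurable_sqnorm.
  by move=> t _; rewrite lee_fin sqr_ge0.
have dr : sip_dom (L2 T Y) (time_rev f) by split => //; rewrite sE.
split => //; apply/eqP; rewrite -(@eqrXn2 _ 2)// ?sip_norm_ge0//; apply/eqP.
by apply: EFin_inj; rewrite !L2_sqnormE.
Qed.

Lemma time_rev_bounded_operator (V : sipSpace R) (F : V -> L2 T Y) :
  hilbert_sip V ->
  bounded_operator F -> bounded_operator (fun v => time_rev (F v) : L2 T Y).
Proof.
have hL := hs_L2 T sepY.
move=> hV [dF lF [M MP]]; split.
- by move=> v dv; exact: (time_rev_norm (dF v dv)).1.
- move=> a u v du dv.
  have d : sip_dom (L2 T Y) (F (a *: u + v) - (a *: F u + F v)).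
    apply: (hs_domB hL); last by apply: (hs_domP hL); exact: dF.
    by apply: dF; exact: (hs_domP hV).
  exact: (etrans (time_rev_norm d).2 (lF a u v du dv)).
- by exists M => v dv; rewrite (time_rev_norm (dF v dv)).2 MP.
Qed.

End TimeReversal.

(** * Control operators: duality with observation of the adjoint semigroup, part (ii) *)

Section Control.
Context {R : realType} {H U : hilbertType R} {Hm1 : completeNormedModType R[i]}.
Hypotheses (sepH : separable H) (sepU : separable U).
Variables (S : R -> H -> H) (A : partialOp H H).
Hypotheses (hS : C0_semigroup S) (hA : is_generator S A).
Variables (beta : R[i]) (rho : resolvent_set A beta).
Variables (j : {linear H -> Hm1}) (extrapH : is_extrapolation_space A beta j).
Variables (B : {linear U -> Hm1}) (ctsB : continuous B).
Local Notation mu := (@lebesgue_measure R).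
Local Notation MR := (measurableTypeR R).
Local Notation I b := (`[0, b]%classic : set MR).
Local Notation As := (adjoint A).
Local Notation Ss := (adjoint_semigroup S).
Local Notation Bs := (control_adjoint j B).
Local Notation hSs := (adjoint_sg_C0 hS hA rho).
Local Notation hAs := (adjoint_is_generator hS hA rho).

Section Isometry.
Variable J : Hm1 -> H.
Hypotheses (linJ : linear J) (JN : forall z, rnorm (J z) = rnorm z).
Hypotheses (Jj : forall x, J (j x) = resolvent A beta x) (Jsurj : forall v, exists z, J z = v).

Lemma control_bounded_linear : bounded_linear (fun u => J (B u)).
Proof.
have linB : linear B by move=> a x y; rewrite linearP.
have [_ [M MP]] := continuous_bounded_linear linB ctsB.
by split => [a x y|]; [rewrite linB linJ|exists M => x; rewrite JN].
Qed.

(** With b = J B bounded from U to H, the adjoint of B at y is the adjoint of b at conj(beta) y - As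
    y, by [pivot_pairingE]. *)
Lemma control_adjoint_rdot u y : dom As y ->
  rdot u (Bs y) = rdot (J (B u)) (beta^*%C *: y - As y).
Proof.
move=> dy; have [G GP] := bounded_linear_adjoint control_bounded_linear.
have h : forall u, pivot_pairing j (B u) y = inner u (G (beta^*%C *: y - As y)).
  by move=> u'; rewrite (pivot_pairingE hS hA rho extrapH linJ JN Jj)// GP.
have := @xgetI _ 0 [set v | forall u, pivot_pairing j (B u) y = inner u v] _ h.
move=> /(_ u) e; rewrite /rdot -e.
by rewrite (pivot_pairingE hS hA rho extrapH linJ JN Jj).
Qed.

Lemma control_adjoint_bounded : bounded_on_H1 As beta^*%C Bs.
Proof.
have lA a x y (dx : dom As x) (dy : dom As y) := gen_linear hSs hAs a dx dy.
split=> [a x y dx dy|].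
  have [dxy AE] := lA a x y dx dy.
  have e (v : R[i]) : beta^*%C *: (v *: x + y) - (v *: As x + As y) =
      v *: (beta^*%C *: x - As x) + (beta^*%C *: y - As y).
    by rewrite scalerDr scalerBr opprD addrACA !scalerA mulrC.
  apply: rdot_injr => u; rewrite control_adjoint_rdot// AE e [LHS]rdotDr [RHS]rdotDr.
  rewrite -(control_adjoint_rdot u dy); congr (_ + _).
  rewrite rdotC rdotZJ rdotC -[in RHS](conjcK a) -rdotZJ.
  by rewrite control_adjoint_rdot// linearZ (linZ linJ).
have [_ [M MP]] := control_bounded_linear.
exists (Num.max M 0) => y dy.
have M0 : 0 <= Num.max M 0 by rewrite le_max lexx orbT.
apply: rnorm_le_rdot => [|u]; first by rewrite mulr_ge0 ?rnorm_ge0.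
rewrite rdotC control_adjoint_rdot// (le_trans (rdot_le _ _))// mulrAC ler_wpM2r ?rnorm_ge0//.
by rewrite (le_trans (MP u))// ler_wpM2r ?rnorm_ge0// le_max lexx.
Qed.

Variable T : R.

(** J turns the integrand in H_{-1} into S(T - s) b u(s) with b = J B; it is measurable and bounded
    by a multiple of |u(s)|, so [bochner_integralE] applies. *)
Lemma input_map_weak u : sip_dom (L2 T U) u ->
  weak_integral (I T) (fun s => S (T - s) (J (B (u s)))) (J (input_map j S B T u)).
Proof.
move=> du; have [mu_ foo] := du.
have bb := control_bounded_linear.
pose f s := extrapolated_semigroup j S (T - s) (B (u s)).
have fE s : s \in `[0, T] -> J (f s) = S (T - s) (J (B (u s))).
  rewrite in_itv /= => /andP[s0 sT].
  by rewrite (extrapolated_sgE hS hA rho extrapH linJ JN Jj Jsurj)// subr_ge0.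
have mf : strongly_measurable T f.
  apply: (strongly_measurable_isometry linJ JN Jsurj).
  have [p sp pf] : strongly_measurable T (fun s => S (T - s) (J (B (u s)))).
    apply: (strongly_measurable_caratheodory (F := fun s v => S (T - s) (J (B v))) sepH mu_).
      move=> v.
      have h : strongly_measurable T (fun t => S t (J (B v))).
        apply: strongly_measurableP_cont => //; exact: sg_orbit_within.
      have [p sp pf] := strongly_measurable_affine (@time_rev_itv R T) h.
      by exists p => // t tT; have := pf t tT; rewrite mulN1r addrC.
    move=> t; rewrite in_itv /= => /andP[t0 tT] x l xl.
    apply: (bounded_linear_cvg (sg_bounded_linear hS _)); first by rewrite subr_ge0.
    exact: (bounded_linear_cvg bb).
  by exists p => // t tT; rewrite fE//; exact: pf.
have [_ [K KP]] := bb; have [M M0 MP] := sg_bound hS T.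
have iu : mu.-integrable (I T) (EFin \o (fun t => M * Num.max K 0 * rnorm (u t))).
  apply: integrable_RZ; first exact: measurable_I.
  by have := integrable_rnormB 0 du; under [X in EFin \o X]eq_fun do rewrite subr0.
have intf : (\int[mu]_(t in I T) (rnorm (f t))%:E < +oo)%E.
  have /integrableP[_] := iu; apply: le_lt_trans; apply: ge0_integral_mono.
    by move=> t _; rewrite lee_fin rnorm_ge0.
  move=> t tT; rewrite lee_fin -JN fE// (le_trans _ (ler_norm _))//.
  have t1 : 0 <= T - t <= T by move: tT; rewrite /= in_itv /= => /andP[? ?]; apply/andP; split; lra.
  rewrite (le_trans (MP _ t1 _))// -mulrA ler_wpM2l// (le_trans (KP _))//.
  by rewrite ler_wpM2r ?rnorm_ge0// le_max lexx.
move=> y; rewrite (bochner_integralE linJ JN Jsurj mf intf y).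
by apply: eq_Rintegral => t; rewrite inE => tT; rewrite fE.
Qed.

Local Notation orb y := (fun t => Bs (Ss t y)).

(** Under the integral move S(T - s) to the other side and apply [control_adjoint_rdot]: the output
    of y appears at time T - s. *)
Lemma input_map_rdot u y : sip_dom (L2 T U) u -> dom As y ->
  rdot (J (input_map j S B T u)) (beta^*%C *: y - As y) =
  sip_rdot (u : L2 T U) (time_rev T (orb y)).
Proof.
move=> du dy; rewrite input_map_weak// L2_rdotE; apply: eq_Rintegral => t.
rewrite inE /= in_itv /= => /andP[t0 tT].
have r0 : 0 <= T - t by rewrite subr_ge0.
have [dS AS] := gen_sg hSs hAs r0 dy.
have linSs := adjoint_sg_linear hS r0.
rewrite (adjoint_sg_rdot hS)// (linB linSs) (linZ linSs) -AS.
rewrite -(control_adjoint_rdot (u t) dS).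
by rewrite /time_rev mulN1r addrC.
Qed.

(** J j is the resolvent, and its adjoint [Rs] has the domain of As as range and undoes conj(beta) -
    As. So the equation in H_{-1} becomes a family of scalar equations in which neither J nor the
    Bochner integral occurs. *)
Lemma input_map_factorP (Phi : (R -> U) -> H) :
  (forall u, sip_dom (L2 T U) u -> j (Phi u) = input_map j S B T u) <->
  (forall u y, sip_dom (L2 T U) u -> dom As y ->
     rdot (Phi u) y = sip_rdot (u : L2 T U) (time_rev T (orb y))).
Proof.
split=> [h u y du dy|h u du].
  rewrite -input_map_rdot// -h// Jj (resolvent_adjoint_rdot hS hA rho).
  by rewrite (resolvent_adjoint_unique hS hA rho).
apply: (isometry_inj linJ JN); apply: rdot_injl => w.
have [dy wE] := resolvent_adjoint_dom hS hA rho w.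
by rewrite Jj (resolvent_adjoint_rdot hS hA rho) h// -input_map_rdot// wE.
Qed.

End Isometry.

Lemma control_adjoint_on_H1 : bounded_on_H1 As beta^*%C Bs.
Proof.
have [J [linJ JN Jj Jsurj]] := extrapolation_isometry hS hA rho extrapH.
exact: (control_adjoint_bounded linJ JN Jj).
Qed.

(** By [input_map_factorP], Phi and the reversed output map are adjoint to each other. From Phi take
    the reversal of its adjoint, from Psi the adjoint of its reversal; reversal is isometric and
    adjoints have the same Hilbert-Schmidt sum. *)
Lemma S_admissible_ctrlP T :
  S_admissible_ctrl j S B T <-> S_admissible_obs Ss As Bs T.
Proof.
have [J [linJ JN Jj Jsurj]] := extrapolation_isometry hS hA rho extrapH.
have factP := input_map_factorP linJ JN Jj Jsurj T.
have hL := hs_L2 T sepU; have hH := @hs_sip_of R H.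
have rhos := adjoint_resolvent_set hS hA rho.
have dorb y (dy : dom As y) := obs_orbit_dom sepU hSs hAs rhos control_adjoint_on_H1 T dy.
have obsP := obs_outputP sepU hSs hAs rhos control_adjoint_on_H1 (T := T).
have [E bE] := exists_orthonormal_basis hH.
(* Equality with the output holds in L2 only up to norm 0, which is tested by pairing with all
   inputs. *)
have zero (v : R -> U) : sip_dom (L2 T U) v ->
    (forall u, sip_dom (L2 T U) u -> sip_rdot (u : L2 T U) v = 0) ->
    sip_norm (v : L2 T U) = 0.
  move=> dv h; apply/eqP; rewrite eq_le sip_norm_ge0 andbT.
  apply: (sip_norm_ge_rdot hL) => // u du.
  by rewrite (sip_rdotC hL)// h// mul0r.
split=> [[Phi [bPhi [L bL Loo]] PhiE]|[Psi [bPsi [L bL Loo]] PsiE]].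
- have [G bG GE] := operator_adjoint hL hH bPhi.
  have bR := time_rev_bounded_operator sepU hH bG.
  have [dG _ _] := bG; have {}dG y : sip_dom (L2 T U) (G y) by exact: dG.
  exists (fun y => time_rev T (G y)); last first.
    apply/(obsP _ bR) => y dy.
    have dO := dorb y dy.
    rewrite -[X in _ - X](time_revK T) -time_revB.
    have dR := (time_rev_norm dO).1.
    have dB := hs_domB hL (dG y) dR.
    rewrite (time_rev_norm dB).2; apply: zero => // u du.
    rewrite (sip_rdotBr hL)//; apply/eqP; rewrite subr_eq0; apply/eqP.
    transitivity (rdot (Phi u) y); first by rewrite /sip_rdot -GE.
    exact: (proj1 (factP Phi) PhiE).
  split => //; exists E => //.
  rewrite (eq_esum (b := fun e => (sip_norm (G e : L2 T U) ^+ 2)%:E)).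
    by rewrite -(esum_sqr_adjoint hL hH bL bE _ _ GE)//; case: bPhi.
  by move=> e _; rewrite (time_rev_norm (dG e)).2.
- have bR := time_rev_bounded_operator sepU hH bPsi.
  have [G bG GE] := operator_adjoint hH hL bR.
  have [dP _ _] := bPsi; have {}dP y : sip_dom (L2 T U) (Psi y) by exact: dP.
  have NP := proj1 (obsP _ bPsi) PsiE.
  exists G; last first.
    apply/factP => u y du dy.
    have dO := dorb y dy; have [dR NR] := time_rev_norm dO.
    have [dR' _] := time_rev_norm (dP y).
    transitivity (sip_rdot (time_rev T (Psi y) : L2 T U) u).
      by rewrite rdotC /sip_rdot (GE y u Logic.I du).
    apply: etrans (sip_rdotC hL dR du).
    apply: (sip_rdot_eq_of_norm0 hL dR' dR du).
    exact: (etrans (time_rev_norm (hs_domB hL (dP y) dO)).2 (NP y dy)).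
  have [L' bL'] := exists_orthonormal_basis hL.
  split => //; exists L' => //.
  rewrite -(esum_sqr_adjoint hH hL bL bL' _ _ GE); [|by case: bR|by case: bG].
  apply: le_lt_trans Loo; apply: le_esum => e _.
  by rewrite (time_rev_norm (dP e)).2.
Qed.

End Control.

Theorem proposition3p4 (R : realType) (H U Y : hilbertType R)
  (sepH : separable H) (sepU : separable U) (sepY : separable Y)
  (S : R -> H -> H) (semigroupS : C0_semigroup S)
  (A : partialOp H H) (genA : is_generator S A)
  (beta : R[i]) (rho_beta : resolvent_set A beta)
  (Hm1 : completeNormedModType R[i]) (j : {linear H -> Hm1})
  (extrapH : is_extrapolation_space A beta j)
  (B : {linear U -> Hm1}) (ctsB : continuous B)
  (C : H -> Y) (bddC : bounded_on_H1 A beta C)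
  (T : R) (T_gt0 : 0 < T)
  (E : set H) (onbE : orthonormal_basis (V := sip_of H) E) :
  let As := adjoint A in
  let Ss := adjoint_semigroup S in
  let Bs := control_adjoint j B in
  [/\ S_admissible_obs S A C T <->
        (admissible_obs S A C /\
         exists2 T' : R, 0 < T' & (yosida_HS_integral S A C E T' < +oo)%E),
      S_admissible_ctrl j S B T <-> S_admissible_obs Ss As Bs T
    & S_admissible_ctrl j S B T <->
        (admissible_obs Ss As Bs /\
         exists2 T' : R, 0 < T' & (yosida_HS_integral Ss As Bs E T' < +oo)%E)].
Proof.
move=> As Ss Bs.
have hSs := adjoint_sg_C0 semigroupS genA rho_beta.
have hAs := adjoint_is_generator semigroupS genA rho_beta.
have rhos := adjoint_resolvent_set semigroupS genA rho_beta.
have bddBs := control_adjoint_on_H1 semigroupS genA rho_beta extrapH ctsB.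
have dual := S_admissible_ctrlP sepH sepU semigroupS genA rho_beta extrapH ctsB T.
split; [exact: (S_admissible_obsP sepH sepY semigroupS genA rho_beta bddC)|exact: dual|].
by rewrite dual; exact: (S_admissible_obsP sepH sepU hSs hAs rhos bddBs).
Qed.
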